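(* Let $F$ be a finite set of places of $\mathbb{Q}$ containing the archimedean place $\infty$, consisting of $\infty$ and $m$ primes, and let $u=\rho_\infty\prod_{p\in F\setminus\{\infty\}}\rho_p$ be the associated product of $m+1$ ratios of local $L$-factors. Then (the restriction to the critical line $\Re(z)=\frac12$ of) $u$ is a quasi-inner function relative to $\mathbb{C}_-=\{z\in\mathbb{C}\mid \Re(z)\le\frac12\}$.
   Context: Local factors and ratios: $\gamma_\infty(z):=\pi^{-z/2}\Gamma(z/2)$, $\gamma_p(z):=(1-p^{-z})^{-1}$ for a prime $p$, and $\rho_v(z):=\gamma_v(z)/\gamma_v(1-z)$ for $v=\infty$ or $v=p$. These functions have modulus $1$ on the critical line $\partial\mathbb{C}_-=\{\Re(z)=\frac12\}$. Hardy space: $L^2(\partial\mathbb{C}_-)$ is taken with respect to Lebesgue measure on the line; $H^2(\mathbb{C}_-)\subset L^2(\partial\mathbb{C}_-)$ is the closed subspace of boundary values of holomorphic functions $f$ on $\{\Re(z)<\frac12\}$ with $\sup_{x<1/2}\int_{\mathbb{R}}|f(x+iy)|^2dy<\infty$. Let $\mathcal{P}$ be the orthogonal projection of $L^2(\partial\mathbb{C}_-)$ onto $H^2(\mathbb{C}_-)$. Quasi-inner: a function $u\in L^\infty(\partial\mathbb{C}_-)$ with $u\bar u=1$ is quasi-inner relative to $\mathbb{C}_-$ if the operator $(1-\mathcal{P})u\mathcal{P}$ on $L^2(\partial\mathbb{C}_-)$ is compact, where $u$ acts by multiplication. *)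

(* Defs.v *)
From HB Require Import structures.
From mathcomp Require Import all_boot all_order all_algebra finmap.
From mathcomp Require Import generic_quotient ring_quotient complex.
From mathcomp Require Import all_classical all_reals all_analysis.
From mathcomp Require Import measurable_realfun.

Set Implicit Arguments.
Unset Strict Implicit.
Unset Printing Implicit Defensive.

Import Order.TTheory GRing.Theory Num.Theory.
Import numFieldNormedType.Exports.
Import Normc.

Local Open Scope classical_set_scope.
Local Open Scope ring_scope.
Local Open Scope complex_scope.

(* the real-valued projections, as opposed to [Num.Def.Re] and [Num.Def.Im] *)
Local Notation Re := complex.Re.
Local Notation Im := complex.Im.

Section ComplexIntegration.
Context (R : realType).
Local Notation mu := (@lebesgue_measure R).

Definition cmeasurable (D : set R) (f : R -> R[i]) : Prop :=
  measurable_fun D (fun t => Re (f t)) /\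
  measurable_fun D (fun t => Im (f t)).

Definition cintegral (D : set R) (f : R -> R[i]) : R[i] :=
  (\int[mu]_(t in D) Re (f t)) +i* (\int[mu]_(t in D) Im (f t)).

End ComplexIntegration.

Section L2.
Context (R : realType).
Local Notation mu := (@lebesgue_measure R).

Definition L2fun : {pred R -> R[i]^o} :=
  [pred f : R -> R[i]^o |
    `[< cmeasurable setT f /\ finite_norm mu 2%:E (@normc R \o f) >]].

Definition L2eNorm (f : R -> R[i]) : \bar R :=
  'N[mu]_2%:E [EFin \o (@normc R \o f)].

Lemma measurable_normc (D : set R) (f : R -> R[i]) :
  measurable D -> cmeasurable D f -> measurable_fun D (@normc R \o f).
Proof.
move=> mD [mr mi].
have -> : @normc R \o f =
    (fun t => Num.sqrt (Re (f t) ^+ 2 + Im (f t) ^+ 2)) :> (R -> R).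
  by apply/funext => t /=; case: (f t).
apply: (@measurableT_comp _ _ _ _ _ _ (@Num.sqrt R)).
  exact: (continuous_measurable_fun (@sqrt_continuous R)).
by apply: measurable_funD; apply: measurable_funX.
Qed.

Lemma cmeasurableD (f g : R -> R[i]) : cmeasurable setT f ->
  cmeasurable setT g -> cmeasurable setT (f \+ g).
Proof.
move=> [fr fi] [gr gi]; split.
- rewrite (_ : (fun _ => _) = (fun t => Re (f t)) \+ (fun t => Re (g t))).
    exact: measurable_funD.
  by apply/funext => t /=; case: (f t) (g t) => ? ? [].
- rewrite (_ : (fun _ => _) = (fun t => Im (f t)) \+ (fun t => Im (g t))).
    exact: measurable_funD.
  by apply/funext => t /=; case: (f t) (g t) => ? ? [].
Qed.

Lemma cmeasurableZ (a : R[i]) (f : R -> R[i]) : cmeasurable setT f ->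
  cmeasurable setT (fun t => a * f t).
Proof.
move=> [fr fi]; case: a => a b; split.
- rewrite (_ : (fun _ => _) =
    (fun t => a * Re (f t) - b * Im (f t))) //.
    by apply: measurable_funB; apply: measurable_funM.
  by apply/funext => t; case: (f t).
- rewrite (_ : (fun _ => _) =
    (fun t => a * Im (f t) + b * Re (f t))) //.
    by apply: measurable_funD; apply: measurable_funM.
  by apply/funext => t; case: (f t).
Qed.

Lemma normc_ge0 (z : R[i]) : 0 <= normc z.
Proof. by case: z => a b; exact: sqrtr_ge0. Qed.

Lemma le_nm (f g : R -> R) : measurable_fun setT f -> measurable_fun setT g ->
  (forall t, 0 <= f t <= g t) ->
  ('N[mu]_2%:E [EFin \o f] <= 'N[mu]_2%:E [EFin \o g])%E.
Proof.
move=> mf mg fg; rewrite unlock.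
have mp (h : R -> R) : measurable_fun setT h ->
    measurable_fun setT (fun x : R => (`|(h x)%:E| `^ 2%R)%E : \bar R).
  move=> mh; apply: (measurableT_comp (measurable_poweR _)).
  by apply: measurableT_comp => //; exact/measurable_EFinP.
have ige (h : R -> R) : (0 <= \int[mu]_x (`|(h x)%:E| `^ 2%R)%E)%E.
  by apply: integral_ge0 => x _; exact: poweR_ge0.
apply: gt0_ler_poweR; rewrite ?in_itv/= ?leey ?invr_ge0 ?ige//=.
apply: ge0_le_integral => //=; [exact: mp|exact: mp|].
move=> x _; rewrite lee_fin; apply: ge0_ler_powR; rewrite ?nnegrE ?normr_ge0 //.
by have /andP[h1 h2] := fg x; rewrite !ger0_norm // (le_trans h1).
Qed.

Lemma nmD (f g : R -> R[i]) : cmeasurable setT f -> cmeasurable setT g ->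
  (L2eNorm (f \+ g)%R <= L2eNorm f + L2eNorm g)%E.
Proof.
move=> mf mg.
have mnf := measurable_normc measurableT mf.
have mng := measurable_normc measurableT mg.
have mnfg := measurable_normc measurableT (cmeasurableD mf mg).
have h1 : (L2eNorm (f \+ g)%R <=
    'N[mu]_2%:E [EFin \o ((@normc R \o f) \+ (@normc R \o g))%R])%E.
  apply: le_nm => //; first exact: measurable_funD.
  by move=> t /=; rewrite normc_ge0 le_normcD.
apply: (le_trans h1).
by apply: eminkowski => //; rewrite lee_fin ler1n.
Qed.

Lemma nmZ (a : R[i]) (f : R -> R[i]) : cmeasurable setT f ->
  L2eNorm (fun t => a * f t) = ((normc a)%:E * L2eNorm f)%E.
Proof.
move=> mf; rewrite /L2eNorm unlock.
have mnf := measurable_normc measurableT mf.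
under eq_integral => x _.
  rewrite /= normcM normrM powRM // EFinM ger0_norm ?normc_ge0 //.
  over.
rewrite /= ge0_integralZl //=; last 2 first.
- apply/measurable_EFinP; apply: (measurableT_comp (measurable_powR _)).
  exact: measurableT_comp.
- by rewrite lee_fin powR_ge0.
rewrite poweRM ?lee_fin ?powR_ge0 //; last first.
  by apply: integral_ge0 => x _; rewrite lee_fin powR_ge0.
by rewrite poweR_EFin -powRrM divff // powRr1 ?normc_ge0.
Qed.

Lemma cmeasurable0 : cmeasurable setT (0 : R -> R[i]^o).
Proof. by split; exact: measurable_cst. Qed.

Lemma nm0 : L2eNorm (0 : R -> R[i]^o) = 0%E.
Proof.
rewrite /L2eNorm (_ : EFin \o _ = cst 0%E); first exact: Lnorm0.
by apply/funext => t; congr (_%:E); exact: normc0.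
Qed.

Lemma L2fun_submod_closed : submod_closed L2fun.
Proof.
split.
  apply/asboolP; split; first exact: cmeasurable0.
  by rewrite /finite_norm -/(L2eNorm 0) nm0.
move=> a f g /asboolP[mf nf] /asboolP[mg ng]; apply/asboolP.
have maf := cmeasurableZ a mf.
split; first exact: (cmeasurableD maf mg).
apply: (le_lt_trans (nmD maf mg)); rewrite nmZ //.
by rewrite lte_add_pinfty // lte_mul_pinfty // lee_fin normc_ge0.
Qed.

HB.instance Definition _ :=
  GRing.isSubmodClosed.Build _ _ L2fun L2fun_submod_closed.

Record L2funType := L2Fun { L2val :> R -> R[i]^o; _ : L2val \in L2fun }.
HB.instance Definition _ := [isSub for L2val].
HB.instance Definition _ := [Choice of L2funType by <:].
HB.instance Definition _ := [SubChoice_isSubLmodule of L2funType by <:].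

Definition aezero : {pred L2funType} :=
  [pred f : L2funType | `[< \forall t \ae mu, f t = 0 >]].

Lemma aezero_zmod_closed : zmod_closed aezero.
Proof.
split; first by apply/asboolP; exact: aeW.
move=> f g /asboolP f0 /asboolP g0; apply/asboolP.
apply: (@filterS2 _ _ (ae_filter_ringOfSetsType mu) _ _ _ _ f0 g0).
by move=> t /= ft gt; rewrite [LHS]/(f t - g t) ft gt; exact: (@subrr R[i] 0).
Qed.

HB.instance Definition _ :=
  GRing.isZmodClosed.Build _ aezero aezero_zmod_closed.

Definition L2line := Quotient.quot aezero.
HB.instance Definition _ := GRing.Zmodule.on L2line.

Lemma aezeroZ (a : R[i]) (f : L2funType) : f \in aezero -> a *: f \in aezero.
Proof.
move=> /asboolP f0; apply/asboolP.
apply: (@filterS _ _ (ae_filter_ringOfSetsType mu) _ _ _ f0) => t ft.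
by rewrite [LHS]/(a * f t) ft; exact: (@mulr0 R[i]). 
Qed.

Local Open Scope quotient_scope.

Lemma eqL2P (f g : L2funType) :
  reflect (\pi_L2line f = \pi_L2line g) (f - g \in aezero).
Proof. by rewrite (Quotient.idealrBE aezero f g); exact: eqP. Qed.

Definition L2scale (a : R[i]) (x : L2line) : L2line :=
  \pi_L2line (a *: (repr x : L2funType)).

Lemma L2scale_pi a f : L2scale a (\pi_L2line f) = \pi_L2line (a *: f).
Proof.
apply/eqL2P; rewrite -scalerBr; apply: aezeroZ; apply/eqL2P.
exact: reprK.
Qed.

Lemma L2piD f g : \pi_L2line (f + g) = \pi_L2line f + \pi_L2line g.
Proof. exact: (@Quotient.pi_add _ aezero). Qed.

Lemma L2scaleA a b x : L2scale a (L2scale b x) = L2scale (a * b) x.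
Proof.
elim/quotW: x => f.
by rewrite (L2scale_pi b f) (L2scale_pi (a * b) f) L2scale_pi scalerA.
Qed.

Lemma L2scale1 : left_id 1 L2scale.
Proof. by elim/quotW => f; rewrite L2scale_pi scale1r. Qed.

Lemma L2scaleDr : right_distributive L2scale +%R.
Proof.
move=> a; elim/quotW => f; elim/quotW => g.
by rewrite -L2piD (L2scale_pi a f) (L2scale_pi a g) L2scale_pi scalerDr L2piD.
Qed.

Lemma L2scaleDl x : {morph L2scale^~ x : a b / a + b}.
Proof.
elim/quotW: x => f a b.
by rewrite (L2scale_pi a f) (L2scale_pi b f) L2scale_pi scalerDl L2piD.
Qed.

HB.instance Definition _ := GRing.Zmodule_isLmodule.Build R[i] L2line
  L2scaleA L2scale1 L2scaleDr L2scaleDl.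

Definition L2norm (x : L2line) : R[i] :=
  (fine (L2eNorm (repr x : L2funType)))%:C.

Lemma nm_fin (f : L2funType) : L2eNorm f \is a fin_num.
Proof.
case: f => f /= /asboolP[_ nf]; rewrite ge0_fin_numE //; exact: Lnorm_ge0.
Qed.

Lemma L2valP (f : L2funType) : cmeasurable setT f.
Proof. by case: f => f /= /asboolP[]. Qed.

Lemma nm_eq0 (f : L2funType) : f \in aezero <-> L2eNorm f = 0%E.
Proof.
have mnf := measurable_normc measurableT (L2valP f).
split=> [/asboolP f0|].
  rewrite -nm0 /L2eNorm unlock; congr (_ `^ _)%E.
  apply: ae_eq_integral => //.
  - apply: (measurableT_comp (measurable_poweR _)).
    by apply: measurableT_comp => //; exact/measurable_EFinP.
  - apply: (measurableT_comp (measurable_poweR _)).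
    apply: measurableT_comp => //; apply/measurable_EFinP.
    exact: (measurable_normc measurableT cmeasurable0).
  - apply: (@filterS _ _ (ae_filter_ringOfSetsType mu) _ _ _ f0) => t ft _.
    by rewrite /= ft.
move=> n0; apply/asboolP.
have mE := (measurable_EFinP _ _).2 mnf.
have p0 : (0 < 2%:E :> \bar R)%E by rewrite lte_fin.
have := @Lnorm_eq0_eq0 _ (measurableTypeR R) R mu _ _ mE p0 n0.
apply: (@filterS _ _ (ae_filter_ringOfSetsType mu)) => t /(_ I) [].
exact: eq0_normc.
Qed.

Lemma L2norm_pi (f : L2funType) : L2norm (\pi_L2line f) = (fine (L2eNorm f))%:C.
Proof.
congr (fine _)%:C.
have le (g h : L2funType) : g - h \in aezero -> (L2eNorm g <= L2eNorm h)%E.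
  move=> /nm_eq0 gh; have /= := nmD (L2valP (g - h)) (L2valP h).
  rewrite (_ : _ \+ _ = g :> (R -> R[i])) ?gh ?add0e //.
  by apply/funext => t; exact: subrK.
apply/eqP; rewrite eq_le !le //; apply/eqL2P; rewrite reprK //.
Qed.

Lemma L2norm_triangle x y : L2norm (x + y) <= L2norm x + L2norm y.
Proof.
elim/quotW: x => f; elim/quotW: y => g.
rewrite -L2piD !L2norm_pi -rmorphD lecR /=.
rewrite -fineD ?nm_fin // fine_le ?nm_fin ?fin_numD ?nm_fin //.
  exact: (nm_fin (f + g)).
exact: (nmD (L2valP f) (L2valP g)).
Qed.

Lemma L2normZ a x : L2norm (a *: x) = `|a| * L2norm x.
Proof.
elim/quotW: x => f; rewrite [_ *: _]L2scale_pi !L2norm_pi.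
have -> : L2eNorm (a *: f) = ((normc a)%:E * L2eNorm f)%E.
  exact: (nmZ a (L2valP f)).
by rewrite fineM ?nm_fin // rmorphM.
Qed.

Lemma L2norm_eq0 x : L2norm x = 0 -> x = 0.
Proof.
elim/quotW: x => f; rewrite L2norm_pi => -[/eqP]; rewrite fine_eq0 ?nm_fin // => /eqP.
move=> /nm_eq0 f0; rewrite -[RHS](@pi_zeror _ _ _ _ _ L2line).
by apply/eqL2P; rewrite subr0.
Qed.

HB.instance Definition _ := Lmodule_isNormed.Build R[i] L2line
  L2norm_triangle L2normZ L2norm_eq0.

(* The class of a function, with value 0 on functions that are not
   square-integrable. *)
Definition L2class (f : R -> R[i]) : L2line :=
  \pi_L2line (insubd (0 : L2funType) (f : R -> R[i]^o)).

Definition L2repr (x : L2line) : R -> R[i] := (repr x : L2funType).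

Definition L2dot (x y : L2line) : R[i] :=
  cintegral setT (fun t => L2repr x t * (L2repr y t)^*%C).

Definition L2mul (u : R -> R[i]) (x : L2line) : L2line :=
  L2class (fun t => u t * L2repr x t).

(* The orthogonal projection onto H. The value 0 is only used where no
   orthogonal projection exists, which does not happen for a closed subspace. *)
Definition L2proj (H : set L2line) (x : L2line) : L2line :=
  xget 0 [set h | H h /\ forall k, H k -> L2dot (x - h) k = 0].

End L2.

Section Hardy.
Context (R : realType).
Local Notation mu := (@lebesgue_measure R).

Definition holomorphic_on (D : set R[i]) (F : R[i] -> R[i]) : Prop :=
  forall z, D z -> derivable (F : R[i]^o -> R[i]^o) z 1.

Definition open_half_plane : set R[i] := [set z | Re z < 2^-1].

Definition hardy_bounded (F : R[i] -> R[i]) : Prop :=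
  (ereal_sup [set \int[mu]_y (normc (F (x +i* y)%R) ^+ 2)%:E
             | x in [set x : R | x < 2^-1]%R] < +oo)%E.

(* Boundary values on the critical line are taken as the limit in L^2 of the
   restrictions of F to the vertical lines Re z = x when x tends to 1/2. *)
Definition hardy : set (L2line R) :=
  [set g | exists F : R[i] -> R[i],
    [/\ holomorphic_on open_half_plane F, hardy_bounded F &
        L2class (fun y => F (x +i* y)) @[x --> (2^-1 : R)^'-] --> g]].

Definition compact_operator (V : normedModType R[i]) (T : V -> V) : Prop :=
  linear T /\ precompact (T @` [set x | `|x| <= 1]).

Definition critical_line (t : R) : R[i] := 2^-1 +i* t.

(* A function on the critical line is given through the parametrization
   [critical_line], which carries Lebesgue measure to Lebesgue measure. *)
Definition quasi_inner (u : R -> R[i]) : Prop :=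
  [/\ cmeasurable setT u, finite_norm mu +oo (@normc R \o u),
      \forall t \ae mu, u t * (u t)^*%C = 1 &
      let P := L2proj hardy in
      compact_operator (fun x => L2mul u (P x) - P (L2mul u (P x)))].

End Hardy.

Section LocalFactors.
Context (R : realType).

Definition cexp (z : R[i]) : R[i] :=
  (expR (Re z) * cos (Im z)) +i* (expR (Re z) * sin (Im z)).

(* a ^ z for a real number a > 0 *)
Definition cpow (a : R) (z : R[i]) : R[i] := cexp (z * (ln a)%:C).

(* Euler's integral, which converges for Re z > 0 *)
Definition Euler_integral (z : R[i]) : R[i] :=
  cintegral `]0, +oo[ (fun t => cpow t (z - 1) * (expR (- t))%:C).

(* The meromorphic continuation through Gamma (z + n) = z ... (z + n - 1) Gamma z:
   n is 0 when Re z > 0, and the least natural number such that Re z + n > 0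
   otherwise. The value at the poles is 0. *)
Definition Gamma (z : R[i]) : R[i] :=
  let n := Num.truncn (1 - Re z) in
  Euler_integral (z + n%:R) / \prod_(k < n) (z + k%:R).

Definition place : choiceType := option {p : nat | prime p}.
Definition archimedean : place := None.

Definition local_factor (v : place) (z : R[i]) : R[i] :=
  if v is Some p then (1 - cpow (val p)%:R (- z))^-1
  else cpow pi (- z / 2) * Gamma (z / 2).

Definition local_ratio (v : place) (z : R[i]) : R[i] :=
  local_factor v z / local_factor v (1 - z).

Definition ratio_product (F : {fset place}) (z : R[i]) : R[i] :=
  local_ratio archimedean z *
  \prod_(p <- (F `\ archimedean)%fset) local_ratio p z.

End LocalFactors.

(* Main.v *)
From HB Require Import structures.
Require Import Defs.
From mathcomp Require Import all_boot all_order all_algebra finmap.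
From mathcomp Require Import generic_quotient ring_quotient complex.
From mathcomp Require Import all_classical all_reals all_analysis.
From mathcomp Require Import measurable_realfun ess_sup_inf ring lra.

(** Why the theorem holds.

    The line is parametrized by t, with z = 1/2 + it.  Call a bounded function v
    tame when Hankel-type operators g |-> v g - P (v g) on the Hardy space H are
    compact ([hcompact]).  Tame functions are closed under sums and uniform
    limits, every v with v H contained in H is tame because its operator is zero,
    and a simple pole 1/(z - c) with Re c < 0 is tame because its operator has
    rank one.  A tame function of modulus one is quasi-inner ([hcompact_compact],
    [quasi_inner_of_hcompact]); it remains to see that the product of ratios is
    tame.

    Membership in H has a characterization by integrals ([hardyP]): g is in H if
    and only if the integrals of g(t) / (it - d) vanish for all d with Re d > 0.
    One direction is Cauchy's theorem on vertical strips, deduced from Goursat's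
    lemma on rectangles.  For the other direction the Cauchy integral of such a g
    coincides with its Poisson integral, which contracts the norm and tends to g
    at the boundary.  The characterization shows that H is closed, hence that the
    projection exists.  For x >= 1 the function x^(z - 1/2) is bounded on the
    half-plane, so x^(it) H is contained in H ([hardy_ei]); by the characterization
    and partial fractions, so is A H for a bounded A = c + (1 - z) K where K is an
    average of such characters ([hardy_affine_average]).

    For the archimedean ratio, the factor at infinity is the Mellin transform of
    the Gaussian 2 exp(-pi x^2), which is its own cosine transform.  Exchanging
    the two integrals gives the ratio as the conditionally convergent Mellin
    transform of 2 cos(2 pi x) ([gauss_mellin_reflection]).  Replacing x by q x
    multiplies it by q^(-z), so q^(-z) times the ratio is the integral of
    2 cos(2 pi q x) x^(z-1), cut at x = 1.  The part over (0, 1) is a uniform limit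
    of sums of poles 1/(z + k), by the Taylor expansion of the cosine; the part
    over (1, oo) becomes c + (1 - z) K after an integration by parts.  So the
    archimedean ratio stays tame after multiplication by an arbitrary power
    q^(-z) ([arch_ratio_hcompact]).

    Tameness of all products with q^(-z) is inherited when v is multiplied by a
    ratio of local factors at a prime p ([prime_ratio_hcompact]): on the line that
    ratio is (1 - p^(z-1)) times the geometric series of the p^(-kz), which
    converges uniformly.  Induction over the primes of F concludes. *)

Set Implicit Arguments.
Unset Strict Implicit.
Unset Printing Implicit Defensive.

Import Order.TTheory GRing.Theory Num.Theory.
Import numFieldNormedType.Exports.
Import Normc.

Local Open Scope classical_set_scope.
Local Open Scope ring_scope.
Local Open Scope complex_scope.

(* the real-valued projections of [complex], rather than those of [ssrnum] *)
Local Notation Re := complex.Re.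
Local Notation Im := complex.Im.

(** * Complex-valued functions of a real variable *)

Section ComplexModulus.
Context (R : realType).
Implicit Types (z w : R[i]) (x : R).

Lemma complexP z w : Re z = Re w -> Im z = Im w -> z = w.
Proof. by case: z w => a b [c d] /= -> ->. Qed.

Lemma Re_add z w : Re (z + w) = Re z + Re w. Proof. by case: z w => ? ? []. Qed.
Lemma Im_add z w : Im (z + w) = Im z + Im w. Proof. by case: z w => ? ? []. Qed.
Lemma Re_opp z : Re (- z) = - Re z. Proof. by case: z. Qed.
Lemma Im_opp z : Im (- z) = - Im z. Proof. by case: z. Qed.
Lemma Re_mul z w : Re (z * w) = Re z * Re w - Im z * Im w.
Proof. by case: z w => ? ? []. Qed.
Lemma Im_mul z w : Im (z * w) = Re z * Im w + Im z * Re w.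
Proof. by case: z w => ? ? []. Qed.
Lemma Re_conj z : Re (z^*%C) = Re z. Proof. by case: z. Qed.
Lemma Im_conj z : Im (z^*%C) = - Im z. Proof. by case: z. Qed.

Lemma natC (n : nat) : n%:R = (n%:R : R)%:C :> R[i].
Proof. by rewrite (rmorph_nat (real_complex R)). Qed.

Lemma normc_sqr z : normc z ^+ 2 = Re z ^+ 2 + Im z ^+ 2.
Proof. by case: z => a b /=; rewrite sqr_sqrtr // addr_ge0 // sqr_ge0. Qed.

Lemma normcC x : normc x%:C = `|x|.
Proof. by rewrite /= expr0n /= addr0 sqrtr_sqr. Qed.

Lemma normc_conj z : normc z^*%C = normc z.
Proof. by case: z => a b /=; rewrite sqrrN. Qed.

Lemma conjcK_mul z : z * z^*%C = (normc z ^+ 2)%:C.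
Proof. by rewrite normc_sqr; case: z => a b; apply: complexP => /=; ring. Qed.

Lemma conjcD z w : (z + w)^*%C = z^*%C + w^*%C. Proof. exact: rmorphD. Qed.
Lemma conjcB z w : (z - w)^*%C = z^*%C - w^*%C. Proof. exact: rmorphB. Qed.
Lemma conjcM z w : (z * w)^*%C = z^*%C * w^*%C. Proof. exact: rmorphM. Qed.
Lemma conjcN z : (- z)^*%C = - z^*%C. Proof. exact: rmorphN. Qed.
Lemma conjcV z : (z^-1)^*%C = (z^*%C)^-1.
Proof. exact: conjc_inv. Qed.

Lemma normc_eq0 z : (normc z == 0) = (z == 0).
Proof. by apply/eqP/eqP => [/eq0_normc //|->]; rewrite normc0. Qed.

Lemma normc_gt0 z : (0 < normc z) = (z != 0).
Proof. by rewrite lt_neqAle normc_ge0 andbT eq_sym normc_eq0. Qed.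

Lemma normRe_le z : `|Re z| <= normc z.
Proof.
rewrite -(ler_pXn2r (ltn0Sn 1)) ?nnegrE ?normc_ge0 // normc_sqr real_normK ?num_real //.
by rewrite lerDl sqr_ge0.
Qed.

Lemma normIm_le z : `|Im z| <= normc z.
Proof.
rewrite -(ler_pXn2r (ltn0Sn 1)) ?nnegrE ?normc_ge0 // normc_sqr real_normK ?num_real //.
by rewrite lerDr sqr_ge0.
Qed.

Lemma normc_le_ReIm z : normc z <= `|Re z| + `|Im z|.
Proof.
rewrite {1}(complexE z); apply: le_trans (le_normcD _ _) _.
rewrite normcM !normcC [normc 'i%C]/= expr0n expr1n add0r sqrtr1 mul1r.
exact: lexx.
Qed.

Lemma normcBC z w : normc (z - w) = normc (w - z).
Proof. by rewrite -normcN opprB. Qed.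

Lemma le_normcB z w : normc (z - w) <= normc z + normc w.
Proof. by rewrite -(normcN w) le_normcD. Qed.

Lemma lerB_normc z w : normc z - normc w <= normc (z - w).
Proof. by rewrite lerBlDr -{1}(subrK w z) le_normcD. Qed.

Lemma normcX z n : normc (z ^+ n) = normc z ^+ n.
Proof. by elim: n => [|n ih]; rewrite ?expr0 ?normc1 // !exprS normcM ih. Qed.

Lemma invcE z :
  z^-1 = (Re z / normc z ^+ 2) +i* - (Im z / normc z ^+ 2).
Proof. by rewrite normc_sqr; case: z. Qed.

End ComplexModulus.

Section ComplexMeasurability.
Context (R : realType).
Implicit Types (D : set R) (f g : R -> R[i]).

Lemma eq_cmeasurable D f g : (forall t, f t = g t) -> cmeasurable D f ->
  cmeasurable D g.
Proof. by move=> fg; have -> : g = f by apply/funext => t; rewrite fg. Qed.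

Lemma cmeasurable_cst D (c : R[i]) : cmeasurable D (fun _ => c).
Proof. by split; exact: measurable_cst. Qed.

Lemma cmeasurable_real D (f : R -> R) : measurable_fun D f ->
  cmeasurable D (fun t => (f t)%:C).
Proof. by split => //=; exact: measurable_cst. Qed.

Lemma cmeasurable_add D f g : cmeasurable D f -> cmeasurable D g ->
  cmeasurable D (fun t => f t + g t).
Proof.
move=> [fr fi] [gr gi]; split.
- by under eq_fun do rewrite Re_add; exact: measurable_funD.
- by under eq_fun do rewrite Im_add; exact: measurable_funD.
Qed.

Lemma cmeasurable_opp D f : cmeasurable D f -> cmeasurable D (fun t => - f t).
Proof.
move=> [fr fi]; split.
- by under eq_fun do rewrite Re_opp; exact: measurable_funN.
- by under eq_fun do rewrite Im_opp; exact: measurable_funN.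
Qed.

Lemma cmeasurable_sub D f g : cmeasurable D f -> cmeasurable D g ->
  cmeasurable D (fun t => f t - g t).
Proof. by move=> mf mg; apply: cmeasurable_add => //; exact: cmeasurable_opp. Qed.

Lemma cmeasurable_mul D f g : cmeasurable D f -> cmeasurable D g ->
  cmeasurable D (fun t => f t * g t).
Proof.
move=> [fr fi] [gr gi]; split.
- under eq_fun do rewrite Re_mul; apply: measurable_funB; exact: measurable_funM.
- under eq_fun do rewrite Im_mul; apply: measurable_funD; exact: measurable_funM.
Qed.

Lemma cmeasurable_conj D f : cmeasurable D f -> cmeasurable D (fun t => (f t)^*%C).
Proof.
move=> [fr fi]; split.
- by under eq_fun do rewrite Re_conj.
- by under eq_fun do rewrite Im_conj; exact: measurable_funN.
Qed.

Lemma cmeasurableS D D' f : measurable D -> D' `<=` D -> cmeasurable D f ->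
  cmeasurable D' f.
Proof. by move=> mD D'D [fr fi]; split; exact: measurable_funS fr || exact: measurable_funS fi. Qed.

Lemma measurable_normc' D f : measurable D -> cmeasurable D f ->
  measurable_fun D (fun t => normc (f t)).
Proof. exact: measurable_normc. Qed.

Lemma cmeasurable_inv D f : measurable D -> cmeasurable D f ->
  cmeasurable D (fun t => (f t)^-1).
Proof.
move=> mD mf.
have mn := measurable_normc mD mf.
have mi : measurable_fun D (fun t => (normc (f t) ^+ 2)^-1).
  rewrite (_ : (fun _ => _) = (fun t => (normc (f t) ^+ 2) `^ (-1))).
    apply: (measurableT_comp (measurable_powR (-1))).
    exact: measurable_funX.
  by apply/funext => t; rewrite powR_inv1 // sqr_ge0.
case: mf => fr fi; split.
- by under eq_fun do rewrite invcE /=; exact: measurable_funM.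
- under eq_fun do rewrite invcE /=; apply: measurable_funN; exact: measurable_funM.
Qed.

Lemma cmeasurable_cvg D (f_ : (R -> R[i])^nat) f : measurable D ->
  (forall n, cmeasurable D (f_ n)) ->
  (forall t, D t -> normc (f_ n t - f t) @[n --> \oo] --> 0) ->
  cmeasurable D f.
Proof.
move=> mD mf_ f_f.
have cR t : D t -> Re (f_ n t) @[n --> \oo] --> Re (f t).
  move=> Dt; apply/subr_cvg0; apply: norm_cvg0.
  apply: (@squeeze_cvgr _ _ _ _ (cst 0) _ _ _ _ _ (f_f t Dt)); last exact: cvg_cst.
  by near=> n; rewrite normr_ge0 /= -Re_opp -Re_add normRe_le.
have cI t : D t -> Im (f_ n t) @[n --> \oo] --> Im (f t).
  move=> Dt; apply/subr_cvg0; apply: norm_cvg0.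
  apply: (@squeeze_cvgr _ _ _ _ (cst 0) _ _ _ _ _ (f_f t Dt)); last exact: cvg_cst.
  by near=> n; rewrite normr_ge0 /= -Im_opp -Im_add normIm_le.
split.
- exact: (@measurable_fun_cvg _ _ _ D (fun n t => Re (f_ n t)) _ (fun n => (mf_ n).1)).
- exact: (@measurable_fun_cvg _ _ _ D (fun n t => Im (f_ n t)) _ (fun n => (mf_ n).2)).
Unshelve. all: end_near. Qed.

End ComplexMeasurability.

Section ComplexIntegrability.
Context (R : realType).
Local Notation mu := (@lebesgue_measure R).
Implicit Types (D : set R) (f g : R -> R[i]).

Lemma integrable_addr D (f g : R -> R) : measurable D ->
  mu.-integrable D (EFin \o f) -> mu.-integrable D (EFin \o g) ->
  mu.-integrable D (EFin \o (fun t => f t + g t)).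
Proof.
move=> mD fi gi; have := @integrableD _ _ _ mu D mD _ _ fi gi.
by apply: eq_integrable => // t _ /=; rewrite EFinD.
Qed.

Lemma integrable_scaler D (k : R) (f : R -> R) : measurable D ->
  mu.-integrable D (EFin \o f) ->
  mu.-integrable D (EFin \o (fun t => k * f t)).
Proof.
move=> mD fi; have := @integrableZl _ _ _ mu D mD k _ fi.
by apply: eq_integrable => // t _ /=; rewrite EFinM.
Qed.

Definition cintegrable D f : Prop :=
  cmeasurable D f /\ (\int[mu]_(t in D) (normc (f t))%:E < +oo)%E.

Lemma cintegrable_normc D f : measurable D -> cintegrable D f ->
  mu.-integrable D (EFin \o (fun t => normc (f t))).
Proof.
move=> mD [mf lf]; apply/integrableP; split.
  by apply/measurable_EFinP; exact: measurable_normc'.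
by under eq_integral do rewrite /= ger0_norm ?normc_ge0 //.
Qed.

Lemma le_cintegrable D f (g : R -> R) : measurable D -> cmeasurable D f ->
  (forall t, D t -> normc (f t) <= g t) -> mu.-integrable D (EFin \o g) ->
  cintegrable D f.
Proof.
move=> mD mf fg ig; split => //.
have /integrableP[_] : mu.-integrable D (EFin \o (fun t => normc (f t))).
  apply: le_integrable ig => //.
    by apply/measurable_EFinP; exact: measurable_normc'.
  move=> t Dt /=; rewrite lee_fin ger0_norm ?normc_ge0 //.
  by apply: le_trans (fg t Dt) _; rewrite ler_norm.
by under eq_integral do rewrite /= ger0_norm ?normc_ge0 //.
Qed.

Lemma cintegrable_Re D f : measurable D -> cintegrable D f ->
  mu.-integrable D (EFin \o (fun t => Re (f t))).
Proof.
move=> mD fi; apply: le_integrable (cintegrable_normc mD fi) => //.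
  by apply/measurable_EFinP; exact: fi.1.1.
by move=> t Dt /=; rewrite lee_fin (ger0_norm (normc_ge0 _)) normRe_le.
Qed.

Lemma cintegrable_Im D f : measurable D -> cintegrable D f ->
  mu.-integrable D (EFin \o (fun t => Im (f t))).
Proof.
move=> mD fi; apply: le_integrable (cintegrable_normc mD fi) => //.
  by apply/measurable_EFinP; exact: fi.1.2.
by move=> t Dt /=; rewrite lee_fin (ger0_norm (normc_ge0 _)) normIm_le.
Qed.

Lemma eq_cintegrable D f g : (forall t, D t -> f t = g t) -> measurable D ->
  cintegrable D f -> cintegrable D g.
Proof.
move=> fg mD fi.
have mg : cmeasurable D g.
  split.
  - apply: eq_measurable_fun fi.1.1 => t /set_mem Dt /=; by rewrite fg.
  - apply: eq_measurable_fun fi.1.2 => t /set_mem Dt /=; by rewrite fg.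
apply: (le_cintegrable mD mg _ (cintegrable_normc mD fi)) => t Dt.
by rewrite fg.
Qed.

Lemma cintegrable_real D (f : R -> R) : measurable D ->
  mu.-integrable D (EFin \o f) -> cintegrable D (fun t => (f t)%:C).
Proof.
move=> mD fi; apply: (@le_cintegrable _ _ (fun t => `|f t|)) => //.
- by apply: cmeasurable_real; case/integrableP : fi => /measurable_EFinP.
- by move=> t _; rewrite normcC.
- exact: integrable_norm.
Qed.

Lemma cintegrable_add D f g : measurable D -> cintegrable D f ->
  cintegrable D g -> cintegrable D (fun t => f t + g t).
Proof.
move=> mD fi gi.
apply: (@le_cintegrable _ _ (fun t => normc (f t) + normc (g t))) => //.
- exact: cmeasurable_add fi.1 gi.1.
- by move=> t _; exact: le_normcD.
- exact: integrable_addr (cintegrable_normc mD fi) (cintegrable_normc mD gi).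
Qed.

Lemma cintegrable_mul_bounded D f g (M : R) : measurable D -> cmeasurable D g ->
  (forall t, D t -> normc (g t) <= M) -> cintegrable D f ->
  cintegrable D (fun t => g t * f t).
Proof.
move=> mD mg gM fi.
apply: (@le_cintegrable _ _ (fun t => M * normc (f t))) => //.
- exact: cmeasurable_mul mg fi.1.
- by move=> t Dt; rewrite normcM ler_wpM2r ?normc_ge0 // gM.
- exact: integrable_scaler (cintegrable_normc mD fi).
Qed.

Lemma cintegrableZ D (a : R[i]) f : measurable D -> cintegrable D f ->
  cintegrable D (fun t => a * f t).
Proof.
by move=> mD; apply: (@cintegrable_mul_bounded _ _ _ (normc a)).
Qed.

Lemma cintegrable_opp D f : measurable D -> cintegrable D f ->
  cintegrable D (fun t => - f t).
Proof.
move=> mD fi; apply: (eq_cintegrable _ _ (cintegrableZ (-1) mD fi)) => //.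
by move=> t _; rewrite mulN1r.
Qed.

Lemma cintegrable_sub D f g : measurable D -> cintegrable D f ->
  cintegrable D g -> cintegrable D (fun t => f t - g t).
Proof.
by move=> mD fi gi; apply: cintegrable_add => //; exact: cintegrable_opp.
Qed.

Lemma cintegrableS D D' f : measurable D -> measurable D' -> D' `<=` D ->
  cintegrable D f -> cintegrable D' f.
Proof.
move=> mD mD' D'D fi.
apply: (@le_cintegrable _ _ (fun t => normc (f t))) => //.
- exact: cmeasurableS fi.1.
- exact: integrableS (cintegrable_normc mD fi).
Qed.

Lemma eq_cintegral D f g : (forall t, D t -> f t = g t) ->
  cintegral D f = cintegral D g.
Proof.
by move=> fg; congr (_ +i* _); apply: eq_Rintegral => t /set_mem Dt; rewrite fg.
Qed.

Lemma ae_eq_cintegral D f g : measurable D -> cmeasurable D f -> cmeasurable D g ->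
  (\forall t \ae mu, D t -> f t = g t) -> cintegral D f = cintegral D g.
Proof.
move=> mD [fr fi] [gr gi] fg; congr (_ +i* _); rewrite /Rintegral; congr fine;
  apply: ae_eq_integral => //; try exact/measurable_EFinP;
  by apply: (@filterS _ _ (ae_filter_ringOfSetsType mu) _ _ _ fg) => t /= h /h ->.
Qed.

Lemma cintegralD D f g : measurable D -> cintegrable D f -> cintegrable D g ->
  cintegral D (fun t => f t + g t) = cintegral D f + cintegral D g.
Proof.
move=> mD fi gi; apply: complexP.
- rewrite Re_add /= -RintegralD //; [|exact: cintegrable_Re..].
  by apply: eq_Rintegral => t _; rewrite Re_add.
- rewrite Im_add /= -RintegralD //; [|exact: cintegrable_Im..].
  by apply: eq_Rintegral => t _; rewrite Im_add.
Qed.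

Lemma cintegralZ D (a : R[i]) f : measurable D -> cintegrable D f ->
  cintegral D (fun t => a * f t) = a * cintegral D f.
Proof.
move=> mD fi; have ir := cintegrable_Re mD fi; have ii := cintegrable_Im mD fi.
apply: complexP.
- rewrite Re_mul /= -!RintegralZl // -RintegralB //; [|exact: integrable_scaler..].
  by apply: eq_Rintegral => t _; rewrite Re_mul.
- rewrite Im_mul /= -!RintegralZl // -RintegralD //; [|exact: integrable_scaler..].
  by apply: eq_Rintegral => t _; rewrite Im_mul.
Qed.

Lemma cintegralN D f : measurable D -> cintegrable D f ->
  cintegral D (fun t => - f t) = - cintegral D f.
Proof.
move=> mD fi; rewrite -mulN1r -cintegralZ //.
by apply: eq_cintegral => t _; rewrite mulN1r.
Qed.

Lemma cintegralB D f g : measurable D -> cintegrable D f -> cintegrable D g ->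
  cintegral D (fun t => f t - g t) = cintegral D f - cintegral D g.
Proof.
by move=> mD fi gi; rewrite cintegralD ?cintegralN //; exact: cintegrable_opp.
Qed.

Lemma cintegral_conj D f : measurable D -> cintegrable D f ->
  cintegral D (fun t => (f t)^*%C) = (cintegral D f)^*%C.
Proof.
move=> mD fi; apply: complexP; rewrite ?Re_conj ?Im_conj /=.
  by apply: eq_Rintegral => t _; rewrite Re_conj.
rewrite -mulN1r -RintegralZl //; last exact: cintegrable_Im.
by apply: eq_Rintegral => t _; rewrite Im_conj mulN1r.
Qed.

Lemma cintegral_real D (f : R -> R) :
  cintegral D (fun t => (f t)%:C) = (\int[mu]_(t in D) f t)%:C.
Proof. by congr (_ +i* _) => /=; rewrite /Rintegral integral0_eq. Qed.

Lemma cintegral0 D : cintegral D (fun _ => 0 : R[i]) = 0.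
Proof. by apply: complexP => /=; rewrite /Rintegral integral0_eq. Qed.

(** With I the integral, |I|^2 is the integral of the real part of conj(I) f. *)
Lemma normc_cintegral D f : measurable D -> cintegrable D f ->
  normc (cintegral D f) <= \int[mu]_(t in D) normc (f t).
Proof.
move=> mD fi; have [I Idef] : {I | I = cintegral D f} by exists (cintegral D f).
rewrite -Idef.
have [->|I0] := eqVneq I 0.
  by rewrite normc0; apply: Rintegral_ge0 => t _; exact: normc_ge0.
have nI0 : 0 < normc I by rewrite normc_gt0.
rewrite -(ler_pM2l nI0).
have -> : normc I * normc I = Re (cintegral D (fun t => I^*%C * f t)).
  by rewrite cintegralZ // -Idef [_^*%C * _]mulrC conjcK_mul /= -expr2.
rewrite /= -RintegralZl //; last exact: cintegrable_normc.
apply: le_Rintegral => //.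
- by apply: cintegrable_Re => //; exact: cintegrableZ.
- exact: integrable_scaler (cintegrable_normc mD fi).
- move=> t _; apply: le_trans (ler_norm _) (le_trans (normRe_le _) _).
  by rewrite normcM normc_conj.
Qed.

Lemma cintegral_setU D D' f : measurable D -> measurable D' ->
  cintegrable (D `|` D') f -> [disjoint D & D'] ->
  cintegral (D `|` D') f = cintegral D f + cintegral D' f.
Proof.
move=> mD mD' fi dd; have mU := measurableU _ _ mD mD'.
apply: complexP; rewrite ?Re_add ?Im_add /= Rintegral_setU //.
  exact: cintegrable_Re.
exact: cintegrable_Im.
Qed.

Lemma cdominated D (f_ : (R -> R[i])^nat) f (g : R -> R) : measurable D ->
  (forall n, cmeasurable D (f_ n)) ->
  (forall t, D t -> normc (f_ n t - f t) @[n --> \oo] --> 0) ->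
  mu.-integrable D (EFin \o g) ->
  (forall n t, D t -> normc (f_ n t) <= g t) ->
  cintegrable D f /\
  normc (cintegral D (f_ n) - cintegral D f) @[n --> \oo] --> 0.
Proof.
move=> mD mf_ ff ig fg.
have mf : cmeasurable D f := cmeasurable_cvg mD mf_ ff.
have fg' t : D t -> normc (f t) <= g t.
  move=> Dt; rewrite -subr_le0.
  have h n : normc (f t) - g t <= normc (f_ n t - f t).
    have h1 := lerB_normc (f t) (f_ n t); have h2 := fg n t Dt.
    by rewrite normcBC; apply: le_trans h1; rewrite lerB.
  rewrite -(cvg_lim _ (ff t Dt)) //; apply: limr_ge; first exact: cvgP (ff t Dt).
  by near=> n; exact: h.
have fi : cintegrable D f := le_cintegrable mD mf fg' ig.
have fni n : cintegrable D (f_ n) := le_cintegrable mD (mf_ n) (fg n) ig.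
split=> //.
pose h_ n t := (normc (f_ n t - f t))%:E.
have mh n : measurable_fun D (h_ n).
  apply/measurable_EFinP; apply: measurable_normc' => //.
  exact: cmeasurable_sub.
have := @dominated_convergence _ _ _ mu D mD h_ (cst 0%E) (fun t => (g t + g t)%:E) mh.
case.
- exact: measurable_cst.
- by apply: aeW => t Dt; apply: cvg_EFin; [exact: nearW|exact: ff].
- exact: (integrable_addr mD ig ig).
- apply: aeW => t n Dt; rewrite /h_ abse_EFin lee_fin ger0_norm ?normc_ge0 //.
  by apply: le_trans (le_normcB _ _) _; apply: lerD; [exact: fg|exact: fg'].
move=> _ _; rewrite integral0_eq // => /fine_cvg h.
apply: (@squeeze_cvgr _ _ _ _ (cst 0) _ _ _ _ _ h); last exact: cvg_cst.
near=> n; rewrite normc_ge0 andTb -cintegralB //.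
by apply: normc_cintegral => //; exact: cintegrable_sub.
Unshelve. all: end_near. Qed.

End ComplexIntegrability.

#[global] Arguments cintegral : simpl never.
#[global] Arguments normc : simpl never.

(** * Square-integrable functions and their classes *)

Section SquareIntegrable.
Context (R : realType).
Local Notation mu := (@lebesgue_measure R).
Implicit Types (f g : R -> R[i]) (x y z : L2line R).

Lemma ae_imp (P Q : R -> Prop) : (forall t, P t -> Q t) ->
  (\forall t \ae mu, P t) -> \forall t \ae mu, Q t.
Proof. by move=> PQ; apply: (@filterS _ _ (ae_filter_ringOfSetsType mu)). Qed.

Lemma ae_imp2 (P Q S : R -> Prop) : (forall t, P t -> Q t -> S t) ->
  (\forall t \ae mu, P t) -> (\forall t \ae mu, Q t) -> \forall t \ae mu, S t.
Proof. by move=> PQ; apply: (@filterS2 _ _ (ae_filter_ringOfSetsType mu)). Qed.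

Definition inL2 f : Prop := cmeasurable setT f /\
  (\int[mu]_t (normc (f t) ^+ 2)%:E < +oo)%E.

Definition sqint f : R := \int[mu]_t (normc (f t) ^+ 2).

Lemma L2eNormE f :
  L2eNorm f = ((\int[mu]_t (normc (f t) ^+ 2)%:E) `^ (2^-1))%E.
Proof.
rewrite /L2eNorm unlock; congr (_ `^ _)%E; apply: eq_integral => t _ /=.
by rewrite ger0_norm ?normc_ge0 // powR_mulrn // normc_ge0.
Qed.

Lemma inL2P f : (f \in @L2fun R) <-> inL2 f.
Proof.
have h : finite_norm mu 2%:E (@normc R \o f) =
    (\int[mu]_t (normc (f t) ^+ 2)%:E < +oo)%E :> bool.
  rewrite /finite_norm -/(L2eNorm f) L2eNormE.
  have i0 : (0 <= \int[mu]_t (normc (f t) ^+ 2)%:E)%E.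
    by apply: integral_ge0 => t _; rewrite lee_fin sqr_ge0.
  case: (\int[mu]_t _)%E i0 => [r| |] //=.
  - by rewrite ltry ltry.
  - by rewrite invr_eq0 pnatr_eq0.
by split=> [/asboolP[mf]|[mf lf]]; [|apply/asboolP]; rewrite ?h //; split => //; rewrite h.
Qed.

Lemma inL2_sq f : inL2 f -> mu.-integrable setT (EFin \o (fun t => normc (f t) ^+ 2)).
Proof.
move=> [mf lf]; apply/integrableP; split.
  by apply/measurable_EFinP/measurable_funX; exact: measurable_normc'.
by under eq_integral do rewrite /= ger0_norm ?sqr_ge0 //.
Qed.

Lemma sqint_ge0 f : 0 <= sqint f.
Proof. by apply: Rintegral_ge0 => t _; exact: sqr_ge0. Qed.

Lemma sqintE f : inL2 f -> (sqint f)%:E = (\int[mu]_t (normc (f t) ^+ 2)%:E)%E.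
Proof.
by move=> /inL2_sq fi; rewrite /sqint /Rintegral fineK //; exact: integrable_fin_num.
Qed.

Lemma le_inL2 f (g : R -> R) : cmeasurable setT f ->
  (forall t, normc (f t) ^+ 2 <= g t) -> mu.-integrable setT (EFin \o g) -> inL2 f.
Proof.
move=> mf fg ig; split=> //.
have /integrableP[_] : mu.-integrable setT (EFin \o (fun t => normc (f t) ^+ 2)).
  apply: le_integrable ig => //.
    by apply/measurable_EFinP/measurable_funX; exact: measurable_normc'.
  move=> t _ /=; rewrite lee_fin ger0_norm ?sqr_ge0 //.
  by apply: le_trans (fg t) _; rewrite ler_norm.
by under eq_integral do rewrite /= ger0_norm ?sqr_ge0 //.
Qed.

Lemma inL2_mul f g : inL2 f -> inL2 g -> cintegrable setT (fun t => f t * g t).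
Proof.
move=> fi gi.
apply: (le_cintegrable measurableT _ _
  (integrable_addr measurableT (inL2_sq fi) (inL2_sq gi))).
  exact: cmeasurable_mul fi.1 gi.1.
move=> t _; rewrite normcM.
have := sqr_ge0 (normc (f t) - normc (g t)).
have := mulr_ge0 (normc_ge0 (f t)) (normc_ge0 (g t)).
by nra.
Qed.

Lemma inL2_add f g : inL2 f -> inL2 g -> inL2 (fun t => f t + g t).
Proof.
move=> /inL2P fi /inL2P gi; apply/inL2P.
rewrite (_ : (fun _ => _) = 1 *: (f : R -> R[i]^o) + g).
  exact: (L2fun_submod_closed R).2 fi gi.
by apply/funext => t; rewrite [RHS]/(1 * f t + g t) mul1r.
Qed.

Lemma inL2Z a f : inL2 f -> inL2 (fun t => a * f t).
Proof.
move=> /inL2P fi; apply/inL2P.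
rewrite (_ : (fun _ => _) = a *: (f : R -> R[i]^o) + 0).
  exact: (L2fun_submod_closed R).2 fi (L2fun_submod_closed R).1.
by apply/funext => t; apply/esym; exact: (@addr0 R[i]).
Qed.

Lemma inL2_sub f g : inL2 f -> inL2 g -> inL2 (fun t => f t - g t).
Proof.
move=> fi gi; have := inL2_add fi (inL2Z (-1) gi).
by under eq_fun do rewrite mulN1r.
Qed.

Lemma inL2_conj f : inL2 f -> inL2 (fun t => (f t)^*%C).
Proof.
move=> fi; apply: (le_inL2 _ _ (inL2_sq fi)); first exact: cmeasurable_conj fi.1.
by move=> t; rewrite normc_conj.
Qed.

Lemma inL2_mul_bounded f g (M : R) : cmeasurable setT g ->
  (forall t, normc (g t) <= M) -> inL2 f -> inL2 (fun t => g t * f t).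
Proof.
move=> mg gM fi.
apply: (le_inL2 _ _ (integrable_scaler (M ^+ 2) measurableT (inL2_sq fi))).
  exact: cmeasurable_mul mg fi.1.
move=> t; rewrite normcM exprMn ler_wpM2r ?sqr_ge0 //.
by rewrite ler_pXn2r ?nnegrE ?normc_ge0 // (le_trans (normc_ge0 (g t))).
Qed.

Lemma le_sqint f g : inL2 f -> inL2 g -> (forall t, normc (f t) <= normc (g t)) ->
  sqint f <= sqint g.
Proof.
move=> fi gi fg; apply: le_Rintegral => //; [exact: inL2_sq..|].
by move=> t _; rewrite ler_pXn2r ?nnegrE ?normc_ge0.
Qed.

Lemma L2reprP x : inL2 (L2repr x).
Proof. by apply/inL2P; rewrite /L2repr; case: (repr x). Qed.

Lemma L2classK x : L2class (L2repr x) = x.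
Proof.
rewrite /L2class /L2repr valKd; exact: reprK.
Qed.

Lemma L2valid f : inL2 f -> L2val (insubd (0 : L2funType R) (f : R -> R[i]^o)) = f.
Proof. by move=> /inL2P fi; rewrite insubdK. Qed.

Lemma pi_ae (f g : L2funType R) : (\pi_(L2line R)%qT f = \pi_(L2line R)%qT g) <->
  \forall t \ae mu, f t = g t.
Proof.
split=> [/eqL2P/asboolP h|h].
- apply: ae_imp h => t h; apply/eqP; rewrite -(@subr_eq0 R[i]); apply/eqP; exact: h.
- apply/eqL2P/asboolP; apply: ae_imp h => t h.
  by rewrite [LHS]/(f t - g t) h; exact: (@subrr R[i]).
Qed.

Lemma L2repr_class f : inL2 f -> \forall t \ae mu, L2repr (L2class f) t = f t.
Proof.
move=> fi; have /pi_ae := @reprK _ (L2line R) (L2class f).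
by apply: ae_imp => t h; rewrite /L2repr h L2valid.
Qed.

Lemma L2class_eq f g : inL2 f -> inL2 g -> (\forall t \ae mu, f t = g t) ->
  L2class f = L2class g.
Proof. by move=> fi gi fg; apply/pi_ae; rewrite !L2valid. Qed.

(** Classes are compared through arbitrary representatives, almost everywhere. *)
Lemma L2line_ext x y : (\forall t \ae mu, L2repr x t = L2repr y t) -> x = y.
Proof. by move=> h; rewrite -(L2classK x) -(L2classK y); apply: L2class_eq => //; exact: L2reprP. Qed.

Lemma L2class_add f g : inL2 f -> inL2 g ->
  L2class f + L2class g = L2class (fun t => f t + g t).
Proof.
move=> fi gi; rewrite /L2class -L2piD; apply/pi_ae; apply: aeW => t.
by rewrite (L2valid (inL2_add fi gi)) -[in RHS](L2valid fi) -[in RHS](L2valid gi).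
Qed.

Lemma L2classZ (a : R[i]) f : inL2 f -> a *: L2class f = L2class (fun t => a * f t).
Proof.
move=> fi; rewrite /L2class [LHS]L2scale_pi; apply/pi_ae; apply: aeW => t.
by rewrite (L2valid (inL2Z a fi)) -[in RHS](L2valid fi).
Qed.

Lemma L2class_sub f g : inL2 f -> inL2 g ->
  L2class f - L2class g = L2class (fun t => f t - g t).
Proof.
move=> fi gi; rewrite -scaleN1r L2classZ // L2class_add //; last exact: inL2Z.
by congr L2class; apply/funext => t; rewrite mulN1r.
Qed.

Lemma L2repr_sub x y : \forall t \ae mu, L2repr (x - y) t = L2repr x t - L2repr y t.
Proof.
have := L2repr_class (inL2_sub (L2reprP x) (L2reprP y)).
by rewrite -L2class_sub ?L2classK //; exact: L2reprP.
Qed.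

Lemma L2reprZ (a : R[i]) x : \forall t \ae mu, L2repr (a *: x) t = a * L2repr x t.
Proof.
have := L2repr_class (inL2Z a (L2reprP x)).
by rewrite -L2classZ ?L2classK //; exact: L2reprP.
Qed.

(** The real number whose embedding is the [R[i]]-valued norm of [L2line]. *)
Definition nrm x : R := fine (L2eNorm (L2repr x)).

Lemma normL2E x : `|x| = (nrm x)%:C. Proof. by []. Qed.

Lemma nrm_ge0 x : 0 <= nrm x.
Proof. by rewrite fine_ge0 // Lnorm_ge0. Qed.

Lemma nrmD x y : nrm (x + y) <= nrm x + nrm y.
Proof. by rewrite -lecR rmorphD; exact: (ler_normD x y). Qed.

Lemma nrmZ a x : nrm (a *: x) = normc a * nrm x.
Proof. by apply: complexI; rewrite rmorphM; exact: (normrZ a x). Qed.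

Lemma nrmN x : nrm (- x) = nrm x.
Proof. by rewrite -scaleN1r nrmZ normcN normc1 mul1r. Qed.

Lemma nrmB x y : nrm (x - y) <= nrm x + nrm y.
Proof. by rewrite -(nrmN y) nrmD. Qed.

Lemma nrmBC x y : nrm (x - y) = nrm (y - x).
Proof. by rewrite -nrmN opprB. Qed.

Lemma nrm0 : nrm 0 = 0.
Proof. by apply: complexI; rewrite -normL2E normr0. Qed.

Lemma nrm_eq0 x : nrm x = 0 -> x = 0.
Proof. by move=> x0; apply: normr0_eq0; rewrite normL2E x0. Qed.

Lemma nrm_sqr x : nrm x ^+ 2 = sqint (L2repr x).
Proof.
rewrite /nrm L2eNormE -sqintE; last exact: L2reprP.
rewrite /= -powR_mulrn ?powR_ge0 // -powRrM mulVf ?pnatr_eq0 //.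
by rewrite powRr1 // sqint_ge0.
Qed.

Lemma ae_sqint f g : inL2 f -> inL2 g -> (\forall t \ae mu, f t = g t) ->
  sqint f = sqint g.
Proof.
move=> fi gi fg; rewrite /sqint /Rintegral; congr fine.
apply: ae_eq_integral => //.
- by have /measurable_int := inL2_sq fi.
- by have /measurable_int := inL2_sq gi.
- by apply: ae_imp fg => t /= ->.
Qed.

Lemma nrm_class f : inL2 f -> nrm (L2class f) ^+ 2 = sqint f.
Proof.
by move=> fi; rewrite nrm_sqr; apply: ae_sqint (L2repr_class fi) => //; exact: L2reprP.
Qed.

Lemma nrm_le_sqr x (c : R) : 0 <= c -> nrm x ^+ 2 <= c ^+ 2 -> nrm x <= c.
Proof. by move=> c0; rewrite ler_pXn2r ?nnegrE ?nrm_ge0. Qed.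

Lemma dot_class f g : inL2 f -> inL2 g ->
  L2dot (L2class f) (L2class g) = cintegral setT (fun t => f t * (g t)^*%C).
Proof.
move=> fi gi; apply: ae_eq_cintegral => //.
- exact: cmeasurable_mul (L2reprP _).1 (cmeasurable_conj (L2reprP _).1).
- exact: cmeasurable_mul fi.1 (cmeasurable_conj gi.1).
- by apply: (ae_imp2 _ (L2repr_class fi) (L2repr_class gi)) => t -> ->.
Qed.

Lemma dotDl x y z : L2dot (x + y) z = L2dot x z + L2dot y z.
Proof.
rewrite -(L2classK x) -(L2classK y) -(L2classK z).
have [[xi yi] zi] := (L2reprP x, L2reprP y, L2reprP z).
rewrite L2class_add // !dot_class //; last exact: inL2_add.
rewrite -cintegralD //; [|exact: inL2_mul xi (inL2_conj zi)|exact: inL2_mul yi (inL2_conj zi)].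
by apply: eq_cintegral => t _; rewrite mulrDl.
Qed.

Lemma dotZl a x z : L2dot (a *: x) z = a * L2dot x z.
Proof.
rewrite -(L2classK x) -(L2classK z); have [xi zi] := (L2reprP x, L2reprP z).
rewrite L2classZ // !dot_class //; last exact: inL2Z.
rewrite -cintegralZ //; last exact: inL2_mul xi (inL2_conj zi).
by apply: eq_cintegral => t _; rewrite mulrA.
Qed.

Lemma dotC x y : L2dot y x = (L2dot x y)^*%C.
Proof.
rewrite /L2dot -cintegral_conj //; last exact: inL2_mul (L2reprP x) (inL2_conj (L2reprP y)).
by apply: eq_cintegral => t _; rewrite conjcM conjcK mulrC.
Qed.

Lemma dotDr x y z : L2dot z (x + y) = L2dot z x + L2dot z y.
Proof. by rewrite dotC dotDl conjcD -!dotC. Qed.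

Lemma dotZr a x z : L2dot z (a *: x) = a^*%C * L2dot z x.
Proof. by rewrite dotC dotZl conjcM -dotC. Qed.

Lemma dotNl x z : L2dot (- x) z = - L2dot x z.
Proof. by rewrite -scaleN1r dotZl mulN1r. Qed.

Lemma dotNr x z : L2dot z (- x) = - L2dot z x.
Proof. by rewrite dotC dotNl conjcN -dotC. Qed.

Lemma dotBl x y z : L2dot (x - y) z = L2dot x z - L2dot y z.
Proof. by rewrite dotDl dotNl. Qed.

Lemma dotBr x y z : L2dot z (x - y) = L2dot z x - L2dot z y.
Proof. by rewrite dotDr dotNr. Qed.

Lemma dot0l z : L2dot 0 z = 0.
Proof. by rewrite -(scale0r 0) dotZl mul0r. Qed.

Lemma dot0r z : L2dot z 0 = 0.
Proof. by rewrite dotC dot0l conjc0. Qed.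

Lemma dot_nrm x : L2dot x x = (nrm x ^+ 2)%:C.
Proof.
rewrite nrm_sqr /sqint -cintegral_real /L2dot.
by apply: eq_cintegral => t _; rewrite conjcK_mul.
Qed.

Lemma nrm_sqrD x y : nrm (x + y) ^+ 2 = nrm x ^+ 2 + nrm y ^+ 2 + 2 * Re (L2dot x y).
Proof.
apply: complexI; rewrite -dot_nrm dotDl !dotDr !dot_nrm (dotC x y).
by case: (L2dot x y) => a b; apply: complexP => /=; ring.
Qed.

Lemma nrm_sqrB x y : nrm (x - y) ^+ 2 = nrm x ^+ 2 + nrm y ^+ 2 - 2 * Re (L2dot x y).
Proof. by rewrite nrm_sqrD nrmN dotNr Re_opp mulrN. Qed.

Lemma nrm_parallelogram x y :
  nrm (x + y) ^+ 2 + nrm (x - y) ^+ 2 = 2 * (nrm x ^+ 2 + nrm y ^+ 2).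
Proof. by rewrite nrm_sqrD nrm_sqrB; ring. Qed.

(** Nonnegativity of the squared norm of x - a y at the optimal a. *)
Lemma cauchy_schwarz x y : normc (L2dot x y) <= nrm x * nrm y.
Proof.
have [->|y0] := eqVneq y 0; first by rewrite dot0r normc0 nrm0 mulr0.
have ny : 0 < nrm y.
  by rewrite lt_neqAle nrm_ge0 andbT eq_sym; apply: contra y0 => /eqP/nrm_eq0 ->.
rewrite -(ler_pXn2r (ltn0Sn 1)) ?nnegrE ?normc_ge0 ?mulr_ge0 ?nrm_ge0 //.
have := sqr_ge0 (nrm (x - (L2dot x y / (nrm y ^+ 2)%:C) *: y)).
rewrite nrm_sqrB nrmZ dotZr normcM normcV normcC ger0_norm ?sqr_ge0 //.
have -> : Re ((L2dot x y / (nrm y ^+ 2)%:C)^*%C * L2dot x y) =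
    normc (L2dot x y) ^+ 2 / nrm y ^+ 2.
  rewrite conjcM conjcV conjc_real mulrAC [_^*%C * _]mulrC conjcK_mul.
  by rewrite -fmorphV -rmorphM.
set a := normc _; set b := nrm y; have b2 : 0 < b ^+ 2 by rewrite exprn_gt0.
have -> : nrm x ^+ 2 + (a / b ^+ 2 * b) ^+ 2 - 2 * (a ^+ 2 / b ^+ 2) =
    nrm x ^+ 2 - a ^+ 2 / b ^+ 2.
  by field; rewrite gt_eqF.
by rewrite subr_ge0 ler_pdivrMr // exprMn.
Qed.

End SquareIntegrable.

(** * Completeness and orthogonal projections *)

Section Completeness.
Context (R : realType).
Local Notation mu := (@lebesgue_measure R).
Implicit Types (f g : R -> R[i]) (x y z : L2line R).

(** Fatou's lemma in the form of a bound that passes to the pointwise limit. *)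
Lemma fatou_le (h_ : (R -> \bar R)^nat) (h : R -> \bar R) (c : \bar R) :
  (forall n, measurable_fun setT (h_ n)) -> (forall n t, (0 <= h_ n t)%E) ->
  (forall t, h_ n t @[n --> \oo] --> h t) ->
  (\forall n \near \oo, (\int[mu]_t h_ n t <= c)%E) -> (\int[mu]_t h t <= c)%E.
Proof.
move=> mh h0 hh hc.
have := @fatou _ _ _ mu setT measurableT h_ mh (fun n t _ => h0 n t).
have -> : (\int[mu]_x limn_einf (h_ ^~ x) = \int[mu]_x h x)%E.
  by apply: eq_integral => t _; rewrite is_cvg_limn_einfE; [apply/cvg_lim|exact: cvgP (hh t)].
move/le_trans; apply; rewrite limn_einf_lim; apply: lime_le.
  exact: is_cvg_einfs.
case: hc => N _ hN; exists N => // n Nn; apply: ereal_inf_le.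
by exists (\int[mu]_t h_ n t)%E; [exists n => //=|exact: hN].
Qed.

Lemma cvg0_norm (u : nat -> R) : u n @[n --> \oo] --> 0 -> `|u n| @[n --> \oo] --> 0.
Proof. by move=> /cvg_norm; rewrite normr0. Qed.

Lemma half_pow_cvg0 : ((2^-1 : R) ^+ n) @[n --> \oo] --> (0 : R).
Proof. by apply: cvg_expr; rewrite ger0_norm ?invr_ge0 // invf_lt1 // ltr1n. Qed.

Lemma sum_half_pow (m n : nat) : (m <= n)%N ->
  \sum_(m <= k < n) (2^-1 : R) ^+ k <= 2 * 2^-1 ^+ m.
Proof.
move=> mn; suff -> : \sum_(m <= k < n) (2^-1 : R) ^+ k = 2 * 2^-1 ^+ m - 2 * 2^-1 ^+ n.
  by rewrite gerBl mulr_ge0 // exprn_ge0 // invr_ge0.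
elim: n mn => [|n ih]; first by rewrite leqn0 => /eqP ->; rewrite big_geq // subrr.
rewrite leq_eqVlt => /predU1P[->|mn]; first by rewrite big_geq // subrr.
by rewrite big_nat_recr //= ih // exprS; field.
Qed.

Lemma rapid_dist (u : nat -> L2line R) :
  (forall n, nrm (u n.+1 - u n) <= 2^-1 ^+ n) ->
  forall m n, (m <= n)%N -> nrm (u n - u m) <= 2 * 2^-1 ^+ m.
Proof.
move=> hu m n mn; apply: le_trans (sum_half_pow mn).
rewrite -(telescope_sumr u mn); elim/big_rec2 : _ => [|i a b _ h].
  by rewrite nrm0.
by apply: le_trans (nrmD _ _) _; rewrite lerD.
Qed.

(** The partial sums S_n of the moduli of the increments have norm at most 2, so by
    monotone convergence the limit of S_n^2 is integrable, hence finite almost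
    everywhere. *)
Lemma rapid_summable (u : nat -> L2line R) :
  (forall n, nrm (u n.+1 - u n) <= 2^-1 ^+ n) ->
  exists2 E : set R, measurable E & (\forall t \ae mu, E t) /\
    forall t, E t ->
      cvgn (series (fun n => normc (L2repr (u n.+1) t - L2repr (u n) t))).
Proof.
move=> hu.
pose d n t := normc (L2repr (u n.+1) t - L2repr (u n) t).
have mdc n : cmeasurable setT (fun t => L2repr (u n.+1) t - L2repr (u n) t).
  exact: cmeasurable_sub (L2reprP _).1 (L2reprP _).1.
have md n : measurable_fun setT (d n) by apply: measurable_normc'.
have d0 n t : 0 <= d n t by exact: normc_ge0.
pose S n t := series (fun k => d k t) n.
have S0 n t : 0 <= S n t by rewrite /S /series /= sumr_ge0.
have mS n : measurable_fun setT (S n).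
  by rewrite /S /series /=; under eq_fun do rewrite /= big_mkord; exact: measurable_sum.
have di n : inL2 (fun t => (d n t)%:C).
  apply: (le_inL2 _ _ (inL2_sq (inL2_sub (L2reprP (u n.+1)) (L2reprP (u n))))).
    exact: cmeasurable_real.
  by move=> t; rewrite normcC ger0_norm.
have nd n : nrm (L2class (fun t => (d n t)%:C)) <= 2^-1 ^+ n.
  apply: le_trans (hu n); apply: nrm_le_sqr; first exact: nrm_ge0.
  rewrite nrm_class // nrm_sqr.
  rewrite -(ae_sqint (inL2_sub (L2reprP (u n.+1)) (L2reprP (u n))) (L2reprP _)).
    apply: le_sqint => //; first exact: inL2_sub (L2reprP _) (L2reprP _).
    by move=> t; rewrite normcC ger0_norm.
  by apply: ae_imp (L2repr_sub (u n.+1) (u n)) => t ->.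
have Si n : inL2 (fun t => (S n t)%:C) /\ nrm (L2class (fun t => (S n t)%:C)) <=
    \sum_(0 <= k < n) 2^-1 ^+ k.
  elim: n => [|n [ih1 ih2]].
    have -> : (fun t => (S 0%N t)%:C) = (fun t => 0 * (d 0%N t)%:C).
      by apply/funext => t; rewrite /S /series /= big_geq // mul0r.
    split; first exact: inL2Z.
    by rewrite -L2classZ // scale0r nrm0 big_geq.
  have -> : (fun t => (S n.+1 t)%:C) = (fun t => (S n t)%:C + (d n t)%:C).
    by apply/funext => t; rewrite /S /series /= big_nat_recr //= rmorphD.
  split; first exact: inL2_add.
  rewrite -L2class_add // big_nat_recr //=.
  by apply: le_trans (nrmD _ _) _; rewrite lerD.
have SL n : (\int[mu]_t ((S n t) ^+ 2)%:E <= 4%:E)%E.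
  have [Sn hS] := Si n.
  have := sqintE Sn; rewrite -nrm_class // => hE.
  rewrite (_ : (\int[mu]_t _)%E = (\int[mu]_t (normc (S n t)%:C ^+ 2)%:E)%E); last first.
    by apply: eq_integral => t _; rewrite normcC ger0_norm.
  rewrite -hE lee_fin (_ : 4 = 2 ^+ 2); last by rewrite -natrX.
  rewrite ler_pXn2r ?nnegrE ?nrm_ge0 //; apply: le_trans hS _.
  by apply: le_trans (sum_half_pow (leq0n n)) _; rewrite expr0 mulr1.
have ndS t : {homo (fun n => (S n t ^+ 2)%:E) : m n / (m <= n)%N >-> (m <= n)%E}.
  apply/nondecreasing_seqP => n; rewrite lee_fin ler_pXn2r ?nnegrE //.
  by rewrite /S /series /= big_nat_recr //= lerDl.
pose G t := limn (fun n => (S n t ^+ 2)%:E).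
have mS2 n : measurable_fun setT (fun t => (S n t ^+ 2)%:E).
  by apply/measurable_EFinP/measurable_funX.
have SG t : (S n t ^+ 2)%:E @[n --> \oo] --> G t by apply: ereal_nondecreasing_is_cvgn.
have mG : measurable_fun setT G.
  by apply: (emeasurable_fun_cvg (fun n t => (S n t ^+ 2)%:E)) => // t _; exact: SG.
have G0 t : (0 <= G t)%E.
  by apply: lime_ge; [exact: cvgP (SG t)|apply: nearW => n; rewrite lee_fin sqr_ge0].
have iG : mu.-integrable setT G.
  apply/integrableP; split=> //.
  apply: (@le_lt_trans _ _ 4%:E); last exact: ltry.
  rewrite (_ : (\int[mu]_x `|G x|)%E = (\int[mu]_x G x)%E); last first.
    by apply: eq_integral => t _; rewrite gee0_abs.
  apply: (fatou_le mS2 _ SG) => [n t|]; first by rewrite lee_fin sqr_ge0.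
  exact: nearW.
exists (G @^-1` [set z | z \is a fin_num]).
  by rewrite -[X in measurable X]setTI; exact: emeasurable_fin_num.
split.
  have := @integrable_ae _ _ _ mu setT measurableT G iG.
  by apply: ae_imp => t /(_ I).
move=> t /= Gfin; apply: nondecreasing_is_cvgn.
  by apply/nondecreasing_seqP => n; rewrite /series /= big_nat_recr //= lerDl normc_ge0.
exists (fine (G t) + 1) => _ [n _ <-].
have : (S n t) ^+ 2 <= fine (G t).
  rewrite -lee_fin fineK //; apply: lime_ge; first exact: cvgP (SG t).
  by exists n => // m nm; exact: ndS.
have := S0 n t; rewrite -/(S n t); nra.
Qed.

(** Riesz-Fischer: the sequence converges pointwise almost everywhere by
    [rapid_summable], and Fatou's lemma bounds the distance of the limit to each u_n. *)
Theorem L2_complete (u : nat -> L2line R) :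
  (forall n, nrm (u n.+1 - u n) <= 2^-1 ^+ n) ->
  exists l, forall n, nrm (l - u n) <= 2 * 2^-1 ^+ n.
Proof.
move=> hu; have [E mE [aeE cE]] := rapid_summable hu.
pose e (t : R) : R[i] := ((\1_E t : R))%:C.
have me : cmeasurable setT e by apply: cmeasurable_real; exact: measurable_indic.
have e1 t : E t -> e t = 1 by move=> Et; rewrite /e indicE mem_set.
have e0 t : ~ E t -> e t = 0 by move=> Et; rewrite /e indicE memNset.
have en t : normc (e t) <= 1.
  by have [/e1 ->|/e0 ->] := pselect (E t); rewrite ?normc1 ?normc0.
pose f n t := e t * L2repr (u n) t.
have fi n : inL2 (f n) by apply: (inL2_mul_bounded me en); exact: L2reprP.
have fu n : L2class (f n) = u n.
  rewrite -[RHS]L2classK; apply: L2class_eq => //; first exact: L2reprP.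
  by apply: ae_imp aeE => t /e1; rewrite /f => ->; rewrite mul1r.
have cf (p : R[i] -> R) t : (forall a b : R[i], p (a - b) = p a - p b) ->
    (forall a : R[i], `|p a| <= normc a) -> cvgn (fun n => p (f n t)).
  move=> pB pn; have p0 : p 0 = 0 by rewrite -(subrr 0) pB subrr.
  have [Et|/e0 e0t] := pselect (E t); last first.
    rewrite (_ : (fun _ => _) = cst 0); first exact: is_cvg_cst.
    by apply/funext => n; rewrite /f e0t mul0r p0.
  have -> : (fun n => p (f n t)) = (fun n => p (f 0%N t) +
      series (fun k => p (L2repr (u k.+1) t - L2repr (u k) t)) n).
    apply/funext => n; rewrite /series /=.
    under eq_bigr do rewrite pB; rewrite telescope_sumr //.
    by rewrite /f e1 // !mul1r addrC subrK.
  apply: is_cvgD; first exact: is_cvg_cst.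
  apply: normed_cvg; apply: series_le_cvg (cE t Et) => n //=.
  exact: normc_ge0.
have cRe t : cvgn (fun n => Re (f n t)).
  by apply: cf => [z w|z]; [rewrite Re_add Re_opp|exact: normRe_le].
have cIm t : cvgn (fun n => Im (f n t)).
  by apply: cf => [z w|z]; [rewrite Im_add Im_opp|exact: normIm_le].
pose g t := limn (fun n => Re (f n t)) +i* limn (fun n => Im (f n t)).
have fg t : normc (f n t - g t) @[n --> \oo] --> 0.
  have h : `|Re (f n t) - Re (g t)| + `|Im (f n t) - Im (g t)| @[n --> \oo] --> 0.
    rewrite -[X in _ --> X]addr0; apply: cvgD.
      by apply: cvg0_norm; apply/subr_cvg0; exact: (cRe t).
    by apply: cvg0_norm; apply/subr_cvg0; exact: (cIm t).
  apply: (@squeeze_cvgr _ _ _ _ (cst 0) _ _ _ _ _ h); last exact: cvg_cst.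
  near=> n; rewrite normc_ge0 /=; apply: le_trans (normc_le_ReIm _) _.
  by rewrite Re_add Re_opp Im_add Im_opp.
have mg : cmeasurable setT g.
  by apply: (cmeasurable_cvg measurableT (fun n => (fi n).1)) => t _; exact: fg.
have key n : (\int[mu]_t (normc (g t - f n t) ^+ 2)%:E <= ((2 * 2^-1 ^+ n) ^+ 2)%:E)%E.
  apply: (@fatou_le (fun m t => (normc (f m t - f n t) ^+ 2)%:E)).
  - move=> m; apply/measurable_EFinP/measurable_funX; apply: measurable_normc' => //.
    exact: cmeasurable_sub (fi m).1 (fi n).1.
  - by move=> m t; rewrite lee_fin sqr_ge0.
  - move=> t; apply: cvg_EFin; first exact: nearW.
    rewrite expr2; under eq_fun do rewrite expr2.
    suff h : normc (f m t - f n t) @[m --> \oo] --> normc (g t - f n t) by exact: cvgM.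
    apply/subr_cvg0; apply: norm_cvg0.
    apply: (@squeeze_cvgr _ _ _ _ (cst 0) _ _ _ _ _ (fg t)); last exact: cvg_cst.
    near=> m; rewrite normr_ge0 /= ler_norml.
    have h1 := lerB_normc (f m t - f n t) (g t - f n t).
    have h2 := lerB_normc (g t - f n t) (f m t - f n t).
    rewrite !opprB !addrA !subrK in h1 h2; rewrite (normcBC (g t) (f m t)) in h2.
    by apply/andP; split; lra.
  - exists n => // m /= nm; have fmn := inL2_sub (fi m) (fi n).
    rewrite -sqintE // -nrm_class // -L2class_sub // !fu lee_fin.
    rewrite ler_pXn2r ?nnegrE ?nrm_ge0 ?mulr_ge0 ?exprn_ge0 ?invr_ge0 //.
    exact: rapid_dist.
have gfi n : inL2 (fun t => g t - f n t).
  split; first exact: cmeasurable_sub mg (fi n).1.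
  by apply: le_lt_trans (key n) _; exact: ltry.
have gi : inL2 g.
  by have := inL2_add (gfi 0%N) (fi 0%N); under eq_fun do rewrite subrK.
exists (L2class g) => n; rewrite -fu L2class_sub //.
apply: nrm_le_sqr; first by rewrite mulr_ge0 // exprn_ge0 // invr_ge0.
by rewrite nrm_class // -lee_fin sqintE.
Unshelve. all: end_near. Qed.

Definition L2cvg (u : nat -> L2line R) (l : L2line R) : Prop :=
  nrm (u n - l) @[n --> \oo] --> 0.

Lemma rapid_cvg (u : nat -> L2line R) : (forall n, nrm (u n.+1 - u n) <= 2^-1 ^+ n) ->
  exists l, L2cvg u l /\ forall n, nrm (l - u n) <= 2 * 2^-1 ^+ n.
Proof.
move=> /L2_complete[l hl]; exists l; split=> //.
have h : 2 * (2^-1 : R) ^+ n @[n --> \oo] --> 0.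
  by rewrite -(mulr0 2); apply: cvgMr; exact: half_pow_cvg0.
apply: (@squeeze_cvgr _ _ _ _ (cst 0) _ _ _ _ _ h); last exact: cvg_cst.
by near=> n; rewrite nrm_ge0 /= nrmBC.
Unshelve. all: end_near. Qed.

End Completeness.

Section Projection.
Context (R : realType).
Local Notation mu := (@lebesgue_measure R).
Implicit Types (x y z : L2line R) (H : set (L2line R)).

Lemma L2cvg_nrm (u : nat -> L2line R) l x : L2cvg u l ->
  nrm (x - u n) @[n --> \oo] --> nrm (x - l).
Proof.
move=> ul; apply/subr_cvg0; apply: norm_cvg0.
apply: (@squeeze_cvgr _ _ _ _ (cst 0) _ _ _ _ _ ul); last exact: cvg_cst.
near=> n; rewrite normr_ge0 /= ler_norml.
have h1 := nrmD (x - l) (l - u n); have h2 := nrmD (x - u n) (u n - l).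
rewrite !addrA !subrK in h1 h2; rewrite (nrmBC l) in h1.
by apply/andP; split; lra.
Unshelve. all: end_near. Qed.

(** Closedness is sequential, which is what completeness produces. *)
Record closed_subspace H : Prop := ClosedSubspace {
  csub0 : H 0;
  csubD : forall x y, H x -> H y -> H (x + y);
  csubZ : forall (a : R[i]) x, H x -> H (a *: x);
  csub_lim : forall u l, (forall n, H (u n)) -> L2cvg u l -> H l }.

Lemma csubB H x y : closed_subspace H -> H x -> H y -> H (x - y).
Proof. by move=> cH Hx Hy; rewrite -scaleN1r; apply: csubD => //; exact: csubZ. Qed.

(** If y were not orthogonal to x, moving from x in the direction of y would
    decrease the norm. *)
Lemma orthogonal_of_minimal x y :
  (forall a : R[i], nrm x ^+ 2 <= nrm (x - a *: y) ^+ 2) -> L2dot x y = 0.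
Proof.
move=> hx; apply/eqP; rewrite -normc_eq0 -sqrf_eq0.
set c := normc _; set b := nrm y ^+ 2.
have b0 : 0 <= b by rewrite sqr_ge0.
have b1 : 0 < b + 1 by rewrite ltr_wpDl.
have := hx ((b + 1)^-1%:C * L2dot x y).
rewrite nrm_sqrB nrmZ dotZr normcM normcC ger0_norm ?invr_ge0 ?(ltW b1) // -/c.
have -> : Re (((b + 1)^-1%:C * L2dot x y)^*%C * L2dot x y) = (b + 1)^-1 * c ^+ 2.
  by rewrite conjcM conjc_real -mulrA [_^*%C * _]mulrC conjcK_mul -rmorphM.
rewrite exprMn -/b.
rewrite -addrA lerDl => h; rewrite eq_le sqr_ge0 andbT.
have e : ((b + 1)^-1 * c) ^+ 2 * b - 2 * ((b + 1)^-1 * c ^+ 2) =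
  - (c ^+ 2 * ((b + 2) / (b + 1) ^+ 2)).
  by field; rewrite gt_eqF.
move: h; rewrite e oppr_ge0 pmulr_lle0 // divr_gt0 ?exprn_gt0 //.
by rewrite ltr_wpDl.
Qed.

(** Choose points whose squared distance to x is within 4^-n / 4 of the infimum; by the
    parallelogram identity they form a rapidly Cauchy sequence. *)
Theorem orthogonal_projection H x : closed_subspace H ->
  exists2 h, H h & forall k, H k -> L2dot (x - h) k = 0.
Proof.
move=> cH; pose D := [set nrm (x - h) ^+ 2 | h in H].
have D0 : D !=set0 by exists (nrm (x - 0) ^+ 2), 0 => //; exact: csub0.
have lD : has_lbound D by exists 0 => _ [h _ <-]; exact: sqr_ge0.
have hD h : H h -> inf D <= nrm (x - h) ^+ 2.
  by move=> Hh; apply: ge_inf => //; exists h.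
pose e n : R := (2^-1 ^+ n) ^+ 2 / 4.
have e0 n : 0 < e n by rewrite divr_gt0 // !exprn_gt0 // invr_gt0.
have /choice[u hu] n : exists h, H h /\ nrm (x - h) ^+ 2 < inf D + e n.
  have [_ [h Hh <-] hh] := inf_adherent (e0 n) (conj D0 lD).
  by exists h.
have step n : nrm (u n.+1 - u n) <= 2^-1 ^+ n.
  apply: nrm_le_sqr; first by rewrite exprn_ge0 // invr_ge0.
  have := nrm_parallelogram (x - u n) (x - u n.+1).
  have -> : x - u n - (x - u n.+1) = u n.+1 - u n by rewrite opprB addrC subrKA.
  have -> : x - u n + (x - u n.+1) = 2 *: (x - 2^-1 *: (u n + u n.+1)).
    by rewrite scalerBr scalerA divff ?pnatr_eq0 // scale1r scaler_nat mulr2n opprD addrACA.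
  rewrite nrmZ [in normc _](natC R 2) normcC ger0_norm // exprMn.
  have := hD _ (csubZ cH 2^-1 (csubD cH (hu n).1 (hu n.+1).1)).
  have [_ h1] := hu n; have [_ h2] := hu n.+1.
  have en : e n.+1 <= e n.
    rewrite /e ler_pM2r ?invr_gt0 // [_ ^+ n.+1]exprS exprMn ler_piMl ?sqr_ge0 //.
    by rewrite exprVn invf_le1 ?exprn_gt0 // -natrX ler1n.
  have -> : (2^-1 ^+ n) ^+ 2 = 4 * e n by rewrite /e mulrC divfK.
  by move: h1 h2 en; lra.
have [l [ul _]] := rapid_cvg step.
have Hl : H l := csub_lim cH (fun n => (hu n).1) ul.
exists l => // k Hk; apply: orthogonal_of_minimal => a.
have -> : x - l - a *: k = x - (l + a *: k) by rewrite opprD addrA.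
apply: le_trans (hD _ (csubD cH Hl (csubZ cH a Hk))).
have c1 : nrm (x - u n) ^+ 2 @[n --> \oo] --> nrm (x - l) ^+ 2.
  have c : nrm (x - u n) @[n --> \oo] --> nrm (x - l) by exact: L2cvg_nrm.
  by rewrite expr2; under eq_fun do rewrite expr2; exact: cvgM.
have c2 : inf D + e n @[n --> \oo] --> inf D.
  rewrite -[X in _ --> X]addr0; apply: cvgD; first exact: cvg_cst.
  rewrite -(mul0r 4^-1) -(mul0r 0); apply: cvgMl; under eq_fun do rewrite expr2.
  by apply: cvgM; exact: half_pow_cvg0.
apply: (ler_cvg_to c1 c2).
by near=> n; exact: ltW (hu n).2.
Unshelve. all: end_near. Qed.

Lemma L2projP H x : closed_subspace H ->
  H (L2proj H x) /\ forall k, H k -> L2dot (x - L2proj H x) k = 0.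
Proof.
move=> cH; have [h Hh hk] := orthogonal_projection x cH.
rewrite /L2proj; case: xgetP => [y _ [] //|/(_ h)].
by case; split.
Qed.

Lemma L2proj_unique H x h : closed_subspace H -> H h ->
  (forall k, H k -> L2dot (x - h) k = 0) -> L2proj H x = h.
Proof.
move=> cH Hh hk; have [Hp pk] := L2projP x cH.
apply/eqP; rewrite -subr_eq0; apply/eqP; apply: nrm_eq0.
apply/eqP; rewrite -sqrf_eq0; apply/eqP; apply: complexI; rewrite -dot_nrm.
have Hd : H (L2proj H x - h) by exact: csubB.
rewrite {1}(_ : L2proj H x - h = (x - h) - (x - L2proj H x)).
  by rewrite dotBl hk // pk // subrr.
by rewrite opprB [RHS]addrC subrKA.
Qed.

Lemma L2proj_id H x : closed_subspace H -> H x -> L2proj H x = x.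
Proof. by move=> cH Hx; apply: L2proj_unique => // k _; rewrite subrr dot0l. Qed.

Lemma L2proj_linear H : closed_subspace H -> linear (L2proj H).
Proof.
move=> cH a x y; have [[Hx px] [Hy py]] := (L2projP x cH, L2projP y cH).
apply: L2proj_unique => //; first by apply: csubD => //; exact: csubZ.
move=> k Hk; rewrite opprD addrACA -scalerBr dotDl dotZl px // py //.
by rewrite mulr0 addr0.
Qed.

Lemma proj_pythagoras H x : closed_subspace H ->
  nrm x ^+ 2 = nrm (x - L2proj H x) ^+ 2 + nrm (L2proj H x) ^+ 2.
Proof.
move=> cH; have [Hp pk] := L2projP x cH.
have := nrm_sqrD (x - L2proj H x) (L2proj H x).
by rewrite subrK pk // mulr0 addr0.
Qed.

Lemma nrm_projK H x : closed_subspace H -> nrm (x - L2proj H x) <= nrm x.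
Proof.
move=> cH; apply: nrm_le_sqr; first exact: nrm_ge0.
by rewrite (proj_pythagoras x cH) lerDl sqr_ge0.
Qed.

Lemma nrm_proj H x : closed_subspace H -> nrm (L2proj H x) <= nrm x.
Proof.
move=> cH; apply: nrm_le_sqr; first exact: nrm_ge0.
by rewrite (proj_pythagoras x cH) lerDr sqr_ge0.
Qed.

End Projection.

Section Compactness.
Context (R : realType).
Implicit Types (x y z : L2line R).

Lemma nbhs_L2 x (A : set (L2line R)) : nbhs x A <->
  exists2 e : R, 0 < e & forall y, nrm (x - y) < e -> A y.
Proof.
split.
- move=> /nbhs_normP[e /= e0 hA].
  have eR : e = (Re e)%:C by move: e0; rewrite ltcE => /andP[/eqP]; case: (e) => a b /= -> _.
  exists (Re e); first by move: e0; rewrite eR ltcR.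
  by move=> y xy; apply: hA; rewrite /ball_ /= eR normL2E ltcR.
- move=> [e e0 hA]; apply/nbhs_normP; exists e%:C => /=; first by rewrite ltcR.
  by move=> y; rewrite /ball_ /= normL2E ltcR; exact: hA.
Qed.

Lemma cvg_L2P (T : Type) (F : set_system T) {FF : Filter F} (f : T -> L2line R) l :
  f @ F --> l <-> forall e : R, 0 < e -> \forall t \near F, nrm (l - f t) < e.
Proof.
split=> [fl e e0|h A /nbhs_L2[e e0 hA]].
- by apply: (fl [set y | nrm (l - y) < e]); apply/nbhs_L2; exists e.
- by apply: filterS (h e e0) => t; exact: hA.
Qed.

(** An ultrafilter containing a finite union of balls contains one of them; so an
    ultrafilter on the closure of K contains arbitrarily small balls.  Their centers
    form a rapidly Cauchy sequence whose limit is the limit of the ultrafilter. *)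
Lemma totally_bounded_precompact (K : set (L2line R)) :
  (forall e : R, 0 < e -> exists s : seq (L2line R),
     forall x, K x -> exists2 y, y \in s & nrm (x - y) < e) ->
  precompact K.
Proof.
move=> tb; rewrite precompactE compact_ultra => F FU FK.
have clK e : 0 < e -> exists c, F [set x | nrm (x - c) < e].
  move=> e0; have e2 : 0 < e / 2 by rewrite divr_gt0.
  have [s hs] := tb _ e2.
  have : F [set x | exists2 y, y \in s & nrm (x - y) < e].
    apply: filterS FK => x Kx.
    have [y [Ky xy]] : K `&` [set y | nrm (x - y) < e / 2] !=set0.
      by apply: Kx; apply/nbhs_L2; exists (e / 2).
    have [c cs yc] := hs y Ky; exists c => //.
    rewrite -(subrK y x) -addrA; apply: le_lt_trans (nrmD _ _) _.
    by rewrite [e in _ < e]splitr ltrD.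
  elim: s {hs} => [|c s ih] hF.
    exfalso; apply: (@filter_not_empty _ F); apply: filterS hF => x [] //.
  have [Fc|Fc] := in_ultra_setVsetC [set x | nrm (x - c) < e] FU; first by exists c.
  apply: ih; apply: (@filterS2 _ F _ _ _ _ _ hF Fc) => x [y].
  by rewrite inE => /predU1P[->|ys xy] // _; exists y.
have p n : 0 < (2^-1 : R) ^+ n.+2 by rewrite exprn_gt0 // invr_gt0.
have /choice[c hc] n := clK _ (p n).
have near_c m n : nrm (c m - c n) <= 2^-1 ^+ m.+2 + 2^-1 ^+ n.+2.
  have [x [xm xn]] : [set x | nrm (x - c m) < 2^-1 ^+ m.+2] `&`
      [set x | nrm (x - c n) < 2^-1 ^+ n.+2] !=set0.
    by apply: (@filter_ex _ F); exact: filterI (hc m) (hc n).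
  have -> : c m - c n = (x - c n) - (x - c m) by rewrite opprB [RHS]addrC subrKA.
  apply: le_trans (nrmB _ _) _; rewrite addrC; apply: ltW; exact: ltrD.
have [l [cl hl]] : exists l, L2cvg c l /\ forall n, nrm (l - c n) <= 2 * 2^-1 ^+ n.
  apply: rapid_cvg => n; apply: le_trans (near_c n.+1 n) _.
  have : 0 <= (2^-1 : R) ^+ n by rewrite exprn_ge0 // invr_ge0.
  rewrite !exprS; set a := _ ^+ n; lra.
have Fl : F --> l.
  move=> A /nbhs_L2[e e0 hA].
  have /cvgrPdist_lt /(_ (e / 3)) := @half_pow_cvg0 R.
  case; first by rewrite divr_gt0.
  move=> N _ /(_ N (leqnn N)) /=; rewrite sub0r normrN ger0_norm; last first.
    by rewrite exprn_ge0 // invr_ge0.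
  move=> hN; apply: filterS (hc N) => x xc; apply: hA.
  have -> : l - x = (l - c N) - (x - c N) by rewrite opprB addrA subrK.
  apply: le_lt_trans (nrmB _ _) _; have := hl N.
  have : (2^-1 : R) ^+ N.+2 <= 2^-1 ^+ N.
    rewrite !exprS; have : 0 <= (2^-1 : R) ^+ N by rewrite exprn_ge0 // invr_ge0.
    by set a := _ ^+ N; lra.
  by move: hN; move: xc => /=; lra.
exists l; split=> //.
suff : closure (closure K) l by rewrite -(closure_id (closure K)).1 //; exact: closed_closure.
move=> A lA.
by have : F (closure K `&` A) by [apply: filterI => //; exact: Fl]; exact: filter_ex.
Qed.

End Compactness.

(** * Compactness of Hankel-type operators *)

Section Multiplication.
Context (R : realType).
Local Notation mu := (@lebesgue_measure R).
Implicit Types (u v : R -> R[i]) (x y z : L2line R).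

Definition bounded_multiplier v : Prop :=
  cmeasurable setT v /\ exists M : R, forall t, normc (v t) <= M.

Lemma bmul_inL2 v f : bounded_multiplier v -> inL2 f -> inL2 (fun t => v t * f t).
Proof. by move=> [mv [M hM]]; exact: inL2_mul_bounded. Qed.

Lemma bmul_cst (c : R[i]) : bounded_multiplier (fun _ => c).
Proof. by split; [exact: cmeasurable_cst|exists (normc c)]. Qed.

Lemma bmul_mul u v : bounded_multiplier u -> bounded_multiplier v ->
  bounded_multiplier (fun t => u t * v t).
Proof.
move=> [mu' [M hM]] [mv [N hN]]; split; first exact: cmeasurable_mul.
exists (M * N) => t; rewrite normcM.
by apply: ler_pM (hM t) (hN t); exact: normc_ge0.
Qed.

Lemma bmul_add u v : bounded_multiplier u -> bounded_multiplier v ->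
  bounded_multiplier (fun t => u t + v t).
Proof.
move=> [mu' [M hM]] [mv [N hN]]; split; first exact: cmeasurable_add.
by exists (M + N) => t; apply: le_trans (le_normcD _ _) (lerD (hM t) (hN t)).
Qed.

Lemma bmul_sub u v : bounded_multiplier u -> bounded_multiplier v ->
  bounded_multiplier (fun t => u t - v t).
Proof.
move=> hu hv; have := bmul_add hu (bmul_mul (bmul_cst (-1)) hv).
by under eq_fun do rewrite mulN1r.
Qed.

Lemma L2mul_class v f : bounded_multiplier v -> inL2 f ->
  L2mul v (L2class f) = L2class (fun t => v t * f t).
Proof.
move=> bv fi; apply: L2class_eq; [exact: bmul_inL2 (L2reprP _)|exact: bmul_inL2|].
by apply: ae_imp (L2repr_class fi) => t ->.
Qed.

Lemma L2mul_linear v (a : R[i]) x y : bounded_multiplier v ->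
  L2mul v (a *: x + y) = a *: L2mul v x + L2mul v y.
Proof.
move=> bv; rewrite -(L2classK x) -(L2classK y).
have [xi yi] := (L2reprP x, L2reprP y).
rewrite L2classZ // L2class_add //; last exact: inL2Z.
rewrite !L2mul_class //; last by apply: inL2_add => //; exact: inL2Z.
rewrite L2classZ; last exact: bmul_inL2.
rewrite L2class_add; [|by apply: inL2Z; exact: bmul_inL2|exact: bmul_inL2].
by congr L2class; apply/funext => t; ring.
Qed.

Lemma L2mul_addl u v x : bounded_multiplier u -> bounded_multiplier v ->
  L2mul (fun t => u t + v t) x = L2mul u x + L2mul v x.
Proof.
move=> bu bv; have xi := L2reprP x; rewrite /L2mul L2class_add; [|exact: bmul_inL2..].
by congr L2class; apply/funext => t; ring.
Qed.

Lemma L2mul_mull u v x : bounded_multiplier u -> bounded_multiplier v ->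
  L2mul (fun t => u t * v t) x = L2mul u (L2mul v x).
Proof.
move=> bu bv; have xi := L2reprP x.
rewrite [L2mul v x]/L2mul L2mul_class //; last exact: bmul_inL2.
by rewrite /L2mul; congr L2class; apply/funext => t; rewrite mulrA.
Qed.

Lemma L2mul_cst (a : R[i]) x : L2mul (fun _ => a) x = a *: x.
Proof. by rewrite -[in RHS](L2classK x) L2classZ //; exact: L2reprP. Qed.

Lemma L2mul_subr v x y : bounded_multiplier v -> L2mul v (x - y) = L2mul v x - L2mul v y.
Proof.
by move=> bv; rewrite addrC -scaleN1r L2mul_linear // scaleN1r addrC.
Qed.

Lemma nrm_L2mul v x (M : R) : cmeasurable setT v -> (forall t, normc (v t) <= M) ->
  nrm (L2mul v x) <= M * nrm x.
Proof.
move=> mv vM; have xi := L2reprP x.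
have M0 : 0 <= M by apply: le_trans (vM 0); exact: normc_ge0.
apply: nrm_le_sqr; first by rewrite mulr_ge0 ?nrm_ge0.
have Mi : inL2 (fun t => M%:C * L2repr x t) by exact: inL2Z.
have -> : (M * nrm x) ^+ 2 = nrm (L2class (fun t => M%:C * L2repr x t)) ^+ 2.
  by rewrite -L2classZ // L2classK nrmZ normcC ger0_norm.
rewrite !nrm_class //; last exact: inL2_mul_bounded mv vM xi.
apply: le_sqint => //; first exact: inL2_mul_bounded mv vM xi.
by move=> t; rewrite !normcM normcC ger0_norm // ler_wpM2r ?normc_ge0.
Qed.

End Multiplication.

Section HankelCompactness.
Context (R : realType) (H : set (L2line R)) (cH : closed_subspace H).
Local Notation P := (L2proj H).
Implicit Types (u v : R -> R[i]) (x y z : L2line R).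

(** The Hankel-type operator of symbol v, before precomposition with the projection. *)
Definition hank v x : L2line R := L2mul v x - P (L2mul v x).

Lemma proj_add x y : P (x + y) = P x + P y.
Proof. by rewrite -[x]scale1r (L2proj_linear cH) !scale1r. Qed.

Lemma hank_linear v (a : R[i]) x y : bounded_multiplier v ->
  hank v (a *: x + y) = a *: hank v x + hank v y.
Proof.
move=> bv; rewrite /hank L2mul_linear // (L2proj_linear cH) scalerBr.
by rewrite opprD addrACA.
Qed.

Lemma hank_sub v x y : bounded_multiplier v -> hank v (x - y) = hank v x - hank v y.
Proof.
move=> bv; rewrite [x - y]addrC -scaleN1r. rewrite hank_linear //. by rewrite scaleN1r [RHS]addrC.
Qed.

Lemma hankZ v (a : R[i]) x : bounded_multiplier v -> hank v (a *: x) = a *: hank v x.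
Proof.
move=> bv; rewrite -[a *: x]addr0 hank_linear //.
have -> : hank v 0 = 0 by have := hank_sub 0 0 bv; rewrite !subrr.
by rewrite addr0.
Qed.

Lemma hank_addl u v x : bounded_multiplier u -> bounded_multiplier v ->
  hank (fun t => u t + v t) x = hank u x + hank v x.
Proof.
by move=> bu bv; rewrite /hank L2mul_addl // proj_add opprD addrACA.
Qed.

Lemma hank_mulcst v (a : R[i]) x : bounded_multiplier v ->
  hank (fun t => a * v t) x = a *: hank v x.
Proof.
move=> bv; rewrite /hank L2mul_mull ?L2mul_cst //; last exact: bmul_cst.
have -> y : P (a *: y) = a *: P y.
  by have := L2proj_linear cH a y 0; rewrite !addr0 (L2proj_id cH (csub0 cH)) addr0.
by rewrite scalerBr.
Qed.

Lemma nrm_hank v x (M : R) : cmeasurable setT v -> (forall t, normc (v t) <= M) ->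
  nrm (hank v x) <= M * nrm x.
Proof. by move=> mv vM; apply: le_trans (nrm_projK _ cH) _; exact: nrm_L2mul. Qed.

(** Compactness in the form closed under uniform limits: up to e, the operator is
    controlled by finitely many linear functionals. *)
Definition hcompact v : Prop := bounded_multiplier v /\
  forall e : R, 0 < e -> exists s : seq (L2line R), forall g, H g ->
    nrm (hank v g) <= e * nrm g + \sum_(k <- s) normc (L2dot g k).

Lemma hcompact_add u v : hcompact u -> hcompact v ->
  hcompact (fun t => u t + v t).
Proof.
move=> [bu hu] [bv hv]; split; first exact: bmul_add.
move=> e e0; have e2 : 0 < e / 2 by rewrite divr_gt0.
have [s hs] := hu _ e2; have [s' hs'] := hv _ e2.
exists (s ++ s') => g Hg; rewrite hank_addl // big_cat /=.
apply: le_trans (nrmD _ _) _; apply: le_trans (lerD (hs g Hg) (hs' g Hg)) _.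
by rewrite addrACA -mulrDl -splitr.
Qed.

Lemma hcompactZ v (a : R[i]) : hcompact v -> hcompact (fun t => a * v t).
Proof.
move=> [bv hv]; split; first exact: bmul_mul (bmul_cst a) bv.
move=> e e0; have a0 : 0 < normc a + 1 by rewrite ltr_wpDl ?normc_ge0.
have [s hs] := hv (e / (normc a + 1)) (divr_gt0 e0 a0).
exists [seq (normc a)%:C *: k | k <- s] => g Hg.
rewrite hank_mulcst // nrmZ big_map.
have -> : \sum_(k <- s) normc (L2dot g ((normc a)%:C *: k)) =
    normc a * \sum_(k <- s) normc (L2dot g k).
  rewrite big_distrr /=; apply: eq_bigr => k _.
  by rewrite dotZr normcM conjc_real normcC ger0_norm ?normc_ge0.
apply: le_trans (ler_wpM2l (normc_ge0 a) (hs g Hg)) _.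
rewrite mulrDr lerD2r mulrA ler_wpM2r ?nrm_ge0 //.
by rewrite mulrA ler_pdivrMr // mulrC ler_pM2l // lerDl.
Qed.

Lemma hcompact_of_stable v : bounded_multiplier v ->
  (forall g, H g -> H (L2mul v g)) -> hcompact v.
Proof.
move=> bv sv; split=> // e e0; exists [::] => g Hg.
by rewrite /hank (L2proj_id cH (sv g Hg)) subrr nrm0 big_nil addr0 mulr_ge0 ?nrm_ge0 // ltW.
Qed.

(** The operator depends on its symbol with norm at most the supremum norm. *)
Lemma hcompact_unif v : bounded_multiplier v ->
  (forall e : R, 0 < e -> exists2 u, hcompact u & forall t, normc (v t - u t) <= e) ->
  hcompact v.
Proof.
move=> bv hv; split=> // e e0; have e2 : 0 < e / 2 by rewrite divr_gt0.
have [u [bu hu] vu] := hv _ e2; have [s hs] := hu _ e2.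
exists s => g Hg.
have bvu := bmul_sub bv bu.
have -> : v = (fun t => (v t - u t) + u t) by apply/funext => t; rewrite subrK.
rewrite hank_addl //; apply: le_trans (nrmD _ _) _.
apply: le_trans (lerD (nrm_hank g bvu.1 vu) (hs g Hg)) _.
by rewrite addrA -mulrDl -splitr.
Qed.

(** If multiplication by v maps into H the kernel in H of one functional, the
    operator vanishes on that hyperplane and so has rank at most one. *)
Lemma hcompact_rank1 v k : bounded_multiplier v ->
  (forall g, H g -> L2dot g k = 0 -> H (L2mul v g)) -> hcompact v.
Proof.
move=> bv hk; split=> // e e0.
have z g : H g -> L2dot g k = 0 -> hank v g = 0.
  by move=> Hg gk; rewrite /hank (L2proj_id cH (hk g Hg gk)) subrr.
have [[g0 [Hg0 gk0]]|nex] := pselect (exists g0, H g0 /\ L2dot g0 k <> 0).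
- pose c := nrm (hank v g0) / normc (L2dot g0 k).
  exists [:: c%:C *: k] => g Hg; rewrite big_seq1 dotZr conjc_real normcM normcC.
  have c0 : 0 <= c by rewrite divr_ge0 ?nrm_ge0 ?normc_ge0.
  pose a := L2dot g k / L2dot g0 k.
  have : hank v (g - a *: g0) = 0.
    apply: z; first by apply: csubB => //; exact: csubZ.
    by rewrite dotBl dotZl /a divfK ?subrr //; apply/eqP.
  rewrite hank_sub // hankZ // => /eqP; rewrite subr_eq0 => /eqP ->.
  rewrite nrmZ /a normcM normcV ger0_norm // /c.
  have -> (p q r s : R) : p / q * r <= s + r / q * p = (0 <= s).
    by rewrite (_ : r / q * p = p / q * r) ?lerDr //; ring.
  by rewrite mulr_ge0 ?nrm_ge0 // ltW.
- exists [::] => g Hg; rewrite big_nil addr0 z ?nrm0 ?mulr_ge0 ?nrm_ge0 ?ltW //.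
  by apply: contrapT => gk; apply: nex; exists g.
Qed.

Lemma finite_code_net (A : set (L2line R)) (T : finType) (f : L2line R -> T) :
  exists s : seq (L2line R), (forall c, c \in s -> A c) /\
    forall x, A x -> exists2 c, c \in s & f c = f x.
Proof.
suff h (r : seq T) : exists s : seq (L2line R), (forall c, c \in s -> A c) /\
    forall x, A x -> f x \in r -> exists2 c, c \in s & f c = f x.
  have [s [sA hs]] := h (enum T); exists s; split=> // x Ax.
  by apply: hs => //; rewrite mem_enum.
elim: r => [|a r [s [sA hs]]]; first by exists [::].
have [[c [Ac fc]]|nex] := pselect (exists c, A c /\ f c = a).
- exists (c :: s); split=> [d|x Ax].
    by rewrite inE => /predU1P[->//|/sA].
  rewrite inE => /predU1P[fx|/(hs x Ax)[d ds fd]].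
    by exists c; rewrite ?mem_head // fc.
  by exists d => //; rewrite inE ds orbT.
- exists s; split=> // x Ax; rewrite inE => /predU1P[fx|/(hs x Ax)//].
  by exfalso; apply: nex; exists x.
Qed.

Lemma truncn_eq_dist (a b : R) : 0 <= a -> 0 <= b ->
  Num.truncn a = Num.truncn b -> `|a - b| < 1.
Proof.
move=> a0 b0 ab; have /andP[] := truncn_itv a0; have /andP[] := truncn_itv b0.
by rewrite ab ltr_distl -!natr1; set n := _%:R => *; apply/andP; split; lra.
Qed.

(** The values of finitely many bounded functionals on a bounded set fall into
    finitely many cells; one picks a point in each nonempty cell. *)
Lemma functional_net (A : set (L2line R)) (s : seq (L2line R)) (d : R) : 0 < d ->
  (forall x, A x -> nrm x <= 1) ->
  exists cs : seq (L2line R), (forall c, c \in cs -> A c) /\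
    forall x, A x -> exists2 c, c \in cs &
      forall k, k \in s -> normc (L2dot (x - c) k) <= 2 * d.
Proof.
move=> d0 A1.
pose C := \sum_(k <- s) nrm k.
have Ck k : k \in s -> nrm k <= C.
  move=> ks; rewrite /C (big_rem k) //= lerDl.
  by apply: sumr_ge0 => *; exact: nrm_ge0.
pose q (r : R) := Num.truncn ((r + C) / d).
pose M := Num.truncn ((C + C) / d).
pose code x : {ffun 'I_(size s) -> 'I_M.+1 * 'I_M.+1} :=
  [ffun i : 'I_(size s) => (inord (q (Re (L2dot x (nth 0 s i)))),
                            inord (q (Im (L2dot x (nth 0 s i)))))].
have [cs [csA hcs]] := finite_code_net A code.
exists cs; split=> // x Ax; have [c cc cx] := hcs x Ax.
exists c => // k ks.
have ik : (index k s < size s)%N by rewrite index_mem.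
have /ffunP/(_ (Ordinal ik)) := cx; rewrite !ffunE /= nth_index // => -[e1 e2].
have bd y : A y -> normc (L2dot y k) <= C.
  move=> Ay; apply: le_trans (cauchy_schwarz _ _) _; apply: le_trans (Ck k ks).
  by rewrite ler_piMl ?nrm_ge0 ?A1.
have cell (r r' : R) : `|r| <= C -> `|r'| <= C ->
    inord (q r) = inord (q r') :> 'I_M.+1 -> `|r - r'| <= d.
  move=> rC rC' /(congr1 val) /=.
  have pos (p : R) : `|p| <= C -> 0 <= (p + C) / d.
    by rewrite ler_norml => /andP[h _]; rewrite divr_ge0 ?(ltW d0) // -lerBlDr sub0r.
  have lt (p : R) : `|p| <= C -> (q p < M.+1)%N.
    move=> pC; rewrite ltnS; apply: le_truncn.
    by rewrite ler_pM2r ?invr_gt0 // lerD2r; move: pC; rewrite ler_norml => /andP[].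
  rewrite !inordK ?lt // => /(truncn_eq_dist (pos _ rC) (pos _ rC')).
  rewrite -mulrBl opprD addrACA subrr addr0 normrM normfV (gtr0_norm d0).
  by rewrite ltr_pdivrMr // mul1r => /ltW.
rewrite dotBl; apply: le_trans (normc_le_ReIm _) _.
rewrite Re_add Im_add Re_opp Im_opp mulr2n mulrDl mul1r.
have [bx bc] := (bd x Ax, bd c (csA c cc)).
apply: lerD; apply: cell => //.
- by apply: le_trans bx; exact: normRe_le.
- by apply: le_trans bc; exact: normRe_le.
- by apply: le_trans bx; exact: normIm_le.
- by apply: le_trans bc; exact: normIm_le.
Qed.

(** Two points of the unit ball of H with close values under the finitely many
    functionals have close images, so [functional_net] provides finite nets of the
    image. *)
Theorem hcompact_compact v : hcompact v ->
  compact_operator (fun x => L2mul v (P x) - P (L2mul v (P x))).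
Proof.
move=> [bv hv]; split.
  by move=> a x y; rewrite (L2proj_linear cH) -/(hank v _) hank_linear.
apply: totally_bounded_precompact => e e0.
have e4 : 0 < e / 4 by rewrite divr_gt0.
have [s hs] := hv _ e4.
pose d := e / (8 * (size s).+1%:R).
have d0 : 0 < d by rewrite divr_gt0 // mulr_gt0.
have [cs [csA hcs]] := @functional_net [set g | H g /\ nrm g <= 1] s d d0 (fun x => @proj2 _ _).
exists [seq hank v c | c <- cs] => _ [x x1 <-].
have Hx : H (P x) by have [] := L2projP x cH.
have nx : nrm (P x) <= 1.
  apply: le_trans (nrm_proj _ cH) _; rewrite -lecR -normL2E; exact: x1.
have [c cc hc] := hcs (P x) (conj Hx nx).
have [Hc nc] := csA c cc.
exists (hank v c); first exact: map_f.
rewrite -/(hank v (P x)) -hank_sub //.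
apply: le_lt_trans (hs _ (csubB cH Hx Hc)) _.
have n2 : nrm (P x - c) <= 2.
  by apply: le_trans (nrmB _ _) _; rewrite (_ : 2 = 1 + 1) ?lerD // -natrD.
have sm : \sum_(k <- s) normc (L2dot (P x - c) k) <= (size s)%:R * (2 * d).
  have -> : (size s)%:R * (2 * d) = \sum_(k <- s) (2 * d).
    by rewrite big_const_seq count_predT iter_addr_0 mulr_natl.
  by rewrite big_seq [leRHS]big_seq; apply: ler_sum => k ks; exact: hc.
have dd : (size s)%:R * (2 * d) <= e / 4.
  rewrite /d; have n1 : 0 < (size s).+1%:R :> R by [].
  have -> : (size s)%:R * (2 * (e / (8 * (size s).+1%:R))) =
     (e / 4) * ((size s)%:R / (size s).+1%:R) by field; rewrite gt_eqF.
  by rewrite ler_piMr ?(ltW e4) // ler_pdivrMr // mul1r ler_nat.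
have ne : e / 4 * nrm (P x - c) <= e / 4 * 2 by rewrite ler_wpM2l ?(ltW e4).
apply: le_lt_trans (lerD ne (le_trans sm dd)) _.
by move: e0; clear; lra.
Qed.

End HankelCompactness.

(** * Cauchy's theorem on rectangles and strips *)

Section RealVariable.
Context (R : realType).
Local Notation mu := (@lebesgue_measure R).
Implicit Types (g h : R -> R[i]) (x a b : R).

(** Continuity at a point for the product topology of R[i], through the two real
    components. *)
Definition ccont_at g x : Prop :=
  {for x, continuous (fun t => Re (g t))} /\ {for x, continuous (fun t => Im (g t))}.

Lemma ccont_at_eps g x :
  (forall e : R, 0 < e -> \forall y \near x, normc (g y - g x) < e) -> ccont_at g x.
Proof.
move=> gx; split; apply/cvgrPdist_lt => e e0; near=> y.
- rewrite distrC -Re_opp -Re_add; apply: le_lt_trans (normRe_le _) _.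
  by near: y; exact: gx.
- rewrite distrC -Im_opp -Im_add; apply: le_lt_trans (normIm_le _) _.
  by near: y; exact: gx.
Unshelve. all: end_near. Qed.

Lemma ccont_add g h x : ccont_at g x -> ccont_at h x -> ccont_at (fun t => g t + h t) x.
Proof.
move=> [gr gi] [hr hi]; split.
- rewrite (_ : (fun _ => _) = (fun t => Re (g t) + Re (h t))); first exact: cvgD.
  by apply/funext => t; rewrite Re_add.
- rewrite (_ : (fun _ => _) = (fun t => Im (g t) + Im (h t))); first exact: cvgD.
  by apply/funext => t; rewrite Im_add.
Qed.

Lemma ccont_mul g h x : ccont_at g x -> ccont_at h x -> ccont_at (fun t => g t * h t) x.
Proof.
move=> [gr gi] [hr hi]; split.
- rewrite (_ : (fun _ => _) = (fun t => Re (g t) * Re (h t) - Im (g t) * Im (h t))).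
    by apply: cvgB; exact: cvgM.
  by apply/funext => t; rewrite Re_mul.
- rewrite (_ : (fun _ => _) = (fun t => Re (g t) * Im (h t) + Im (g t) * Re (h t))).
    by apply: cvgD; exact: cvgM.
  by apply/funext => t; rewrite Im_mul.
Qed.

Lemma ccont_cst (c : R[i]) x : ccont_at (fun _ => c) x.
Proof. by split; exact: cvg_cst. Qed.

Lemma ccont_sub g h x : ccont_at g x -> ccont_at h x -> ccont_at (fun t => g t - h t) x.
Proof.
move=> gx hx; have := ccont_add gx (ccont_mul (ccont_cst (-1) x) hx).
by under eq_fun do rewrite mulN1r.
Qed.

Lemma ccont_cmeasurable g : (forall x, ccont_at g x) -> cmeasurable setT g.
Proof.
by move=> cg; split; apply: continuous_measurable_fun => x; have [] := cg x.
Qed.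

Lemma ccont_cintegrable g a b : (forall x, a <= x <= b -> ccont_at g x) ->
  cintegrable `[a, b] g.
Proof.
move=> cg.
have cR : {within `[a, b], continuous (fun t => Re (g t))}.
  by apply: continuous_in_subspaceT => x; rewrite inE /= in_itv /= => /cg[].
have cI : {within `[a, b], continuous (fun t => Im (g t))}.
  by apply: continuous_in_subspaceT => x; rewrite inE /= in_itv /= => /cg[].
have iR := continuous_compact_integrable (@segment_compact _ a b) cR.
have iI := continuous_compact_integrable (@segment_compact _ a b) cI.
have mab : measurable `[a, b]%classic by [].
apply: (@le_cintegrable _ _ _ (fun t => `|Re (g t)| + `|Im (g t)|)) => //.
- split; first by have /measurable_int/measurable_EFinP := iR.
  by have /measurable_int/measurable_EFinP := iI.
- by move=> t _; exact: normc_le_ReIm.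
- exact: (integrable_addr mab (integrable_norm iR) (integrable_norm iI)).
Qed.

Lemma cintegral_itv_split g a b c : a <= b -> b <= c -> cintegrable `[a, c] g ->
  cintegral `[a, c] g = cintegral `[a, b] g + cintegral `[b, c] g.
Proof.
move=> ab bc gi.
have mac : measurable `[a, c]%classic by [].
have sp p : mu.-integrable `[a, c] (EFin \o p) ->
  \int[mu]_(t in `[a, c]) p t = \int[mu]_(t in `[a, b]) p t + \int[mu]_(t in `[b, c]) p t.
  move=> ip; have := @Rintegral_itvB R p (BLeft a) (BRight c) b ip.
  rewrite !bnd_simp => /(_ ab bc) /eqP; rewrite subr_eq => /eqP ->.
  rewrite addrC Rintegral_itv_obnd_cbnd //.
  apply: integrableS ip => //.
  by apply: subset_itvr; rewrite bnd_simp.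
apply: complexP; rewrite ?Re_add ?Im_add; apply: sp.
  exact: cintegrable_Re.
exact: cintegrable_Im.
Qed.

Lemma Rintegral_cst_itv (r : R) a b : a <= b ->
  \int[mu]_(_ in `[a, b]) r = r * (b - a).
Proof.
move=> ab; rewrite Rintegral_cst //.
have := @lebesgue_measure_itv R `[a, b]; rewrite /= => ->.
by rewrite lte_fin; case: ltgtP ab => //= [->]; rewrite subrr.
Qed.

Lemma cintegral_cst_itv (c : R[i]) a b : a <= b ->
  cintegral `[a, b] (fun _ => c) = c * (b - a)%:C.
Proof.
move=> ab; apply: complexP; rewrite ?Re_mul ?Im_mul /cintegral /= Rintegral_cst_itv //.
  by rewrite mulr0 subr0.
by rewrite mulr0 add0r.
Qed.

Lemma cintegrable_cst_itv (c : R[i]) a b : cintegrable `[a, b] (fun _ => c).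
Proof. by apply: ccont_cintegrable => x _; exact: ccont_cst. Qed.

Lemma normc_cintegral_itv g a b (M : R) : a <= b -> cintegrable `[a, b] g ->
  (forall x, a <= x <= b -> normc (g x) <= M) ->
  normc (cintegral `[a, b] g) <= M * (b - a).
Proof.
move=> ab gi gM; apply: le_trans (normc_cintegral _ gi) _ => //.
rewrite -Rintegral_cst_itv //; apply: le_Rintegral; first by [].
- exact: cintegrable_normc.
- have mab : measurable `[a, b]%classic by [].
  exact: (cintegrable_Re mab (cintegrable_cst_itv M%:C a b)).
- by move=> x; rewrite /= in_itv /=; exact: gM.
Qed.

End RealVariable.

Section ComplexDifferentiability.
Context (R : realType).
Implicit Types (f g : R[i] -> R[i]) (z w c : R[i]).

(** Complex differentiability with an explicit linear remainder.  This form is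
    symmetric in the increments and does not exclude w = z. *)
Definition cdiff f z : Prop := exists c : R[i], forall e : R, 0 < e ->
  exists2 d : R, 0 < d & forall w, normc (w - z) < d ->
    normc (f w - f z - c * (w - z)) <= e * normc (w - z).

Lemma quotient_remainder (F : fieldType) (c q k : F) : k != 0 ->
  q - c * k = - ((c - k^-1 * q) * k).
Proof. by move=> k0; field. Qed.

(** The bridge to the derivative used by [holomorphic_on]. *)
Lemma derivable_cdiff f z : derivable (f : R[i]^o -> R[i]^o) z 1 <-> cdiff f z.
Proof.
split.
- move=> /cvg_ex[/= c /cvgrPdist_lt fc]; exists c => e e0.
  have e0' : 0 < e%:C :> R[i] by rewrite ltcR.
  have /nbhs_normP[d /= d0 hd] := fc _ e0'.
  have dR : d = (Re d)%:C.
    by move: d0; rewrite ltcE => /andP[/eqP]; case: (d) => a b /= -> _.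
  exists (Re d); first by move: d0; rewrite dR ltcR.
  move=> w wz; have [->|wz0] := eqVneq w z.
    by rewrite !subrr mulr0 subrr normc0 mulr0.
  have h0 : w - z != 0 by rewrite subr_eq0.
  have := hd (w - z); rewrite /ball_ /= sub0r normrN dR ltcR => /(_ wz h0).
  rewrite ltcR => /ltW h.
  have -> : f w - f z - c * (w - z) =
      - ((c - (w - z)^-1 *: ((f ((w - z) *: (1 : R[i]^o) + z) : R[i]^o) - f z)) * (w - z)).
    rewrite (_ : (w - z) *: (1 : R[i]^o) + z = w); last first.
      by rewrite [_ *: _]mulr1 subrK.
    exact: quotient_remainder.
  by rewrite normcN normcM ler_wpM2r ?normc_ge0.
- move=> [c hc]; apply/cvg_ex; exists c; apply/cvgrPdist_lt => e e0.
  have eR : e = (Re e)%:C.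
    by move: e0; rewrite ltcE => /andP[/eqP]; case: (e) => a b /= -> _.
  have e1 : 0 < Re e by move: e0; rewrite eR ltcR.
  have [d d0 hd] := hc (Re e / 2) (divr_gt0 e1 (ltr0n _ 2)).
  apply/nbhs_normP; exists d%:C; first by rewrite /= ltcR.
  move=> h; rewrite /ball_ /= sub0r normrN ltcR => hd' h0.
  rewrite eR ltcR.
  have nh : 0 < normc h by rewrite normc_gt0.
  have := hd (h + z); rewrite addrK => /(_ hd').
  rewrite (_ : h *: (1 : R[i]^o) + z = h + z); last by rewrite [_ *: _]mulr1.
  have -> : c - h^-1 *: ((f (h + z) : R[i]^o) - f z) =
     - ((f (h + z) - f z - c * h) * h^-1).
    have := quotient_remainder c (f (h + z) - f z) h0; rewrite /= => ->.
    by rewrite mulNr mulfK // opprK.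
  rewrite normcN normcM normcV => hh.
  rewrite ltr_pdivrMr //; apply: le_lt_trans hh _.
  by rewrite ltr_pM2r // ltr_pdivrMr // ltr_pMr // ltr1n.
Qed.

Lemma cdiff_mul f g z : cdiff f z -> cdiff g z -> cdiff (fun w => f w * g w) z.
Proof.
move=> /derivable_cdiff df /derivable_cdiff dg; apply/derivable_cdiff.
exact: (derivableM df dg).
Qed.

Lemma cdiff_sub_inv (d z : R[i]) : z != d -> cdiff (fun w => (w - d)^-1) z.
Proof.
move=> zd; apply/derivable_cdiff.
apply: (@derivableV _ _ (fun w : R[i]^o => w - d)); first by rewrite subr_eq0.
apply: derivableB; first exact: derivable_id.
exact: derivable_cst.
Qed.

Lemma cdiff_continuous f z (e : R) : cdiff f z -> 0 < e ->
  exists2 d : R, 0 < d & forall w, normc (w - z) < d -> normc (f w - f z) < e.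
Proof.
move=> [c hc] e0; have [d d0 hd] := hc 1 ltr01.
have c1 : 0 < 1 + normc c by rewrite ltr_wpDr ?normc_ge0.
exists (Num.min d (e / (1 + normc c))); first by rewrite lt_min d0 divr_gt0.
move=> w; rewrite lt_min => /andP[wd we].
rewrite -(subrK (c * (w - z)) (f w - f z)); apply: le_lt_trans (le_normcD _ _) _.
rewrite normcM; apply: le_lt_trans (lerD (hd w wd) (lexx _)) _.
by rewrite -mulrDl mulrC -ltr_pdivlMr.
Qed.

Lemma cdiff_ccont_h f (x y : R) : cdiff f (x +i* y) -> ccont_at (fun t => f (t +i* y)) x.
Proof.
move=> df; apply: ccont_at_eps => e e0; have [d d0 hd] := cdiff_continuous df e0.
near=> t; apply: hd.
rewrite (_ : _ - _ = (t - x)%:C); last by apply: complexP => /=; ring.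
by rewrite normcC; near: t; exact: cvgr_distC_lt.
Unshelve. all: end_near. Qed.

Lemma cdiff_ccont_v f (x y : R) : cdiff f (x +i* y) -> ccont_at (fun t => f (x +i* t)) y.
Proof.
move=> df; apply: ccont_at_eps => e e0; have [d d0 hd] := cdiff_continuous df e0.
near=> t; apply: hd.
rewrite (_ : _ - _ = 'i%C * (t - y)%:C); last by apply: complexP => /=; ring.
rewrite normcM [normc 'i%C](_ : _ = 1); last first.
  by rewrite /normc /= expr0n expr1n add0r sqrtr1.
by rewrite mul1r normcC; near: t; exact: cvgr_distC_lt.
Unshelve. all: end_near. Qed.

End ComplexDifferentiability.

Section Goursat.
Context (R : realType) (f : R[i] -> R[i]).
Implicit Types (a b h k x y : R).

Definition in_rect a b h k (z : R[i]) : Prop :=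
  a <= Re z <= a + h /\ b <= Im z <= b + k.

(** The boundary integral over [a, a + h] x [b, b + k], with opposite sides
    grouped. *)
Definition rect_integral a b h k : R[i] :=
  cintegral `[a, a + h] (fun x => f (x +i* b) - f (x +i* (b + k))) +
  'i%C * cintegral `[b, b + k] (fun y => f ((a + h) +i* y) - f (a +i* y)).

Lemma rect_integrable_h a b h k y : 0 <= h ->
  (forall z, in_rect a b h k z -> cdiff f z) -> b <= y <= b + k ->
  cintegrable `[a, a + h] (fun x => f (x +i* y)).
Proof.
move=> h0 df yb; apply: ccont_cintegrable => x xa.
by apply: cdiff_ccont_h; apply: df.
Qed.

Lemma rect_integrable_v a b h k x : 0 <= k ->
  (forall z, in_rect a b h k z -> cdiff f z) -> a <= x <= a + h ->
  cintegrable `[b, b + k] (fun y => f (x +i* y)).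
Proof.
move=> k0 df xa; apply: ccont_cintegrable => y yb.
by apply: cdiff_ccont_v; apply: df.
Qed.

Lemma rect_integral_split_h a b h h' k : 0 <= h -> 0 <= h' -> 0 <= k ->
  (forall z, in_rect a b (h + h') k z -> cdiff f z) ->
  rect_integral a b (h + h') k = rect_integral a b h k + rect_integral (a + h) b h' k.
Proof.
move=> h0 h0' k0 df; rewrite /rect_integral.
have ih y : b <= y <= b + k -> cintegrable `[a, a + (h + h')] (fun x => f (x +i* y)).
  by move=> yb; apply: rect_integrable_h df _ => //; rewrite addr_ge0.
have iv x : a <= x <= a + (h + h') -> cintegrable `[b, b + k] (fun y => f (x +i* y)).
  by move=> xa; apply: rect_integrable_v df _.
rewrite (@cintegral_itv_split _ _ a (a + h)).
- have i1 := iv (a + (h + h')); have i2 := iv a; have i3 := iv (a + h).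
  have {}i1 : cintegrable `[b, b + k] (fun y => f ((a + (h + h')) +i* y)) by apply: i1; lra.
  have {}i2 : cintegrable `[b, b + k] (fun y => f (a +i* y)) by apply: i2; lra.
  have {}i3 : cintegrable `[b, b + k] (fun y => f ((a + h) +i* y)) by apply: i3; lra.
  rewrite -[a + h + h']addrA.
  have -> : cintegral `[b, b + k] (fun y => f ((a + (h + h')) +i* y) - f (a +i* y)) =
      cintegral `[b, b + k] (fun y => f ((a + h) +i* y) - f (a +i* y)) +
      cintegral `[b, b + k] (fun y => f ((a + (h + h')) +i* y) - f ((a + h) +i* y)).
    rewrite -cintegralD //; [|exact: cintegrable_sub..].
    by apply: eq_cintegral => y _; ring.
  ring.
- lra.
- lra.
- by apply: cintegrable_sub => //; apply: ih; lra.
Qed.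

Lemma rect_integral_split_v a b h k k' : 0 <= h -> 0 <= k -> 0 <= k' ->
  (forall z, in_rect a b h (k + k') z -> cdiff f z) ->
  rect_integral a b h (k + k') = rect_integral a b h k + rect_integral a (b + k) h k'.
Proof.
move=> h0 k0 k0' df; rewrite /rect_integral.
have ih y : b <= y <= b + (k + k') -> cintegrable `[a, a + h] (fun x => f (x +i* y)).
  by move=> yb; apply: rect_integrable_h df _.
have iv x : a <= x <= a + h -> cintegrable `[b, b + (k + k')] (fun y => f (x +i* y)).
  by move=> xa; apply: rect_integrable_v df _ => //; rewrite addr_ge0.
rewrite [X in _ + _ * X](@cintegral_itv_split _ _ b (b + k)).
- have i1 := ih (b + (k + k')); have i2 := ih b; have i3 := ih (b + k).
  have {}i1 : cintegrable `[a, a + h] (fun x => f (x +i* (b + (k + k')))) by apply: i1; lra.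
  have {}i2 : cintegrable `[a, a + h] (fun x => f (x +i* b)) by apply: i2; lra.
  have {}i3 : cintegrable `[a, a + h] (fun x => f (x +i* (b + k))) by apply: i3; lra.
  rewrite -[b + k + k']addrA.
  have -> : cintegral `[a, a + h] (fun x => f (x +i* b) - f (x +i* (b + (k + k')))) =
      cintegral `[a, a + h] (fun x => f (x +i* b) - f (x +i* (b + k))) +
      cintegral `[a, a + h] (fun x => f (x +i* (b + k)) - f (x +i* (b + (k + k')))).
    rewrite -cintegralD //; [|exact: cintegrable_sub..].
    by apply: eq_cintegral => x _; ring.
  ring.
- lra.
- lra.
- by apply: cintegrable_sub => //; apply: iv; lra.
Qed.

(** Affine functions have zero boundary integral, so only the remainder counts. *)
Lemma rect_integral_bound a b h k (z0 c : R[i]) (M : R) : 0 <= h -> 0 <= k ->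
  (forall z, in_rect a b h k z -> cdiff f z) ->
  (forall z, in_rect a b h k z -> normc (f z - f z0 - c * (z - z0)) <= M) ->
  normc (rect_integral a b h k) <= 2 * M * (h + k).
Proof.
move=> h0 k0 df fM; rewrite /rect_integral.
pose r z := f z - f z0 - c * (z - z0).
have iH : cintegrable `[a, a + h] (fun x => f (x +i* b) - f (x +i* (b + k))).
  by apply: cintegrable_sub => //; apply: rect_integrable_h df _ => //; lra.
have iV : cintegrable `[b, b + k] (fun y => f ((a + h) +i* y) - f (a +i* y)).
  by apply: cintegrable_sub => //; apply: rect_integrable_v df _ => //; lra.
have c1 := cintegrable_cst_itv (c * ('i%C * k%:C)) a (a + h).
have c2 := cintegrable_cst_itv (c * h%:C) b (b + k).
have e1 : cintegral `[a, a + h] (fun x => f (x +i* b) - f (x +i* (b + k))) =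
    cintegral `[a, a + h] (fun x => r (x +i* b) - r (x +i* (b + k))) -
    c * ('i%C * k%:C) * h%:C.
  have -> : h%:C = (a + h - a)%:C :> R[i] by congr _%:C; ring.
  rewrite -cintegral_cst_itv ?lerDl // -cintegralB //.
    apply: eq_cintegral => x _; rewrite /r.
    have -> : x +i* (b + k) = x +i* b + 'i%C * k%:C by apply: complexP => /=; ring.
    ring.
  apply: eq_cintegrable (cintegrable_add _ iH c1) => // x _; rewrite /r.
  have -> : x +i* (b + k) = x +i* b + 'i%C * k%:C by apply: complexP => /=; ring.
  ring.
have e2 : cintegral `[b, b + k] (fun y => f ((a + h) +i* y) - f (a +i* y)) =
    cintegral `[b, b + k] (fun y => r ((a + h) +i* y) - r (a +i* y)) +
    c * h%:C * k%:C.
  have -> : k%:C = (b + k - b)%:C :> R[i] by congr _%:C; ring.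
  rewrite -cintegral_cst_itv ?lerDl // -cintegralD //.
    apply: eq_cintegral => y _; rewrite /r.
    have -> : (a + h) +i* y = a +i* y + h%:C by apply: complexP => /=; ring.
    ring.
  apply: eq_cintegrable (cintegrable_sub _ iV c2) => // y _; rewrite /r.
  have -> : (a + h) +i* y = a +i* y + h%:C by apply: complexP => /=; ring.
  ring.
have iH' : cintegrable `[a, a + h] (fun x => r (x +i* b) - r (x +i* (b + k))).
  apply: eq_cintegrable (cintegrable_add _ iH c1) => // x _; rewrite /r.
  have -> : x +i* (b + k) = x +i* b + 'i%C * k%:C by apply: complexP => /=; ring.
  ring.
have iV' : cintegrable `[b, b + k] (fun y => r ((a + h) +i* y) - r (a +i* y)).
  apply: eq_cintegrable (cintegrable_sub _ iV c2) => // y _; rewrite /r.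
  have -> : (a + h) +i* y = a +i* y + h%:C by apply: complexP => /=; ring.
  ring.
rewrite e1 e2.
set A := cintegral _ _; set B := cintegral _ _.
have -> : A - c * ('i%C * k%:C) * h%:C + 'i%C * (B + c * h%:C * k%:C) = A + 'i%C * B.
  ring.
apply: le_trans (le_normcD _ _) _; rewrite normcM.
have -> : normc 'i%C = 1 :> R by rewrite /normc /= expr0n expr1n add0r sqrtr1.
rewrite mul1r mulrDr; apply: lerD.
- have -> : 2 * M * h = 2 * M * (a + h - a) by ring.
  apply: normc_cintegral_itv => //; first by rewrite lerDl.
  move=> x xa; apply: le_trans (le_normcB _ _) _; rewrite mulr_natl mulr2n.
  by apply: lerD; apply: fM; split => /=; lra.
- have -> : 2 * M * k = 2 * M * (b + k - b) by ring.
  apply: normc_cintegral_itv => //; first by rewrite lerDl.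
  move=> y yb; apply: le_trans (le_normcB _ _) _; rewrite mulr_natl mulr2n.
  by apply: lerD; apply: fM; split => /=; lra.
Qed.

(** One of the four quarters carries at least a quarter of the integral. *)
Lemma rect_quarter a b h k : 0 <= h -> 0 <= k ->
  (forall z, in_rect a b (h + h) (k + k) z -> cdiff f z) ->
  exists p : R * R, [/\ p.1 = a \/ p.1 = a + h, p.2 = b \/ p.2 = b + k &
    normc (rect_integral a b (h + h) (k + k)) <= 4 * normc (rect_integral p.1 p.2 h k)].
Proof.
move=> h0 k0 df.
have e : rect_integral a b (h + h) (k + k) =
    rect_integral a b h k + rect_integral a (b + k) h k +
    (rect_integral (a + h) b h k + rect_integral (a + h) (b + k) h k).
  rewrite rect_integral_split_h ?addr_ge0 //.
  rewrite !rect_integral_split_v // => z [/andP[? ?] /andP[? ?]]; apply: df;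
    by split; apply/andP; split; lra.
apply: contrapT => nex.
have lt p1 p2 : p1 = a \/ p1 = a + h -> p2 = b \/ p2 = b + k ->
    4 * normc (rect_integral p1 p2 h k) < normc (rect_integral a b (h + h) (k + k)).
  move=> e1 e2; rewrite ltNge; apply/negP => le; apply: nex.
  by exists (p1, p2).
have l1 := lt _ _ (or_introl erefl) (or_introl erefl).
have l2 := lt _ _ (or_introl erefl) (or_intror erefl).
have l3 := lt _ _ (or_intror erefl) (or_introl erefl).
have l4 := lt _ _ (or_intror erefl) (or_intror erefl).
have := le_normcD (rect_integral a b h k + rect_integral a (b + k) h k)
  (rect_integral (a + h) b h k + rect_integral (a + h) (b + k) h k).
rewrite -e.
have := le_normcD (rect_integral a b h k) (rect_integral a (b + k) h k).
have := le_normcD (rect_integral (a + h) b h k) (rect_integral (a + h) (b + k) h k).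
lra.
Qed.

(** Repeated quartering gives rectangles shrinking to a point z0 whose integrals
    decrease at most like 4^-n; differentiability at z0 bounds them by
    e times 4^-n for every e. *)
Theorem goursat a b h k : 0 <= h -> 0 <= k ->
  (forall z, in_rect a b h k z -> cdiff f z) -> rect_integral a b h k = 0.
Proof.
move=> h0 k0 df.
pose hn n : R := h / 2 ^+ n; pose kn n : R := k / 2 ^+ n.
have p2 n : 0 < (2 : R) ^+ n by rewrite exprn_gt0.
have hn0 n : 0 <= hn n by rewrite divr_ge0 // ltW.
have kn0 n : 0 <= kn n by rewrite divr_ge0 // ltW.
have hS n : hn n = hn n.+1 + hn n.+1 by rewrite /hn exprS; field; rewrite gt_eqF.
have kS n : kn n = kn n.+1 + kn n.+1 by rewrite /kn exprS; field; rewrite gt_eqF.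
pose inside n (p : R * R) := a <= p.1 /\ p.1 + hn n <= a + h /\
   b <= p.2 /\ p.2 + kn n <= b + k.
have dfi n p z : inside n p -> in_rect p.1 p.2 (hn n) (kn n) z -> cdiff f z.
  move=> [i1 [i2 [i3 i4]]] [/andP[? ?] /andP[? ?]]; apply: df.
  by split; apply/andP; split; lra.
have /choice[step hstep] (q : nat * (R * R)) : exists p : R * R, inside q.1 q.2 ->
    inside q.1.+1 p /\ (q.2.1 <= p.1 /\ p.1 + hn q.1.+1 <= q.2.1 + hn q.1) /\
    (q.2.2 <= p.2 /\ p.2 + kn q.1.+1 <= q.2.2 + kn q.1) /\
    normc (rect_integral q.2.1 q.2.2 (hn q.1) (kn q.1)) <=
      4 * normc (rect_integral p.1 p.2 (hn q.1.+1) (kn q.1.+1)).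
  case: q => n p /=; have [ins|] := pselect (inside n p); last by exists p.
  have [|p' [p1 p2' hp]] := rect_quarter (hn0 n.+1) (kn0 n.+1) (a := p.1) (b := p.2).
    by move=> z; rewrite -hS -kS; exact: dfi.
  exists p' => _; rewrite -hS -kS in hp.
  have [i1 [i2 [i3 i4]]] := ins.
  have := hS n; have := kS n; have := hn0 n.+1; have := kn0 n.+1.
  move=> g1 g2 g3 g4.
  split; [|split; [|split]] => //; rewrite /inside; case: p1 => e1; case: p2' => e2;
    by rewrite ?e1 ?e2; repeat split; clear -i1 i2 i3 i4 g1 g2 g3 g4; lra.
pose fix u n := if n is m.+1 then step (m, u m) else (a, b).
have ins n : inside n (u n).
  elim: n => [|n ih] /=; first by rewrite /inside /= /hn /kn expr0 !divr1; repeat split.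
  by have [] := hstep (n, u n) ih.
have uP n := (hstep (n, u n) (ins n)).2.
have h00 : hn 0%N = h by rewrite /hn expr0 divr1.
have k00 : kn 0%N = k by rewrite /kn expr0 divr1.
have big n : normc (rect_integral a b h k) <=
    4 ^+ n * normc (rect_integral (u n).1 (u n).2 (hn n) (kn n)).
  elim: n => [|n ih]; first by rewrite expr0 mul1r h00 k00.
  apply: le_trans ih _; rewrite exprSr -mulrA ler_wpM2l ?exprn_ge0 //.
  by have [_ [_]] := uP n.
have nd1 : nondecreasing_seq (fun n => (u n).1).
  by apply/nondecreasing_seqP => n; have [[]] := uP n.
have nd2 : nondecreasing_seq (fun n => (u n).2).
  by apply/nondecreasing_seqP => n; have [_ [[]]] := uP n.
have ni1 : nonincreasing_seq (fun n => (u n).1 + hn n).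
  by apply/nonincreasing_seqP => n; have [[]] := uP n.
have ni2 : nonincreasing_seq (fun n => (u n).2 + kn n).
  by apply/nonincreasing_seqP => n; have [_ [[]]] := uP n.
have nest (w c : nat -> R) n m : nondecreasing_seq w -> (forall n, 0 <= c n) ->
    nonincreasing_seq (fun n => w n + c n) -> w m <= w n + c n.
  move=> ndw c0 niw; apply: le_trans (ndw _ _ (leq_maxl m n)) _.
  by apply: le_trans (niw _ _ (leq_maxr m n)); rewrite lerDl.
have limP (w c : nat -> R) : nondecreasing_seq w -> (forall n, 0 <= c n) ->
    nonincreasing_seq (fun n => w n + c n) ->
    exists l, forall n, w n <= l <= w n + c n.
  move=> ndw c0 niw; exists (limn w) => n.
  have cw : cvgn w.
    apply: nondecreasing_is_cvgn => //; exists (w 0%N + c 0%N) => _ [m _ <-].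
    exact: nest.
  apply/andP; split; first exact: nondecreasing_cvgn_le.
  by apply: limr_le => //; apply: nearW => m; exact: nest.
have [x0 hx0] := limP _ _ nd1 hn0 ni1.
have [y0 hy0] := limP _ _ nd2 kn0 ni2.
have dz : cdiff f (x0 +i* y0).
  apply: df; have := hx0 0%N; have := hy0 0%N; rewrite h00 k00 /= => ? ?.
  by split.
have [c hc] := dz.
apply/eqP; rewrite -normc_eq0 eq_le normc_ge0 andbT.
apply/ler_addgt0Pr => e e0; rewrite add0r.
pose s := h + k.
have s0 : 0 <= s by rewrite addr_ge0.
have d0 : 0 < e / (2 * s ^+ 2 + 1).
  by rewrite divr_gt0 // ltr_wpDl // mulr_ge0 // sqr_ge0.
have [d dd hd] := hc _ d0.
have [n hn'] : exists n, hn n + kn n < d.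
  have /cvgrPdist_lt /(_ (d / (s + 1))) := @half_pow_cvg0 R.
  case; first by rewrite divr_gt0 // ltr_wpDl.
  move=> N _ /(_ N (leqnn N)) /=; rewrite sub0r normrN ger0_norm; last first.
    by rewrite exprn_ge0 // invr_ge0.
  rewrite ltr_pdivlMr ?ltr_wpDl // => hN; exists N; rewrite /hn /kn -mulrDl -/s -exprVn.
  apply: le_lt_trans hN; rewrite mulrC ler_wpM2l ?exprn_ge0 ?invr_ge0 //.
  by rewrite lerDl.
have bd := @rect_integral_bound (u n).1 (u n).2 (hn n) (kn n) (x0 +i* y0) c
   (e / (2 * s ^+ 2 + 1) * (hn n + kn n)) (hn0 n) (kn0 n) (fun z => dfi n (u n) z (ins n)).
apply: le_trans (big n) _.
have {}bd := bd _.
have le1 : normc (rect_integral (u n).1 (u n).2 (hn n) (kn n)) <=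
   2 * (e / (2 * s ^+ 2 + 1) * (hn n + kn n)) * (hn n + kn n).
  apply: bd => z [/andP[z1 z2] /andP[z3 z4]].
  have zz : normc (z - x0 +i* y0) <= hn n + kn n.
    apply: le_trans (normc_le_ReIm _) _; rewrite Re_add Im_add Re_opp Im_opp /=.
    have := hx0 n; have := hy0 n => /andP[? ?] /andP[? ?].
    by apply: lerD; rewrite ler_norml; apply/andP; split; lra.
  apply: le_trans (hd _ (le_lt_trans zz hn')) _.
  by rewrite ler_wpM2l // ltW.
apply: le_trans (ler_wpM2l _ le1) _; first by rewrite exprn_ge0.
have e4 : (4 : R) ^+ n = 2 ^+ n * 2 ^+ n by rewrite -exprMn -natrM.
have -> : 4 ^+ n * (2 * (e / (2 * s ^+ 2 + 1) * (hn n + kn n)) * (hn n + kn n)) =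
    e / (2 * s ^+ 2 + 1) * (2 * s ^+ 2).
  rewrite e4 /hn /kn /s; field.
  rewrite (gt_eqF (p2 n)) /= gt_eqF // ltr_wpDl // mulr_ge0 //; exact: sqr_ge0.
rewrite mulrAC ler_pdivrMr ?ltr_wpDl // ?mulr_ge0 ?sqr_ge0 //.
by rewrite ler_pM2l // lerDl.
Qed.

End Goursat.

Section JointMeasurability.
Context (R : realType).

(** The preimage of an open half-line is the union of the rational squares that it
    contains. *)
Lemma cont2_measurable (f : R -> R -> R) :
  (forall x y e, 0 < e -> exists2 d : R, 0 < d &
     forall x' y', `|x' - x| < d -> `|y' - y| < d -> `|f x' y' - f x y| < e) ->
  measurable_fun setT (fun z : measurableTypeR R * measurableTypeR R => f z.1 z.2).
Proof.
move=> cf.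
apply: (measurability _ (RGenOInfty.measurableE R)) => _ [_ [a ->] <-]; rewrite setTI.
pose rect (i : rat * rat * nat) : set (measurableTypeR R * measurableTypeR R) :=
  ball (ratr i.1.1 : R) (i.2.+1%:R^-1) `*` ball (ratr i.1.2 : R) (i.2.+1%:R^-1).
set U := _ @^-1` _.
have -> : U = \bigcup_(i in setT) (if `[< rect i `<=` U >] then rect i else set0).
  rewrite eqEsubset; split=> [[x y]|z [i _]]; last by case: asboolP => // h; exact: h.
  rewrite /U /= in_itv /= andbT => axy.
  have e0 : 0 < f x y - a by rewrite subr_gt0.
  have [d d0 hd] := cf x y _ e0.
  pose n := Num.truncn (2 / d).
  have n0 : 0 < n.+1%:R^-1 :> R by rewrite invr_gt0.
  have nd : 2 * n.+1%:R^-1 < d.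
    rewrite ltr_pdivrMr // mulrC -ltr_pdivrMr //.
    by have /andP[_] := truncn_itv (ltW (divr_gt0 (ltr0n _ 2) d0)).
  have rat_near (r : R) : exists q : rat, `|r - ratr q| < n.+1%:R^-1.
    have [|q] := @rat_in_itvoo R (r - n.+1%:R^-1) (r + n.+1%:R^-1).
      by rewrite ltrBlDr -addrA ltrDl addr_gt0.
    rewrite in_itv /= => /andP[h1 h2]; exists q.
    by rewrite ltr_distlC h1 h2.
  have [p hp] := rat_near x; have [q hq] := rat_near y.
  have rin : rect (p, q, n) (x, y).
    by split; rewrite /ball /= distrC.
  exists (p, q, n) => //; case: asboolP => // h; exfalso; apply: h => -[x' y'] [/= hx hy].
  rewrite /U /= in_itv /= andbT.
  have := hd x' y'; rewrite /ball /= in hx hy.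
  have tri (r r' c : R) : `|r - c| < n.+1%:R^-1 -> `|c - r'| < n.+1%:R^-1 -> `|r' - r| < d.
    move=> h1 h2; apply: le_lt_trans nd; rewrite -(subrKA c) mulr_natl mulr2n.
    by apply: le_trans (ler_normD _ _) _; apply: lerD; apply: ltW; rewrite distrC.
  have bx := tri _ _ _ hp hx; have by' := tri _ _ _ hq hy.
  by move=> /(_ bx by'); rewrite ltr_distl => /andP[]; lra.
apply: countable_bigcupT_measurable => // i; case: asboolP => // _.
by apply: measurableX; exact: measurable_ball.
Qed.

End JointMeasurability.

Section Exhaustion.
Context (R : realType).
Local Notation mu := (@lebesgue_measure R).

Lemma cintegral_mkcond (D : set R) (f : R -> R[i]) :
  cintegral D f = cintegral setT (fun t => (\1_D t)%:C * f t).
Proof.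
have e (p : R[i] -> R) : p 0 = 0 -> (forall z, p (1 * z) = p z) ->
    \int[mu]_(t in D) p (f t) = \int[mu]_t p ((\1_D t)%:C * f t).
  move=> p0 p1; rewrite Rintegral_mkcond; apply: eq_Rintegral => t _.
  rewrite /patch indicE; case: ifP => h; first by rewrite p1.
  by rewrite mul0r p0.
by congr (_ +i* _); apply: e => // z; rewrite mul1r.
Qed.

Lemma cintegral_exhaust (D : set R) (D_ : nat -> set R) (f : R -> R[i]) :
  measurable D -> (forall n, measurable (D_ n)) -> (forall n, D_ n `<=` D) ->
  (forall t, D t -> \forall n \near \oo, D_ n t) -> cintegrable D f ->
  normc (cintegral (D_ n) f - cintegral D f) @[n --> \oo] --> 0.
Proof.
move=> mD mD_ sD nD fi.
have e n : cintegral (D_ n) f = cintegral D (fun t => (\1_(D_ n) t)%:C * f t).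
  rewrite cintegral_mkcond [RHS]cintegral_mkcond; apply: eq_cintegral => t _.
  rewrite mulrA; congr (_ * _); rewrite -rmorphM; congr _%:C.
  rewrite !indicE; have [/set_mem h|h] := boolP (t \in D_ n); last by rewrite mulr0.
  by rewrite mulr1 mem_set //; exact: sD h.
under eq_fun do rewrite e.
have ind1 n t : normc (\1_(D_ n) t)%:C <= 1 :> R.
  by rewrite normcC indicE; case: (_ \in _); rewrite ?normr1 ?normr0.
apply: (proj2 (@cdominated R D (fun n t => (\1_(D_ n) t)%:C * f t) f
   (fun t => normc (f t)) mD _ _ _ _)).
- move=> n; apply: cmeasurable_mul fi.1; apply: cmeasurable_real.
  exact: measurable_indic.
- move=> t Dt; apply: cvg_near_cst; apply: filterS (nD t Dt) => n h.
  by rewrite indicE mem_set // mul1r subrr normc0.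
- exact: cintegrable_normc.
- by move=> n t _; rewrite normcM ler_piMl ?normc_ge0.
Qed.

End Exhaustion.

Section Strip.
Context (R : realType) (G : R[i] -> R[i]) (x1 x2 : R) (x12 : x1 <= x2).
Local Notation mu := (@lebesgue_measure R).
Hypothesis dG : forall z, x1 <= Re z <= x2 -> cdiff G z.
Hypothesis i1 : cintegrable setT (fun y => G (x1 +i* y)).
Hypothesis i2 : cintegrable setT (fun y => G (x2 +i* y)).
Variable C : R.
Hypothesis GC : forall x, x1 <= x <= x2 ->
  (\int[mu]_y (normc (G (x +i* y)))%:E <= C%:E)%E.

Let clamp (x : R) := Num.max x1 (Num.min x x2).

Let clampP x : x1 <= clamp x <= x2.
Proof. by rewrite /clamp le_max lexx ge_max x12 ge_min lexx orbT. Qed.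

Let clampK x : x1 <= x <= x2 -> clamp x = x.
Proof. by move=> /andP[h1 h2]; rewrite /clamp; move/min_idPl : h2 => ->; apply/max_idPr. Qed.

Let clamp_lip x x' : `|clamp x' - clamp x| <= `|x' - x|.
Proof.
rewrite /clamp /Num.max /Num.min.
by repeat case: ifPn; rewrite -?leNgt => *; rewrite ler_norml;
  have := ler_norm (x' - x); have := ler_norm (x - x'); rewrite (distrC x) => *;
  apply/andP; split; lra.
Qed.

Let modG : measurable_fun setT
  (fun z : measurableTypeR R * measurableTypeR R => normc (G (clamp z.1 +i* z.2))).
Proof.
apply: (cont2_measurable (f := fun x y => normc (G (clamp x +i* y)))) => x y e e0.
have dz : cdiff G (clamp x +i* y) by apply: dG; rewrite /= clampP.
have [d d0 hd] := cdiff_continuous dz e0.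
exists (d / 2); first by rewrite divr_gt0.
move=> x' y' hx hy.
have /hd h : normc (clamp x' +i* y' - clamp x +i* y) < d.
  apply: le_lt_trans (normc_le_ReIm _) _; rewrite Re_add Im_add Re_opp Im_opp /=.
  rewrite [d]splitr; apply: ltrD => //; exact: le_lt_trans (clamp_lip x x') hx.
rewrite ltr_norml.
have h1 := lerB_normc (G (clamp x' +i* y')) (G (clamp x +i* y)).
have h2 := lerB_normc (G (clamp x +i* y)) (G (clamp x' +i* y')).
by rewrite (normcBC (G (clamp x +i* y))) in h2; apply/andP; split; lra.
Qed.

Let phi (z : measurableTypeR R * measurableTypeR R) : \bar R :=
  ((\1_(`[x1, x2]%classic : set R) z.1 : R) * normc (G (clamp z.1 +i* z.2)))%:E.

Let mphi : measurable_fun setT phi.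
Proof.
apply/measurable_EFinP/measurable_funM; last exact: modG.
apply: (@measurableT_comp _ _ _ _ _ _ (\1_(`[x1, x2]%classic : set R) : R -> R)).
  by apply: measurable_indic.
exact: measurable_fst.
Qed.

Let phi0 z : (0 <= phi z)%E.
Proof. by rewrite lee_fin mulr_ge0 ?normc_ge0 // indicE ler0n. Qed.

(* the contribution of the horizontal side at height y *)
Let side (y : R) : \bar R := (\int[mu]_x phi (x, y))%E.

Let side_ge0 y : (0 <= side y)%E.
Proof. by apply: integral_ge0 => x _; exact: phi0. Qed.

Let mside : measurable_fun setT side.
Proof. exact: (measurable_fun_fubini_tonelli_G (m1 := mu)). Qed.

Let int_side : (\int[mu]_y side y < +oo)%E.
Proof.
rewrite -(fubini_tonelli (m1 := mu) (m2 := mu) phi) //.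
apply: (@le_lt_trans _ _ (\int[mu]_(x in `[x1, x2]) C%:E)%E).
  rewrite [leRHS]integral_mkcond; apply: ge0_le_integral => //.
  - by move=> x _; apply: integral_ge0 => y _; exact: phi0.
  - exact: (measurable_fun_fubini_tonelli_F (m2 := mu) phi).
  - apply/(measurable_restrictT _ _).1 => //.
  - move=> x _; rewrite /phi /patch /=; case: ifPn => [/set_mem|] xI.
      have xx : x1 <= x <= x2 by move: xI; rewrite /= in_itv.
      apply: le_trans (GC xx); rewrite le_eqVlt; apply/orP; left; apply/eqP.
      by apply: eq_integral => y _; rewrite indicE mem_set // mul1r clampK.
    by rewrite integral0_eq // => y _; rewrite indicE (negbTE xI) mul0r.
have := @lebesgue_measure_itv R `[x1, x2]; rewrite /= => mI.
rewrite integral_cst //= mI; case: ifP => _; last by rewrite mule0 ltry.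
by rewrite -EFinB -EFinM ltry.
Qed.

Let sideE y : exists2 h : R, side y = h%:E &
  normc (cintegral `[x1, x2] (fun x => G (x +i* y))) <= h.
Proof.
have gi : cintegrable `[x1, x2] (fun x => G (x +i* y)).
  apply: ccont_cintegrable => x xx; apply: cdiff_ccont_h; exact: dG.
exists (\int[mu]_(x in `[x1, x2]) normc (G (x +i* y))); last exact: normc_cintegral.
rewrite /Rintegral fineK; last first.
  have mI : measurable `[x1, x2]%classic by [].
  by apply: integrable_fin_num (cintegrable_normc mI gi).
rewrite [RHS]integral_mkcond; apply: eq_integral => x _.
rewrite /phi /patch indicE /=; case: ifPn => [/set_mem|] xI; last by rewrite mul0r.
by rewrite mul1r clampK //; move: xI; rewrite /= in_itv.
Qed.

Let small_side (D : set R) (e : R) : measurable D -> mu D = +oo%E -> 0 < e ->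
  exists2 y, D y & normc (cintegral `[x1, x2] (fun x => G (x +i* y))) < e.
Proof.
move=> mD D8 e0; apply: contrapT => nex.
have big y : D y -> (e%:E <= side y)%E.
  move=> Dy; have [h -> hh] := sideE y; rewrite lee_fin leNgt; apply/negP => he.
  by apply: nex; exists y => //; exact: le_lt_trans hh he.
have : (\int[mu]_(y in D) e%:E <= \int[mu]_y side y)%E.
  apply: (@le_trans _ _ (\int[mu]_(y in D) side y)%E).
    apply: ge0_le_integral => //; first by move=> y _; rewrite lee_fin ltW.
    exact: measurable_funTS.
  by apply: ge0_subset_integral.
have -> : (\int[mu]_(y in D) e%:E = +oo)%E.
  rewrite integral_cst //; apply: etrans (congr1 (mule e%:E) D8) _.
  by rewrite gt0_muley ?lte_fin.
by rewrite leye_eq => /eqP h; move: int_side; rewrite h.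
Qed.

(** The horizontal sides of large rectangles have integrals that are integrable
    functions of the height, so they are small at suitable heights tending to
    infinity, and [goursat] applies to these rectangles. *)
Theorem strip_integral :
  cintegral setT (fun y => G (x1 +i* y)) = cintegral setT (fun y => G (x2 +i* y)).
Proof.
have e0 (n : nat) : 0 < n.+1%:R^-1 :> R by rewrite invr_gt0.
have top n : exists2 y, n%:R < y &
    normc (cintegral `[x1, x2] (fun x => G (x +i* y))) < n.+1%:R^-1.
  have [||y] := @small_side `]n%:R, +oo[%classic _ _ _ (e0 n) => //.
    by have := @lebesgue_measure_itv R `]n%:R, +oo[; rewrite /= => ->; rewrite ltry.
  by rewrite /= in_itv /= andbT; exists y.
have bot n : exists2 y, y < - n%:R &
    normc (cintegral `[x1, x2] (fun x => G (x +i* y))) < n.+1%:R^-1.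
  have [||y] := @small_side `]-oo, (- n%:R)[%classic _ _ _ (e0 n) => //.
    by have := @lebesgue_measure_itv R `]-oo, (- n%:R)[; rewrite /= => ->; rewrite ltNyr.
  by rewrite /= in_itv /=; exists y.
have /choice[yp hp] n : exists y, n%:R < y /\
    normc (cintegral `[x1, x2] (fun x => G (x +i* y))) < n.+1%:R^-1.
  by have [y] := top n; exists y.
have /choice[ym hm] n : exists y, y < - n%:R /\
    normc (cintegral `[x1, x2] (fun x => G (x +i* y))) < n.+1%:R^-1.
  by have [y] := bot n; exists y.
pose g y := G (x2 +i* y) - G (x1 +i* y).
have gi : cintegrable setT g by exact: cintegrable_sub.
suff g0 : cintegral setT g = 0.
  by apply/esym/eqP; rewrite -subr_eq0 -cintegralB //; apply/eqP.
have lim1 := @cintegral_exhaust R setT (fun n => `[ym n, yp n]%classic) g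
  measurableT (fun n => measurable_itv _) (fun n => @subsetT _ _) _ gi.
have {}lim1 := lim1 _.
have lim2 : normc (cintegral `[ym n, yp n] g) @[n --> \oo] --> 0.
  have h : 2 * (n.+1%:R^-1 : R) @[n --> \oo] --> 0.
    by rewrite -(mulr0 2); apply: cvgMr; exact: cvg_harmonic.
  apply: (@squeeze_cvgr _ _ _ _ (cst 0) _ _ _ _ _ h); last exact: cvg_cst.
  near=> n; rewrite normc_ge0 /=.
  have [p1 p2] := hp n; have [m1 m2] := hm n.
  have n0 : 0 <= n%:R :> R by [].
  have := @goursat R G x1 (ym n) (x2 - x1) (yp n - ym n).
  rewrite /rect_integral !(addrC x1) !(addrC (ym n)) !subrK => /(_ _ _ _) h'.
  have {h'} : cintegral `[x1, x2] (fun x => G (x +i* ym n) - G (x +i* yp n)) +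
      'i%C * cintegral `[ym n, yp n] g = 0.
    apply: h'; [by rewrite subr_ge0|by lra|].
    move=> z [/andP[z1 z2] _]; apply: dG; apply/andP; split => //; lra.
  move=> /eqP; rewrite addr_eq0 => /eqP h'.
  have -> : normc (cintegral `[ym n, yp n] g) =
      normc (cintegral `[x1, x2] (fun x => G (x +i* ym n) - G (x +i* yp n))).
    rewrite h' normcN normcM (_ : normc 'i%C = 1) ?mul1r //.
    by rewrite /normc /= expr0n expr1n add0r sqrtr1.
  rewrite cintegralB //; last 2 first.
  - by apply: ccont_cintegrable => x xx; apply: cdiff_ccont_h; exact: dG.
  - by apply: ccont_cintegrable => x xx; apply: cdiff_ccont_h; exact: dG.
  apply: le_trans (le_normcB _ _) _; rewrite mulr_natl mulr2n.
  by apply: lerD; apply: ltW.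
apply/eqP; rewrite -normc_eq0 eq_le normc_ge0 andbT.
have h : normc (cintegral `[ym n, yp n] g - cintegral setT g) +
   normc (cintegral `[ym n, yp n] g) @[n --> \oo] --> 0.
  rewrite -[X in _ --> X]addr0; apply: cvgD lim2; apply: lim1 => t _.
  have t1 := truncn_itv (normr_ge0 t).
  exists (Num.truncn `|t|).+1 => // n /= nt; rewrite in_itv /=.
  have [p1 _] := hp n; have [m1 _] := hm n.
  have : `|t| < n%:R by move: t1 => /andP[_ /lt_le_trans]; apply; rewrite ler_nat.
  by rewrite ltr_norml => /andP[? ?]; apply/andP; split; lra.
rewrite -(cvg_lim _ h) //; apply: limr_ge; first exact: cvgP h.
near=> n; set a := cintegral _ _; set b := cintegral _ _.
by have := le_normcB b (b - a); rewrite subKr [leRHS]addrC.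
Unshelve. all: end_near. Qed.

End Strip.

(** * Cauchy kernels and the Hardy space *)

Section CauchyKernel.
Context (R : realType).
Local Notation mu := (@lebesgue_measure R).
Implicit Types (s q t : R).

Lemma integralT_oneDsqrV : (\int[mu]_t ((oneDsqr t)^-1)%:E = (pi : R)%:E)%E.
Proof.
rewrite ge0_symfun_integralT; first last.
- by move=> t; rewrite /= /oneDsqr sqrrN.
- exact: continuous_oneDsqrV.
- by move=> t; rewrite invr_ge0 (le_trans _ (oneDsqr_ge1 t)).
- by rewrite -set_itvcy integral0y_oneDsqr -EFinM mulrC divfK.
Qed.

(** Total mass pi, by translation and scaling from the arctangent density. *)
Lemma cauchy_mass s q : 0 < s ->
  (\int[mu]_t (s / (s ^+ 2 + (t - q) ^+ 2))%:E = (pi : R)%:E)%E.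
Proof.
move=> s0; rewrite -integralT_oneDsqrV.
pose F t := (t - q) / s.
have dF t : is_derive t 1 F s^-1.
  rewrite -[F]/((id - cst q) * cst s^-1); apply: is_derive_eq.
  by rewrite scaler0 add0r subr0 [_ *: _]mulr1.
have F1E : derive1 F = cst s^-1.
  by apply/funext => t; rewrite derive1E; exact: derive_val.
rewrite (@increasing_ge0_integration_by_substitutionT R F (fun x => (oneDsqr x)^-1)).
- apply: eq_integral => t _; congr _%:E.
  rewrite F1E /F; transitivity ((1 + ((t - q) / s) ^+ 2)^-1 * s^-1); last by [].
  have h : s ^+ 2 + (t - q) ^+ 2 != 0.
    by rewrite gt_eqF // ltr_pwDl ?sqr_ge0 // exprn_gt0.
  have -> : 1 + ((t - q) / s) ^+ 2 = (s ^+ 2 + (t - q) ^+ 2) / s ^+ 2.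
    by field; rewrite gt_eqF.
  rewrite invf_div; set D := _ + _. field.
  by rewrite h gt_eqF.
- by move=> x y xy; rewrite /F ltr_pM2r ?invr_gt0 // ltrD2r.
- by rewrite F1E => x; exact: cvg_cst.
- by rewrite F1E; exact: is_cvg_cst.
- by rewrite F1E; exact: is_cvg_cst.
- by move=> t; have [] := dF t.
- apply/cvgrNyPle => A; near=> t; rewrite /F ler_pdivrMr // lerBlDr.
  by near: t; apply: nbhs_ninfty_le; exact: num_real.
- apply/cvgryPge => A; near=> t; rewrite /F ler_pdivlMr // lerBrDr.
  by near: t; apply: nbhs_pinfty_ge; exact: num_real.
- exact: continuous_oneDsqrV.
- by move=> t; rewrite invr_ge0 (le_trans _ (oneDsqr_ge1 t)).
Unshelve. all: end_near. Qed.

(** The Cauchy kernel 1 / (z - d) restricted to z = 1/2 + it, where d = 1/2 - s + iq.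
    A positive s puts the pole d in the left half-plane. *)
Definition ck s q t : R[i] := (s +i* (t - q))^-1.

Lemma ck_neq0 s q t : s != 0 -> s +i* (t - q) != 0 :> R[i].
Proof. by move=> s0; rewrite eq_complex /= negb_and s0. Qed.

Lemma normc_ck s q t : normc (ck s q t) ^+ 2 = (s ^+ 2 + (t - q) ^+ 2)^-1.
Proof. by rewrite /ck normcV exprVn normc_sqr. Qed.

Lemma ccont_affine s q t : ccont_at (fun t => s +i* (t - q)) t.
Proof.
split => /=; first exact: cvg_cst.
by apply: cvgB; [exact: cvg_id|exact: cvg_cst].
Qed.

Lemma ck_measurable s q : cmeasurable setT (ck s q).
Proof.
apply: cmeasurable_inv => //; apply: ccont_cmeasurable => t.
exact: ccont_affine.
Qed.

Lemma sqint_ck s q : s != 0 -> inL2 (ck s q) /\ sqint (ck s q) = pi / `|s|.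
Proof.
move=> s0; have as0 : 0 < `|s| by rewrite normr_gt0.
have e : (\int[mu]_t (normc (ck s q t) ^+ 2)%:E = (pi / `|s|)%:E)%E.
  have mf : measurable_fun setT (fun t => `|s| / (`|s| ^+ 2 + (t - q) ^+ 2)).
    have := measurable_funM (measurable_cst `|s|)
      (measurable_funX 2 (measurable_normc' measurableT (ck_measurable s q))).
    by congr measurable_fun; apply/funext => t /=; rewrite normc_ck real_normK ?num_real.
  have f0 t : (0 <= (`|s| / (`|s| ^+ 2 + (t - q) ^+ 2))%:E)%E.
    by rewrite lee_fin divr_ge0 // addr_ge0 // sqr_ge0.
  rewrite mulrC EFinM -(cauchy_mass q as0) -ge0_integralZl //; last exact/measurable_EFinP.
  apply: eq_integral => t _; rewrite -EFinM normc_ck real_normK ?num_real //.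
  by rewrite mulrA mulVf ?mul1r // gt_eqF.
have ii : inL2 (ck s q) by split; [exact: ck_measurable|rewrite e ltry].
by split=> //; apply: EFin_inj; rewrite sqintE.
Qed.

Lemma inL2_ck s q : s != 0 -> inL2 (ck s q).
Proof. by move=> /(sqint_ck q)[]. Qed.

Lemma normc_ck_le s q t : s != 0 -> normc (ck s q t) <= `|s|^-1.
Proof.
move=> s0; rewrite /ck normcV lef_pV2 ?posrE ?normr_gt0 ?normc_gt0 ?ck_neq0 //.
exact: (normRe_le (s +i* (t - q))).
Qed.

Lemma normc_ck_mono s s' q t : s != 0 -> `|s| <= `|s'| ->
  normc (ck s' q t) <= normc (ck s q t).
Proof.
move=> s0 ss'; have s0' : s' != 0.
  by rewrite -normr_gt0 (lt_le_trans _ ss') // normr_gt0.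
rewrite -(ler_pXn2r (ltn0Sn 1)) ?nnegrE ?normc_ge0 // !normc_ck.
have h (r : R) : r != 0 -> 0 < r ^+ 2 + (t - q) ^+ 2.
  by move=> r0; rewrite ltr_pwDl ?sqr_ge0 // lt_neqAle eq_sym sqrf_eq0 r0 sqr_ge0.
rewrite lef_pV2 ?posrE ?h // lerD2r -(real_normK (num_real s)) -(real_normK (num_real s')).
by rewrite ler_pXn2r ?nnegrE.
Qed.

(** The partial fraction identity behind all computations with multipliers. *)
Lemma ck_sub s s' q q' t : s != 0 -> s' != 0 ->
  ck s q t - ck s' q' t = ((s' - s) +i* (q - q')) * (ck s q t * ck s' q' t).
Proof.
move=> s0 s0'; have -> : (s' - s) +i* (q - q') = s' +i* (t - q') - s +i* (t - q).
  by apply: complexP => /=; ring.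
rewrite /ck; field.
by rewrite !ck_neq0.
Qed.

Lemma bmul_ck s q : s != 0 -> bounded_multiplier (ck s q).
Proof.
move=> s0; split; first exact: ck_measurable.
by exists `|s|^-1 => t; exact: normc_ck_le.
Qed.

End CauchyKernel.

Section HardyOrthogonal.
Context (R : realType).
Local Notation mu := (@lebesgue_measure R).

(** Orthogonality to the Cauchy kernels with poles in the right half-plane Re > 1/2. *)
Definition cauchy_null (g : R -> R[i]) : Prop :=
  forall p q : R, 0 < p -> cintegral setT (fun t => g t * ck (- p) q t) = 0.

(** The supremum in [hardy_bounded] bounds the squared norms of the restrictions to
    all vertical lines at once. *)
Lemma hardy_bounded_slices (F : R[i] -> R[i]) :
  holomorphic_on (@open_half_plane R) F -> hardy_bounded F ->
  exists C : R, forall x, x < 2^-1 -> inL2 (fun y => F (x +i* y)) /\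
    sqint (fun y => F (x +i* y)) <= C.
Proof.
move=> hF; rewrite /hardy_bounded; set S := ereal_sup _ => SC.
have up x : x < 2^-1 -> (\int[mu]_y (normc (F (x +i* y)%R) ^+ 2)%:E <= S)%E.
  by move=> x12; apply: ereal_sup_ubound; exists x.
have S0 : (0 <= S)%E.
  apply: le_trans (up 0 _); last by rewrite invr_gt0.
  by apply: integral_ge0 => y _; rewrite lee_fin sqr_ge0.
have Sf : S \is a fin_num by rewrite ge0_fin_numE.
exists (fine S) => x x12.
have ii : inL2 (fun y => F (x +i* y)).
  split; last exact: le_lt_trans (up x x12) SC.
  apply: ccont_cmeasurable => y; apply: cdiff_ccont_v; apply/derivable_cdiff.
  exact: hF.
by split=> //; rewrite -lee_fin sqintE // fineK // up.
Qed.

(** For F holomorphic, the integral of F(z) / (z - d) over the line Re z = u does not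
    depend on u by [strip_integral], and it tends to 0 when u tends to -oo, because
    the norm of the kernel does.  Letting u tend to 1/2 gives the claim for the
    boundary values. *)
Theorem hardy_cauchy_null (x : L2line R) : hardy x -> cauchy_null (L2repr x).
Proof.
move=> [F [hF bF Fx]] p q p0.
have [C hC] := hardy_bounded_slices hF bF.
have C0 : 0 <= C by have [_] := hC 0 ltac:(by rewrite invr_gt0); apply: le_trans; exact: sqint_ge0.
pose d : R[i] := (2^-1 + p) +i* q.
pose G z := F z * (z - d)^-1.
pose s (t : R) := t - (2^-1 + p).
have GE t y : G (t +i* y) = F (t +i* y) * ck (s t) q y.
  by rewrite /G /ck; congr (_ * _^-1); apply: complexP => /=; ring.
have sp t : t < 2^-1 -> s t < - p by rewrite /s; lra.
have s0 t : t < 2^-1 -> s t != 0 by move=> /sp h; rewrite lt_eqF //; lra.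
have as_ t : t < 2^-1 -> `|s t| = 2^-1 + p - t.
  by move=> /sp h; rewrite ltr0_norm; [rewrite /s opprB|lra].
pose X t := L2class (fun y => F (t +i* y)).
pose K t := L2class (fun y => (ck (s t) q y)^*%C).
have ki t : t < 2^-1 -> inL2 (fun y => (ck (s t) q y)^*%C).
  by move=> t12; apply: inL2_conj; exact: inL2_ck (s0 _ t12).
have IE t : t < 2^-1 -> cintegral setT (fun y => G (t +i* y)) = L2dot (X t) (K t).
  move=> t12; rewrite dot_class //; [|exact: (hC t t12).1|exact: ki].
  by apply: eq_cintegral => y _; rewrite conjcK GE.
have Gi t : t < 2^-1 -> cintegrable setT (fun y => G (t +i* y)).
  move=> t12; under eq_fun do rewrite GE.
  exact: inL2_mul (hC t t12).1 (inL2_ck q (s0 _ t12)).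
have Kn t : t < 2^-1 -> nrm (K t) ^+ 2 = pi / (2^-1 + p - t).
  move=> t12; rewrite nrm_class; last exact: ki.
  rewrite -(as_ _ t12) -(sqint_ck q (s0 _ t12)).2.
  by apply: eq_Rintegral => y _; rewrite normc_conj.
have Xn t : t < 2^-1 -> nrm (X t) ^+ 2 <= C.
  by move=> t12; have [h1 h2] := hC t t12; rewrite nrm_class.
have const t t' : t <= t' -> t' < 2^-1 ->
    cintegral setT (fun y => G (t +i* y)) = cintegral setT (fun y => G (t' +i* y)).
  move=> tt' t12'; have t12 := le_lt_trans tt' t12'.
  apply: (strip_integral tt' _ (Gi _ t12) (Gi _ t12') (C := C + pi / p)).
    move=> z /andP[_ z12]; have z2 := le_lt_trans z12 t12'.
    apply: cdiff_mul; first by apply/derivable_cdiff; exact: hF.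
    by apply: cdiff_sub_inv; rewrite eq_complex negb_and /= lt_eqF //; lra.
  move=> u /andP[_ ut]; have u12 := le_lt_trans ut t12'.
  have [fi fC] := hC u u12; have [ci cC] := sqint_ck q (s0 _ u12).
  apply: (@le_trans _ _ (\int[mu]_y ((normc (F (u +i* y)) ^+ 2)%:E +
     (normc (ck (s u) q y) ^+ 2)%:E))%E).
    apply: ge0_le_integral => //.
    - by move=> y _; rewrite lee_fin normc_ge0.
    - by apply/measurable_EFinP; apply: measurable_normc' => //; exact: (Gi u u12).1.
    - apply: emeasurable_funD; apply/measurable_EFinP/measurable_funX;
        by apply: measurable_normc' => //; first [exact: fi.1|exact: ci.1].
    - move=> y _; rewrite -EFinD lee_fin GE normcM.
      have := sqr_ge0 (normc (F (u +i* y)) - normc (ck (s u) q y)).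
      have := mulr_ge0 (normc_ge0 (F (u +i* y))) (normc_ge0 (ck (s u) q y)).
      nra.
  rewrite ge0_integralD //=; last 4 first.
  - by move=> y _; rewrite lee_fin sqr_ge0.
  - by apply/measurable_EFinP/measurable_funX; apply: measurable_normc' => //; exact: fi.1.
  - by move=> y _; rewrite lee_fin sqr_ge0.
  - by apply/measurable_EFinP/measurable_funX; apply: measurable_normc' => //; exact: ci.1.
  rewrite -!sqintE // -EFinD lee_fin; apply: lerD => //; rewrite cC as_ //.
  by rewrite ler_pM2l ?pi_gt0 // lef_pV2 ?posrE //; lra.
have zero t : t < 2^-1 -> L2dot (X t) (K t) = 0.
  move=> t12; apply/eqP; rewrite -normc_eq0 -sqrf_eq0 eq_le sqr_ge0 andbT.
  apply/ler_addgt0Pr => e e0; rewrite add0r.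
  pose u := Num.min t (- (C * pi / e)).
  have ut : u <= t by rewrite /u ge_min lexx.
  have ue : u <= - (C * pi / e) by rewrite /u ge_min lexx orbT.
  have u12 := le_lt_trans ut t12.
  rewrite -IE // -(const _ _ ut t12) IE //.
  have := cauchy_schwarz (X u) (K u).
  rewrite -(ler_pXn2r (ltn0Sn 1)) ?nnegrE ?normc_ge0 ?mulr_ge0 ?nrm_ge0 //.
  move=> /le_trans; apply; rewrite exprMn Kn //.
  have v0 : 0 < 2^-1 + p - u by lra.
  apply: le_trans (ler_wpM2r _ (Xn u u12)) _; first by rewrite divr_ge0 ?pi_ge0 // ltW.
  have : C * pi / e <= 2^-1 + p - u by lra.
  by rewrite mulrA !ler_pdivrMr // [e * _]mulrC.
pose K0 := L2class (fun y => (ck (- p) q y)^*%C).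
have np0 : - p != 0 by rewrite oppr_eq0 gt_eqF.
have k0i : inL2 (fun y => (ck (- p) q y)^*%C) by apply: inL2_conj; exact: inL2_ck.
have -> : cintegral setT (fun t => L2repr x t * ck (- p) q t) = L2dot x K0.
  rewrite -[x in RHS]L2classK dot_class //; last exact: L2reprP.
  by apply: eq_cintegral => t _; rewrite conjcK.
have KK t : t < 2^-1 -> nrm (K0 - K t) <= (2^-1 - t) / p * nrm K0.
  move=> t12; have c0 : 0 <= (2^-1 - t) / p by apply: divr_ge0; rewrite ?subr_ge0; exact: ltW.
  apply: nrm_le_sqr; first by rewrite mulr_ge0 ?nrm_ge0.
  have -> : (2^-1 - t) / p * nrm K0 = nrm (((2^-1 - t) / p)%:C *: K0).
    by rewrite nrmZ normcC ger0_norm.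
  have kti := ki t t12.
  rewrite L2class_sub // L2classZ // !nrm_class //; [|exact: inL2Z|exact: inL2_sub].
  apply: le_sqint; [exact: inL2_sub|exact: inL2Z|move=> y].
  rewrite -conjcB normc_conj ck_sub //; last exact: s0.
  rewrite !normcM normc_conj normcC (ger0_norm c0).
  rewrite mulrA mulrAC ler_wpM2r ?normc_ge0 //.
  have -> : (s t - - p) +i* (q - q) = (t - 2^-1)%:C.
    by apply: complexP; rewrite /s /=; ring.
  have t0 : 0 <= 2^-1 - t by rewrite subr_ge0 ltW.
  rewrite normcC distrC ger0_norm // ler_wpM2l //.
  apply: le_trans (normc_ck_le _ _ (s0 _ t12)) _.
  by rewrite as_ // lef_pV2 ?posrE //; lra.
have Kt t : t < 2^-1 -> nrm (K t) <= nrm K0.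
  move=> t12; apply: nrm_le_sqr; first exact: nrm_ge0.
  rewrite !nrm_class //; last exact: ki.
  apply: le_sqint => //; first exact: ki.
  move=> y; rewrite !normc_conj; apply: normc_ck_mono => //.
  by rewrite normrN gtr0_norm // as_ //; lra.
apply/eqP; rewrite -normc_eq0 eq_le normc_ge0 andbT.
apply/ler_addgt0Pr => e e0; rewrite add0r.
pose M := nrm K0 + nrm x * nrm K0 / p + 1.
have M0 : 0 < M.
  rewrite /M ltr_wpDl // addr_ge0 ?nrm_ge0 // divr_ge0 ?mulr_ge0 ?nrm_ge0 //; exact: ltW.
have eM : 0 < e / M by rewrite divr_gt0.
have [t [t12 [te xt]]] : exists t, t < 2^-1 /\ (2^-1 - t < e / M /\ nrm (x - X t) < e / M).
  have n1 := (cvg_L2P (F := (2^-1 : R)^'-) _ _).1 Fx _ eM.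
  near (2^-1 : R)^'- => t; exists t; split; [|split].
  - by near: t; exact: nbhs_left_lt.
  - rewrite ltrBlDr -ltrBlDl.
    by near: t; apply: nbhs_left_gt; rewrite ltrBlDr ltrDl.
  - by near: t; exact: n1.
have -> : L2dot x K0 = L2dot x (K0 - K t) + L2dot (x - X t) (K t).
  rewrite dotBl dotBr (zero t t12); move: (L2dot x K0) (L2dot x (K t)) => A B; ring.
apply: le_trans (le_normcD _ _) _.
have h1 : normc (L2dot x (K0 - K t)) <= nrm x * ((e / M) / p * nrm K0).
  apply: le_trans (cauchy_schwarz _ _) _; rewrite ler_wpM2l ?nrm_ge0 //.
  apply: le_trans (KK t t12) _; rewrite ler_wpM2r ?nrm_ge0 // ler_pM2r ?invr_gt0 //.
  exact: ltW.
have h2 : normc (L2dot (x - X t) (K t)) <= (e / M) * nrm K0.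
  apply: le_trans (cauchy_schwarz _ _) _; apply: ler_pM; rewrite ?nrm_ge0 //.
    exact: ltW.
  exact: Kt.
apply: le_trans (lerD h1 h2) _.
have -> : nrm x * (e / M / p * nrm K0) + e / M * nrm K0 = (e / M) * (M - 1).
  have -> : M - 1 = nrm K0 + nrm x * nrm K0 / p by rewrite /M addrK.
  by ring.
rewrite mulrBr mulr1 divfK ?gt_eqF // gerBl.
exact: ltW.
Unshelve. all: end_near. Qed.

End HardyOrthogonal.

(** * Cauchy and Poisson integrals *)

Section ZeroIntegrals.
Context (R : realType).
Local Notation mu := (@lebesgue_measure R).

(** Lebesgue differentiation of the indefinite integral, which is zero. *)
Lemma ae_zero_of_intervals (f : R -> R) :
  (forall a b, mu.-integrable `[a, b] (EFin \o f)) -> measurable_fun setT f ->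
  (forall a b, a < b -> \int[mu]_(t in `[a, b]) f t = 0) ->
  \forall t \ae mu, f t = 0.
Proof.
move=> fi mf f0.
have lf : locally_integrable setT f.
  split=> //; first exact: openT.
  move=> K _ cK; have [M [_ hM]] := compact_bounded cK.
  have M1 : M < `|M| + 1 by rewrite (le_lt_trans (ler_norm M)) // ltrDl.
  have sK : K `<=` `[- (`|M| + 1), (`|M| + 1)].
    by move=> x Kx; have /= := hM _ M1 x Kx; rewrite in_itv /= -ler_norml.
  have mK : measurable K by exact: compact_measurable.
  have : mu.-integrable K (EFin \o f) by exact: (@integrableS _ _ _ mu _ _ _ (measurable_itv _) mK sK (fi _ _)).
  by move=> /integrableP[].
have h n : \forall t \ae mu, - n%:R < t -> f t = 0.
  have := FTC1 (a := BLeft (- n%:R)) (fi (- n%:R)) lf.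
  apply: ae_imp => t h nt.
  have [|_ <-] := h; first by rewrite /= lte_fin.
  rewrite (_ : (fun x => _) = cst 0) ?derive1_cst //.
  apply/funext => y; have [yn|ny] := ltP (- n%:R) y; first exact: f0.
  move: ny; rewrite le_eqVlt => /predU1P[->|ny].
    by rewrite set_itv1 Rintegral_set1.
  by rewrite set_itv_ge ?Rintegral_set0 // bnd_simp -ltNge.
have := @ae_foralln _ _ _ mu (fun n t => - n%:R < t -> f t = 0) h.
apply: ae_imp => t ht; apply: (ht (Num.truncn `|t|).+1).
have /andP[_] := truncn_itv (normr_ge0 t).
by rewrite ltr_norml => /andP[].
Qed.

End ZeroIntegrals.

Section CauchyTransform.
Context (R : realType).
Local Notation mu := (@lebesgue_measure R).
Implicit Types (g : R -> R[i]) (s q t : R).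

Definition cauchy_transform g s q : R[i] := cintegral setT (fun t => g t * ck s q t).

(** The Cauchy integral of g at the point z, up to the factor 2 pi. *)
Definition cauchy_ext g (z : R[i]) : R[i] := cauchy_transform g (2^-1 - Re z) (Im z).

Lemma ck_sub_le s s' q q' t : s != 0 -> `|s| / 2 <= `|s'| -> 
  normc (ck s' q' t) <= 2 / `|s|.
Proof.
move=> s0 ss'; have as0 : 0 < `|s| by rewrite normr_gt0.
have as0' : 0 < `|s'| by apply: lt_le_trans ss'; rewrite divr_gt0.
apply: le_trans (normc_ck_le q' t _) _; first by rewrite -normr_gt0.
by rewrite -invf_div lef_pV2 ?posrE // divr_gt0.
Qed.

(** Differentiation under the integral, from the explicit difference quotient of the
    kernel. *)
Lemma cauchy_ext_cdiff g z : inL2 g -> Re z != 2^-1 -> cdiff (cauchy_ext g) z.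
Proof.
move=> gi; rewrite -subr_eq0 -oppr_eq0 opprB; set s := 2^-1 - Re z; set q := Im z => s0.
have as0 : 0 < `|s| by rewrite normr_gt0.
have ki : inL2 (ck s q) := inL2_ck q s0.
have gk : cintegrable setT (fun t => g t * ck s q t) by exact: inL2_mul.
have bk := bmul_ck q s0.
have gkk : cintegrable setT (fun t => ck s q t * (g t * ck s q t)).
  exact: cintegrable_mul_bounded measurableT bk.1 (fun t _ => normc_ck_le q t s0) gk.
have gkk2 : cintegrable setT (fun t => ck s q t * (ck s q t * (g t * ck s q t))).
  exact: cintegrable_mul_bounded measurableT bk.1 (fun t _ => normc_ck_le q t s0) gkk.
pose B := \int[mu]_t normc (ck s q t * (g t * ck s q t)).
have B0 : 0 <= B by apply: Rintegral_ge0 => t _; exact: normc_ge0.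
exists (cintegral setT (fun t => ck s q t * (g t * ck s q t))) => e e0.
pose C := 2 / `|s| * B.
have C0 : 0 <= C by rewrite mulr_ge0 // divr_ge0 // ltW.
exists (Num.min (`|s| / 2) (e / (C + 1))).
  by rewrite lt_min !divr_gt0 // ltr_wpDl.
move=> w; rewrite lt_min => /andP[ws we].
pose s' := 2^-1 - Re w; pose q' := Im w.
have ss' : `|s| / 2 <= `|s'|.
  have : `|Re (w - z)| < `|s| / 2 by apply: le_lt_trans ws; exact: normRe_le.
  rewrite Re_add Re_opp => h.
  have := ler_normD s' (s - s'); rewrite addrCA subrr addr0.
  rewrite (_ : s - s' = Re w - Re z); last by rewrite /s /s'; ring.
  lra.
have s0' : s' != 0 by rewrite -normr_gt0 (lt_le_trans _ ss') // divr_gt0.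
have bk' : bounded_multiplier (ck s' q') by exact: bmul_ck.
have kle t : setT t -> normc (ck s' q' t) <= 2 / `|s|.
  by move=> _; exact: ck_sub_le ss'.
have gk' : cintegrable setT (fun t => g t * ck s' q' t).
  by apply: inL2_mul => //; exact: inL2_ck.
have gkk' : cintegrable setT (fun t => ck s' q' t * (ck s q t * (g t * ck s q t))).
  exact: cintegrable_mul_bounded measurableT bk'.1 kle gkk.
have dk t : ck s' q' t - ck s q t = (w - z) * (ck s q t * ck s' q' t).
  rewrite -opprB ck_sub // -mulNr; congr (_ * _).
  by rewrite /s /s' /q /q'; apply: complexP; rewrite ?Re_add ?Im_add ?Re_opp ?Im_opp /=; ring.
have -> : cauchy_ext g w - cauchy_ext g z -
    cintegral setT (fun t => ck s q t * (g t * ck s q t)) * (w - z) =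
    (w - z) * (w - z) * cintegral setT (fun t => ck s' q' t * (ck s q t * (g t * ck s q t))).
  rewrite /cauchy_ext /cauchy_transform -/s -/q -/s' -/q' [X in _ - X]mulrC.
  rewrite -cintegralB // -!cintegralZ // -cintegralB //; last 2 first.
  - exact: cintegrable_sub.
  - exact: cintegrableZ.
  apply: eq_cintegral => t _.
  rewrite -mulrBr dk.
  have e1 : ck s' q' t = ck s q t + (w - z) * (ck s q t * ck s' q' t) by rewrite -dk addrC subrK.
  transitivity ((w - z) * (g t * ck s q t) * (ck s' q' t - ck s q t)); first by ring.
  by rewrite dk; ring.
rewrite !normcM -mulrA mulrC -mulrA [in leRHS]mulrC.
rewrite ler_wpM2l ?normc_ge0 //.
have : normc (cintegral setT (fun t => ck s' q' t * (ck s q t * (g t * ck s q t)))) <= C.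
  apply: le_trans (normc_cintegral measurableT gkk') _.
  have ii := cintegrable_normc measurableT gkk.
  rewrite /C /B -RintegralZl //; apply: le_Rintegral => //.
  - exact: cintegrable_normc.
  - exact: integrable_scaler.
  - by move=> t _; rewrite normcM ler_wpM2r ?normc_ge0 // kle.
move=> hC; apply: le_trans (ler_wpM2r (normc_ge0 _) hC) _.
have := normc_ge0 (w - z); move: we; rewrite ltr_pdivlMr ?ltr_wpDl // => we nw.
by apply: le_trans (ltW we); rewrite mulrC ler_wpM2l // lerDl.
Qed.

(** The Poisson kernel of the half-plane at distance d from the line. *)
Definition pk d y t : R := d / (d ^+ 2 + (t - y) ^+ 2) / pi.

Definition poisson d g y : R[i] := cintegral setT (fun t => (pk d y t)%:C * g t).

Lemma pk_ge0 d y t : 0 < d -> 0 <= pk d y t.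
Proof.
by move=> d0; rewrite /pk divr_ge0 ?pi_ge0 // divr_ge0 ?(ltW d0) // addr_ge0 // sqr_ge0.
Qed.

Lemma pkC d y t : pk d y t = pk d t y.
Proof. by rewrite /pk -(sqrrN (t - y)) opprB. Qed.

(** The Poisson kernel is the difference of the Cauchy kernels at two points
    symmetric with respect to the line. *)
Lemma pkE d y t : 0 < d ->
  (pk d y t)%:C = ((2 * pi)^-1)%:C * (ck d y t - ck (- d) y t) :> R[i].
Proof.
move=> d0; have d0' : d != 0 by rewrite gt_eqF.
rewrite ck_sub ?oppr_eq0 //.
have e : ck d y t * ck (- d) y t = (- (d ^+ 2 + (t - y) ^+ 2)^-1)%:C.
  rewrite /ck -invfM.
  have -> : (d +i* (t - y)) * ((- d) +i* (t - y)) = (- (d ^+ 2 + (t - y) ^+ 2))%:C :> R[i].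
    by apply: complexP => /=; ring.
  by rewrite -fmorphV invrN.
rewrite e.
have -> : (- d - d) +i* (y - y) = (- (2 * d))%:C :> R[i] by apply: complexP => /=; ring.
rewrite -!rmorphM /pk; congr _%:C.
have p0 : pi != 0 :> R by rewrite gt_eqF // pi_gt0.
have D0 : d ^+ 2 + (t - y) ^+ 2 != 0.
  by rewrite gt_eqF // ltr_pwDl ?sqr_ge0 // exprn_gt0.
by move: pi p0 => P p0; field; rewrite p0 D0.
Qed.

End CauchyTransform.

Section PoissonKernel.
Context (R : realType).
Local Notation mu := (@lebesgue_measure R).
Implicit Types (g : R -> R[i]) (d q t y : R).

Lemma pk_measurable d y : 0 < d -> measurable_fun setT (pk d y).
Proof.
move=> d0.
have m : cmeasurable setT (fun t => (pk d y t)%:C).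
  apply: (eq_cmeasurable (fun t => esym (pkE y t d0))).
  apply: cmeasurable_mul; first exact: cmeasurable_cst.
  by apply: cmeasurable_sub; exact: ck_measurable.
exact: m.1.
Qed.

Lemma pk_mass d y : 0 < d -> (\int[mu]_t (pk d y t)%:E = 1)%E.
Proof.
move=> d0; have p0 := pi_gt0 R.
transitivity ((pi^-1)%:E * \int[mu]_t (d / (d ^+ 2 + (t - y) ^+ 2))%:E)%E.
  rewrite -ge0_integralZl //; last 3 first.
  - apply/measurable_EFinP.
    have := measurable_funM (pk_measurable y d0) (measurable_cst (pi : R)).
    by congr measurable_fun; apply/funext => t /=; rewrite /pk divfK // gt_eqF.
  - by move=> t _; rewrite lee_fin divr_ge0 ?(ltW d0) // addr_ge0 // sqr_ge0.
  - by rewrite lee_fin invr_ge0 ltW.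
  by apply: eq_integral => t _; rewrite -EFinM mulrC.
by rewrite cauchy_mass // -EFinM mulVf // gt_eqF.
Qed.

Lemma pk_integrable d y : 0 < d -> mu.-integrable setT (EFin \o pk d y).
Proof.
move=> d0; apply/integrableP; split.
  by apply/measurable_EFinP; exact: pk_measurable.
under eq_integral do rewrite /= ger0_norm ?pk_ge0 //.
by rewrite pk_mass // ltry.
Qed.

Lemma pk_mass' d y : 0 < d -> \int[mu]_t pk d y t = 1.
Proof. by move=> d0; rewrite /Rintegral pk_mass. Qed.

Lemma pk_le d y t : 0 < d -> pk d y t <= (d * pi)^-1.
Proof.
move=> d0; rewrite /pk invfM ler_pM2r ?invr_gt0 ?pi_gt0 //.
rewrite ler_pdivrMr; last by rewrite ltr_pwDl ?sqr_ge0 // exprn_gt0.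
rewrite mulrDr expr2 mulrA mulVf ?gt_eqF // mul1r lerDl.
by rewrite mulr_ge0 ?invr_ge0 ?sqr_ge0 // ltW.
Qed.

Lemma poisson_integrable d g y : 0 < d -> inL2 g ->
  cintegrable setT (fun t => (pk d y t)%:C * g t).
Proof.
move=> d0 gi; have d0' : d != 0 by rewrite gt_eqF.
have h : cintegrable setT (fun t => ((2 * pi)^-1)%:C * (g t * ck d y t - g t * ck (- d) y t)).
  apply: cintegrableZ => //; apply: cintegrable_sub => //; apply: inL2_mul => //.
    exact: inL2_ck.
  by apply: inL2_ck; rewrite oppr_eq0.
by apply: (eq_cintegrable _ _ h) => // t _; rewrite pkE //; ring.
Qed.

Lemma poissonE d g y : 0 < d -> inL2 g ->
  poisson d g y = ((2 * pi)^-1)%:C * (cauchy_transform g d y - cauchy_transform g (- d) y).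
Proof.
move=> d0 gi; have d0' : d != 0 by rewrite gt_eqF.
have i1 : cintegrable setT (fun t => g t * ck d y t).
  by apply: inL2_mul => //; exact: inL2_ck.
have i2 : cintegrable setT (fun t => g t * ck (- d) y t).
  by apply: inL2_mul => //; apply: inL2_ck; rewrite oppr_eq0.
have i3 := cintegrable_sub measurableT i1 i2.
rewrite /cauchy_transform -cintegralB // -cintegralZ //.
by apply: eq_cintegral => t _; rewrite pkE //; ring.
Qed.

Lemma poisson_ccont d g y : 0 < d -> inL2 g -> ccont_at (poisson d g) y.
Proof.
move=> d0 gi; have d0' : d != 0 by rewrite gt_eqF.
have ct s : s != 0 -> ccont_at (cauchy_transform g s) y.
  move=> s0; have : cdiff (cauchy_ext g) ((2^-1 - s) +i* y).
    by apply: cauchy_ext_cdiff => //=; rewrite -subr_eq0 addrAC subrr sub0r oppr_eq0.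
  move=> /cdiff_ccont_v h.
  rewrite (_ : cauchy_transform g s = fun u => cauchy_ext g ((2^-1 - s) +i* u)) //.
  by apply/funext => u; rewrite /cauchy_ext /= subKr.
rewrite (_ : poisson d g = fun y => ((2 * pi)^-1)%:C *
    (cauchy_transform g d y - cauchy_transform g (- d) y)); last first.
  by apply/funext => u; exact: poissonE.
apply: ccont_mul; first exact: ccont_cst.
by apply: ccont_sub; apply: ct; rewrite ?oppr_eq0.
Qed.

(** Jensen's inequality for the probability density [pk d y], obtained by integrating
    2 l |g| <= l^2 + |g|^2 and choosing l to be the integral of |g|. *)
Lemma poisson_jensen d g y : 0 < d -> inL2 g ->
  ((normc (poisson d g y) ^+ 2)%:E <= \int[mu]_t (pk d y t * normc (g t) ^+ 2)%:E)%E.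
Proof.
move=> d0 gi; have pc := poisson_integrable y d0 gi.
have mpk := pk_measurable y d0; have mg := measurable_normc' measurableT gi.1.
have pg : mu.-integrable setT (EFin \o (fun t => pk d y t * normc (g t) ^+ 2)).
  have bd := integrable_scaler (d * pi)^-1 measurableT (inL2_sq gi).
  apply: le_integrable bd => //.
    by apply/measurable_EFinP; apply: measurable_funM => //; exact: measurable_funX.
  move=> t _ /=.
  have c0 : 0 <= (d * pi)^-1 by rewrite invr_ge0 mulr_ge0 ?(ltW d0) ?pi_ge0.
  have q0 := sqr_ge0 (normc (g t)); have k0 := pk_ge0 y t d0.
  rewrite lee_fin (ger0_norm (mulr_ge0 k0 q0)) (ger0_norm (mulr_ge0 c0 q0)).
  by rewrite ler_wpM2r // pk_le.
pose a := \int[mu]_t (pk d y t * normc (g t)).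
pose b := \int[mu]_t (pk d y t * normc (g t) ^+ 2).
have pa : mu.-integrable setT (EFin \o (fun t => pk d y t * normc (g t))).
  rewrite (_ : (fun t => pk d y t * normc (g t)) = (fun t => normc ((pk d y t)%:C * g t))).
    exact: cintegrable_normc.
  by apply/funext => t; rewrite normcM normcC ger0_norm ?pk_ge0.
have key (l : R) : 2 * l * a <= l ^+ 2 + b.
  have pi1 := pk_integrable y d0.
  have pi2 := integrable_scaler (l ^+ 2) measurableT pi1.
  have -> : 2 * l * a = \int[mu]_t (2 * l * (pk d y t * normc (g t))).
    by rewrite RintegralZl.
  have -> : l ^+ 2 + b = \int[mu]_t (l ^+ 2 * pk d y t + pk d y t * normc (g t) ^+ 2).
    by rewrite RintegralD // RintegralZl // pk_mass' // mulr1.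
  apply: le_Rintegral => //.
  - exact: (integrable_scaler (2 * l) measurableT pa).
  - exact: (integrable_addr measurableT pi2 pg).
  - move=> t _; have := pk_ge0 y t d0.
    have := sqr_ge0 (l - normc (g t)); nra.
have ab : a ^+ 2 <= b by have := key a; rewrite expr2; lra.
have -> : (\int[mu]_t (pk d y t * normc (g t) ^+ 2)%:E = b%:E)%E.
  by rewrite /b /Rintegral fineK //; exact: integrable_fin_num pg.
have a0 : 0 <= a by apply: Rintegral_ge0 => t _; rewrite mulr_ge0 ?normc_ge0 ?pk_ge0.
rewrite lee_fin; apply: le_trans ab; rewrite ler_pXn2r ?nnegrE ?normc_ge0 //.
apply: le_trans (normc_cintegral _ pc) _ => //.
rewrite le_eqVlt; apply/orP; left; apply/eqP.
by apply: eq_Rintegral => t _; rewrite normcM normcC ger0_norm ?pk_ge0.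
Qed.

Lemma pk_measurable2 d : 0 < d ->
  measurable_fun setT (fun z : measurableTypeR R * measurableTypeR R => pk d z.1 z.2).
Proof.
move=> d0.
have m (f : measurableTypeR R * measurableTypeR R -> R) : measurable_fun setT f ->
   (forall z, 0 <= f z) -> measurable_fun setT (fun z => (f z)^-1).
  move=> mf f0; rewrite (_ : (fun _ => _) = (fun z => (f z) `^ (-1))).
    exact: (measurableT_comp (measurable_powR (-1))).
  by apply/funext => z; rewrite powR_inv1.
apply: measurable_funM; last exact: measurable_cst.
apply: measurable_funM; first exact: measurable_cst.
apply: m; last by move=> z; rewrite addr_ge0 // sqr_ge0.
apply: measurable_funD; first exact: measurable_cst.
apply: measurable_funX; apply: measurable_funB.
  exact: measurable_snd.
exact: measurable_fst.
Qed.

(** [poisson_jensen] integrated over y; the kernel is symmetric and has mass one. *)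
Theorem poisson_contraction d g : 0 < d -> inL2 g ->
  inL2 (poisson d g) /\ sqint (poisson d g) <= sqint g.
Proof.
move=> d0 gi.
have mP : cmeasurable setT (poisson d g).
  by apply: ccont_cmeasurable => y; exact: poisson_ccont.
have key : (\int[mu]_y (normc (poisson d g y) ^+ 2)%:E <=
    \int[mu]_t (normc (g t) ^+ 2)%:E)%E.
  pose f (z : measurableTypeR R * measurableTypeR R) : \bar R :=
    (pk d z.1 z.2 * normc (g z.2) ^+ 2)%:E.
  have mf : measurable_fun setT f.
    apply/measurable_EFinP; apply: measurable_funM; first exact: pk_measurable2.
    apply: measurable_funX.
    apply: (@measurableT_comp _ _ _ _ _ _ (fun t => normc (g t))).
      exact: measurable_normc' gi.1.
    exact: measurable_snd.
  have f0 z : (0 <= f z)%E by rewrite lee_fin mulr_ge0 ?sqr_ge0 ?pk_ge0.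
  apply: (@le_trans _ _ (\int[mu]_y \int[mu]_t f (y, t))%E).
    apply: ge0_le_integral => //.
    - by move=> y _; rewrite lee_fin sqr_ge0.
    - by apply/measurable_EFinP/measurable_funX; exact: measurable_normc'.
    - exact: (measurable_fun_fubini_tonelli_F (m2 := mu) f).
    - by move=> y _; exact: poisson_jensen.
  rewrite (fubini_tonelli (m1 := mu) (m2 := mu) f) //.
  rewrite le_eqVlt; apply/orP; left; apply/eqP; apply: eq_integral => t _.
  transitivity ((normc (g t) ^+ 2)%:E * \int[mu]_y (pk d t y)%:E)%E.
    rewrite -ge0_integralZl //; last 3 first.
    - by apply/measurable_EFinP; exact: pk_measurable.
    - by move=> y _; rewrite lee_fin pk_ge0.
    - by rewrite lee_fin sqr_ge0.
    by apply: eq_integral => y _; rewrite /f /= pkC mulrC.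
  by rewrite pk_mass // mule1.
have Pi : inL2 (poisson d g) by split=> //; apply: le_lt_trans key gi.2.
by split=> //; rewrite -lee_fin !sqintE.
Qed.

End PoissonKernel.

Section PoissonConvergence.
Context (R : realType).
Local Notation mu := (@lebesgue_measure R).
Implicit Types (d q t y a b : R) (x z : L2line R).

Definition Pois d x : L2line R := L2class (poisson d (L2repr x)).

Lemma Pois_class d f : 0 < d -> inL2 f -> Pois d (L2class f) = L2class (poisson d f).
Proof.
move=> d0 fi; rewrite /Pois; congr L2class; apply/funext => y.
have xi := L2reprP (L2class f).
apply: ae_eq_cintegral => //.
- exact: (poisson_integrable y d0 xi).1.
- exact: (poisson_integrable y d0 fi).1.
- by apply: ae_imp (L2repr_class fi) => t ->.
Qed.

Lemma PoisD d x z : 0 < d -> Pois d (x + z) = Pois d x + Pois d z.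
Proof.
move=> d0; have [xi zi] := (L2reprP x, L2reprP z).
rewrite -[in LHS](L2classK x) -[in LHS](L2classK z) L2class_add //.
rewrite Pois_class //; last exact: inL2_add.
rewrite /Pois L2class_add; [|exact: (poisson_contraction d0 _).1..].
congr L2class; apply/funext => y; rewrite /poisson.
rewrite -cintegralD //; [|exact: poisson_integrable..].
by apply: eq_cintegral => t _; rewrite mulrDr.
Qed.

Lemma PoisZ d (c : R[i]) x : 0 < d -> Pois d (c *: x) = c *: Pois d x.
Proof.
move=> d0; have xi := L2reprP x.
rewrite -[in LHS](L2classK x) L2classZ // Pois_class //; last exact: inL2Z.
rewrite /Pois L2classZ; last exact: (poisson_contraction d0 _).1.
congr L2class; apply/funext => y; rewrite /poisson.
rewrite -cintegralZ //; last exact: poisson_integrable.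
by apply: eq_cintegral => t _; ring.
Qed.

Lemma nrm_Pois d x : 0 < d -> nrm (Pois d x) <= nrm x.
Proof.
move=> d0; apply: nrm_le_sqr; first exact: nrm_ge0.
have [pi_ ple] := poisson_contraction d0 (L2reprP x).
by rewrite nrm_class // nrm_sqr.
Qed.

Lemma PoisB d x z : 0 < d -> Pois d (x - z) = Pois d x - Pois d z.
Proof. by move=> d0; rewrite -scaleN1r PoisD // PoisZ // scaleN1r. Qed.

(** The classes recovered from their Poisson integrals at the boundary. *)
Definition poisson_good : set (L2line R) := [set x | forall e, 0 < e ->
  exists2 d0, 0 < d0 & forall d, 0 < d -> d < d0 -> nrm (Pois d x - x) < e].

Lemma poisson_good_closed : closed_subspace poisson_good.
Proof.
split.
- move=> e e0; exists 1 => // d d0 _; rewrite subr0.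
  by apply: le_lt_trans (nrm_Pois 0 d0) _; rewrite nrm0.
- move=> x z gx gz e e0; have e2 : 0 < e / 2 by rewrite divr_gt0.
  have [d1 d10 h1] := gx _ e2; have [d2 d20 h2] := gz _ e2.
  exists (Num.min d1 d2); first by rewrite lt_min d10.
  move=> d d0; rewrite lt_min => /andP[dd1 dd2].
  rewrite PoisD // opprD addrACA; apply: le_lt_trans (nrmD _ _) _.
  by rewrite (splitr e); apply: ltrD; [exact: h1|exact: h2].
- move=> c x gx e e0; have c0 : 0 < normc c + 1 by rewrite ltr_wpDl ?normc_ge0.
  have [d1 d10 h1] := gx (e / (normc c + 1)) (divr_gt0 e0 c0).
  exists d1 => // d d0 dd1; rewrite PoisZ // -scalerBr nrmZ.
  have := h1 d d0 dd1; rewrite ltr_pdivlMr // => h.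
  by apply: le_lt_trans h; rewrite mulrC ler_wpM2l ?nrm_ge0 // lerDl.
- move=> u l gu ul e e0; have e4 : 0 < e / 4 by rewrite divr_gt0.
  have /cvgrPdist_lt /(_ _ e4) [N _ /(_ N (leqnn N))] := ul.
  rewrite /= sub0r normrN ger0_norm ?nrm_ge0 // => uN.
  have [d1 d10 h1] := gu N _ e4; exists d1 => // d d0 dd1.
  have -> : Pois d l - l = Pois d (l - u N) + (Pois d (u N) - u N) + (u N - l).
    by rewrite PoisB // !subrKA.
  apply: le_lt_trans (nrmD _ _) _.
  have := nrmD (Pois d (l - u N)) (Pois d (u N) - u N).
  have := nrm_Pois (l - u N) d0; rewrite (nrmBC l).
  have := h1 d d0 dd1; lra.
Qed.

Lemma indicator_inL2 a b : inL2 (fun t => ((\1_(`[a, b]%classic : set R) t : R))%:C).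
Proof.
split; first by apply: cmeasurable_real; exact: measurable_indic.
apply: (@le_lt_trans _ _ (\int[mu]_(t in `[a, b]) 1%:E)%E).
  rewrite [leRHS]integral_mkcond; apply: ge0_le_integral => //.
  - by move=> t _; rewrite lee_fin sqr_ge0.
  - apply/measurable_EFinP/measurable_funX; apply: measurable_normc' => //.
    by apply: cmeasurable_real; exact: measurable_indic.
  - exact/(measurable_restrictT _ _).1.
  - move=> t _; rewrite /patch indicE normcC; case: (_ \in _) => //=.
      by rewrite normr1 expr1n.
    by rewrite normr0 expr0n.
have := @lebesgue_measure_itv R `[a, b]; rewrite /= => mI.
rewrite integral_cst //= mI; case: ifP => _; last by rewrite mule0 ltry.
by rewrite -EFinB -EFinM ltry.
Qed.

(** Outside the interval, at distance at least r from y, the kernel [pk d] is at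
    most d times a multiple of [pk 1]. *)
Lemma poisson_indicator_lower a b r d y : 0 < r -> 0 < d -> a + r <= y <= b - r ->
  1 - d * ((1 + r ^+ 2) / r ^+ 2) <=
  Re (poisson d (fun t => ((\1_(`[a, b]%classic : set R) t : R))%:C) y).
Proof.
move=> r0 d0 /andP[ya yb].
have fi := indicator_inL2 a b.
have pc := poisson_integrable y d0 fi.
set C := (1 + r ^+ 2) / r ^+ 2.
have C0 : 0 < C by rewrite divr_gt0 // ?exprn_gt0 // ltr_pwDl // sqr_ge0.
have -> : 1 - d * C = \int[mu]_t (pk d y t - d * C * pk 1 y t).
  rewrite RintegralB //; [|exact: pk_integrable|]; last first.
    exact: (integrable_scaler (d * C) measurableT (pk_integrable y ltr01)).
  by rewrite RintegralZl // ?pk_mass' ?mulr1 //; exact: pk_integrable.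
apply: le_Rintegral => //.
- rewrite (_ : (fun t => pk d y t - d * C * pk 1 y t) =
      (fun t => pk d y t + - (d * C) * pk 1 y t)).
    exact: (integrable_addr measurableT (pk_integrable y d0)
      (integrable_scaler (- (d * C)) measurableT (pk_integrable y ltr01))).
  by apply/funext => t; rewrite mulNr.
- exact: cintegrable_Re pc.
- move=> t _; rewrite -rmorphM /= indicE.
  have [|] := boolP (t \in _); rewrite ?mulr1 ?mulr0 => tI.
    have k1 := pk_ge0 y t ltr01; have dC := mulr_gt0 d0 C0.
    by rewrite gerBl mulr_ge0 // ltW.
  have tr : r ^+ 2 <= (t - y) ^+ 2.
    have := contra (fun h => mem_set h) tI; rewrite /= in_itv /= negb_and -!ltNge.
    by case/orP => h; nra.
  rewrite subr_le0 /pk mulrA ler_pM2r ?invr_gt0 ?pi_gt0 //.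
  rewrite -mulrA ler_pM2l // expr1n.
  have u0 : 0 < (t - y) ^+ 2 by apply: lt_le_trans tr; rewrite exprn_gt0.
  apply: (@le_trans _ _ ((t - y) ^+ 2)^-1).
    by rewrite lef_pV2 ?posrE // ?lerDr ?sqr_ge0 // ltr_pwDl ?exprn_gt0 // sqr_ge0.
  rewrite div1r -[leLHS]div1r ler_pdivrMr // /C.
  rewrite mulrAC ler_pdivlMr ?ltr_pwDl ?ltr01 ?(ltW u0) // mul1r.
  rewrite mulrAC ler_pdivlMr ?exprn_gt0 //.
  nra.
Qed.

(** Since the operator is a contraction, |Pf - f|^2 <= 2 (|f|^2 - Re <Pf, f>), and
    [poisson_indicator_lower] bounds <Pf, f> from below. *)
Lemma poisson_good_indicator a b : a < b ->
  poisson_good (L2class (fun t => ((\1_(`[a, b]%classic : set R) t : R))%:C)).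
Proof.
move=> ab; have fi := indicator_inL2 a b; set f := fun t => _ in fi *.
move=> e e0.
have bound r d : 0 < r -> r < (b - a) / 2 -> 0 < d ->
    nrm (Pois d (L2class f) - L2class f) ^+ 2 <=
    2 * (2 * r + d * ((1 + r ^+ 2) / r ^+ 2) * (b - a)).
  move=> r0 rb d0; have [Pi Ple] := poisson_contraction d0 fi.
  rewrite Pois_class //.
  have nf : nrm (L2class f) ^+ 2 = b - a.
    rewrite nrm_class // -[RHS]mul1r -Rintegral_cst_itv ?(ltW ab) //.
    rewrite Rintegral_mkcond; apply: eq_Rintegral => t _; rewrite /f /patch indicE.
    rewrite normcC; case: (_ \in _) => /=; first by rewrite normr1 expr1n.
    by rewrite normr0 expr0n.
  have nP : nrm (L2class (poisson d f)) ^+ 2 <= b - a by rewrite -nf !nrm_class.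
  rewrite nrm_sqrB nf.
  set C := (1 + r ^+ 2) / r ^+ 2.
  have C0 : 0 < C by rewrite divr_gt0 // ?exprn_gt0 // ltr_pwDl // sqr_ge0.
  suff : (1 - d * C) * (b - a - 2 * r) <= Re (L2dot (L2class (poisson d f)) (L2class f)).
    have : 0 < d * C * (2 * r) by rewrite (mulr_gt0 (mulr_gt0 d0 C0)) ?(mulr_gt0 _ r0).
    move: nP; set N := nrm _ ^+ 2; set X := Re _.
    have -> : (1 - d * C) * (b - a - 2 * r) =
      b - a - 2 * r - d * C * (b - a) + d * C * (2 * r) by ring.
    set Y := d * C * (b - a); set Z := d * C * (2 * r); lra.
  rewrite dot_class //; set c1 := a + r; set c2 := b - r.
  have c12 : c1 <= c2 by rewrite /c1 /c2; lra.
  have pd : mu.-integrable setT (EFin \o (fun t => Re (poisson d f t * (f t)^*%C))).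
    by apply: cintegrable_Re => //; apply: inL2_mul => //; exact: inL2_conj.
  rewrite (_ : b - a - 2 * r = c2 - c1); last by rewrite /c1 /c2; ring.
  rewrite -Rintegral_cst_itv //.
  have P0 t : 0 <= Re (poisson d f t).
    rewrite /poisson /cintegral /=; apply: Rintegral_ge0 => u _.
    by rewrite /= mul0r subr0 mulr_ge0 ?pk_ge0 // indicE ler0n.
  rewrite Rintegral_mkcond; apply: le_Rintegral => //.
    rewrite (_ : _ \_ _ = (fun t => (1 - d * C) * \1_(`[c1, c2]%classic : set R) t)).
      exact: (integrable_scaler _ measurableT (integrable_indic_itv c1 c2 true false)).
    by apply/funext => t; rewrite /patch indicE; case: ifP; rewrite ?mulr1 ?mulr0.
  have ReC (z : R[i]) (c : R) : Re (z * c%:C) = Re z * c by rewrite Re_mul /= mulr0 subr0.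
  move=> t _; rewrite [in (f t)]/f conjc_real ReC indicE /patch.
  case: ifPn => [/set_mem|_]; last by rewrite mulr_ge0.
  rewrite /= in_itv /= => /andP[h1 h2].
  rewrite mem_set; last by rewrite /= in_itv /=; move: h1 h2; rewrite /c1 /c2 => ? ?; apply/andP; split; lra.
  rewrite mulr1; apply: poisson_indicator_lower => //.
  by rewrite h1 h2.
have e2 : 0 < e ^+ 2 by rewrite exprn_gt0.
have ba : 0 < b - a by rewrite subr_gt0.
pose r := Num.min ((b - a) / 4) (e ^+ 2 / 16).
have r0 : 0 < r by rewrite lt_min !divr_gt0.
have rb : r < (b - a) / 2.
  by apply: (@le_lt_trans _ _ ((b - a) / 4)); [rewrite /r ge_min lexx|lra].
have re : r <= e ^+ 2 / 16 by rewrite /r ge_min lexx orbT.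
pose C := (1 + r ^+ 2) / r ^+ 2.
have C0 : 0 < C by rewrite divr_gt0 // ?exprn_gt0 // ltr_pwDl // sqr_ge0.
have Cb : 0 < C * (b - a) by rewrite mulr_gt0.
exists (e ^+ 2 / 16 / (C * (b - a))); first by rewrite !divr_gt0.
move=> d d0; rewrite ltr_pdivlMr // => hd.
rewrite -(ltr_pXn2r (ltn0Sn 1)) ?nnegrE ?nrm_ge0 ?(ltW e0) //.
apply: le_lt_trans (bound r d r0 rb d0) _; rewrite -/C -mulrA.
by set X := d * _ in hd *; lra.
Qed.

(** The set of good classes is a closed subspace.  A class orthogonal to it has zero
    integral over every interval, hence is zero, so the subspace is everything. *)
Theorem poisson_goodT x : poisson_good x.
Proof.
have cS := poisson_good_closed.
have [h Sh hk] := orthogonal_projection x cS.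
suff : x - h = 0 by move=> /eqP; rewrite subr_eq0 => /eqP ->.
set y := x - h in hk *; have yi := L2reprP y.
have i_ a b : cintegrable `[a, b] (L2repr y).
  have := inL2_mul yi (indicator_inL2 a b).
  move=> /(cintegrableS measurableT (measurable_itv `[a, b]) (@subsetT _ _)).
  apply: eq_cintegrable => // t tab.
  by rewrite indicE mem_set // mulr1.
have z a b : a < b -> cintegral `[a, b] (L2repr y) = 0.
  move=> ab; rewrite -[RHS](hk _ (poisson_good_indicator ab)).
  rewrite -[y in RHS]L2classK dot_class //; last exact: indicator_inL2.
  rewrite cintegral_mkcond; apply: eq_cintegral => t _.
  by rewrite conjc_real mulrC.
apply: L2line_ext.
have zr : \forall t \ae mu, Re (L2repr y t) = 0.
  apply: ae_zero_of_intervals; [|exact: yi.1.1|].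
    by move=> a b; apply: cintegrable_Re => //.
  by move=> a b /z /(congr1 (@complex.Re R)).
have zi : \forall t \ae mu, Im (L2repr y t) = 0.
  apply: ae_zero_of_intervals; [|exact: yi.1.2|].
    by move=> a b; apply: cintegrable_Im => //.
  by move=> a b /z /(congr1 (@complex.Im R)).
have z0 : \forall t \ae mu, L2repr (0 : L2line R) t = 0.
  have := L2reprZ 0 (0 : L2line R); rewrite scale0r.
  by apply: ae_imp => t ->; rewrite mul0r.
have zy : \forall t \ae mu, L2repr y t = 0.
  by apply: (ae_imp2 _ zr zi) => t h1 h2; apply: complexP.
by apply: (ae_imp2 _ zy z0) => t -> ->.
Qed.

End PoissonConvergence.

(** * Hardy functions are those orthogonal to the Cauchy kernels *)

Section ComplexFubini.
Context (R : realType).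
Local Notation mu := (@lebesgue_measure R).
Local Notation mR := (measurableTypeR R).

Lemma rfubini (D1 D2 : set R) (h : R -> R -> R) : measurable D1 -> measurable D2 ->
  measurable_fun setT (fun z : mR * mR => h z.1 z.2) ->
  (\int[mu]_(x in D1) \int[mu]_(y in D2) `|h x y|%:E < +oo)%E ->
  \int[mu]_(x in D1) \int[mu]_(y in D2) h x y =
  \int[mu]_(y in D2) \int[mu]_(x in D1) h x y.
Proof.
move=> mD1 mD2 mh hfin.
pose k x y := \1_D1 x * \1_D2 y * h x y.
pose f (z : mR * mR) : \bar R := (k z.1 z.2)%:E.
have mf : measurable_fun setT f.
  apply/measurable_EFinP/measurable_funM => //; apply: measurable_funM.
    apply: (@measurableT_comp _ _ _ _ _ _ (\1_D1 : R -> R)); last exact: measurable_fst.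
    exact: measurable_indic.
  apply: (@measurableT_comp _ _ _ _ _ _ (\1_D2 : R -> R)); last exact: measurable_snd.
  exact: measurable_indic.
have ind (D : set R) x (a : R) : \1_D x * a = ((fun=> a) \_ D) x.
  by rewrite indicE /patch; case: ifP; rewrite ?mul1r ?mul0r.
have fi : (mu \x mu)%E.-integrable setT f.
  apply/(@integrable12ltyP _ _ _ _ R mu mu f mf).
  apply: le_lt_trans hfin; rewrite [leRHS]integral_mkcond.
  rewrite le_eqVlt; apply/orP; left; apply/eqP; apply: eq_integral => x _.
  rewrite /f /k /= /patch; case: ifPn => xD.
    rewrite [RHS]integral_mkcond; apply: eq_integral => y _.
    rewrite !indicE xD mul1r /patch; case: ifP => _; first by rewrite mul1r.
    by rewrite mul0r normr0.
  by rewrite integral0_eq // => y _; rewrite !indicE (negbTE xD) !mul0r normr0.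
have aeR (g : R -> \bar R) : mu.-integrable setT g ->
    (\int[mu]_x (fine (g x))%:E = \int[mu]_x g x)%E.
  move=> ig; apply: ae_eq_integral => //.
  - by have /measurable_int mg := ig; apply/measurable_EFinP; exact: measurableT_comp.
  - exact: measurable_int ig.
  - have := @integrable_ae _ _ _ mu setT measurableT g ig.
    by apply: ae_imp => x /= gx _; rewrite fineK // gx.
have E1 : \int[mu]_(x in D1) \int[mu]_(y in D2) h x y = fine (\int[mu]_x \int[mu]_y f (x, y))%E.
  rewrite -(aeR _ (integrable_fubini_F fi)) Rintegral_mkcond; congr fine.
  apply: eq_integral => x _; congr _%:E; rewrite -/(Rintegral _ _ _).
  rewrite /patch; case: ifPn => xD; last first.
    by rewrite /Rintegral integral0_eq // => y _; rewrite /k indicE (negbTE xD) !mul0r.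
  rewrite Rintegral_mkcond; apply: eq_Rintegral => y _.
  by rewrite /k indicE xD mul1r ind.
have E2 : \int[mu]_(y in D2) \int[mu]_(x in D1) h x y = fine (\int[mu]_y \int[mu]_x f (x, y))%E.
  pose f' (z : mR * mR) := f (z.2, z.1).
  have mf' : measurable_fun setT f'.
    by apply: (measurableT_comp mf); exact: measurable_swap.
  have fi' : (mu \x mu)%E.-integrable setT f'.
    by apply/(@integrable12ltyP _ _ _ _ R mu mu f' mf'); apply/integrable21ltyP.
  rewrite -(aeR _ (integrable_fubini_F fi')) Rintegral_mkcond; congr fine.
  apply: eq_integral => y _; congr _%:E; rewrite -/(Rintegral _ _ _).
  rewrite /patch; case: ifPn => yD; last first.
    by rewrite /Rintegral integral0_eq // => x _; rewrite /k [\1_D2 _]indicE (negbTE yD) mulr0 mul0r.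
  rewrite Rintegral_mkcond; apply: eq_Rintegral => x _.
  by rewrite /k [\1_D2 _]indicE yD mulr1 ind.
by rewrite E1 E2 (Fubini fi).
Qed.

End ComplexFubini.

Section ComplexFubini2.
Context (R : realType).
Local Notation mu := (@lebesgue_measure R).
Local Notation mR := (measurableTypeR R).

Definition cmeasurable2 (f : R -> R -> R[i]) : Prop :=
  measurable_fun setT (fun z : mR * mR => Re (f z.1 z.2)) /\
  measurable_fun setT (fun z : mR * mR => Im (f z.1 z.2)).

Lemma cmeasurable2_mul f g : cmeasurable2 f -> cmeasurable2 g ->
  cmeasurable2 (fun x y => f x y * g x y).
Proof.
move=> [fr fi] [gr gi]; split.
- under eq_fun do rewrite Re_mul; apply: measurable_funB; exact: measurable_funM.
- under eq_fun do rewrite Im_mul; apply: measurable_funD; exact: measurable_funM.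
Qed.

Lemma cmeasurable2_1 (f : R -> R[i]) : cmeasurable setT f -> cmeasurable2 (fun x _ => f x).
Proof.
move=> [fr fi]; split.
- exact: (@measurableT_comp _ _ _ _ _ _ (fun x => Re (f x)) _ _ fr measurable_fst).
- exact: (@measurableT_comp _ _ _ _ _ _ (fun x => Im (f x)) _ _ fi measurable_fst).
Qed.

Lemma cmeasurable2_2 (f : R -> R[i]) : cmeasurable setT f -> cmeasurable2 (fun _ y => f y).
Proof.
move=> [fr fi]; split.
- exact: (@measurableT_comp _ _ _ _ _ _ (fun x => Re (f x)) _ _ fr measurable_snd).
- exact: (@measurableT_comp _ _ _ _ _ _ (fun x => Im (f x)) _ _ fi measurable_snd).
Qed.

Lemma cmeasurable2_normc f : cmeasurable2 f ->
  measurable_fun setT (fun z : mR * mR => normc (f z.1 z.2)).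
Proof.
move=> [fr fi].
rewrite (_ : (fun _ => _) = (fun z : mR * mR =>
    Num.sqrt (Re (f z.1 z.2) ^+ 2 + Im (f z.1 z.2) ^+ 2))).
  apply: (@measurableT_comp _ _ _ _ _ _ (@Num.sqrt R)).
    exact: (continuous_measurable_fun (@sqrt_continuous R)).
  by apply: measurable_funD; apply: measurable_funX.
by apply/funext => z; case: (f z.1 z.2).
Qed.

Lemma cfubini (D1 D2 : set R) (f : R -> R -> R[i]) : measurable D1 -> measurable D2 ->
  cmeasurable2 f ->
  (\int[mu]_(x in D1) \int[mu]_(y in D2) (normc (f x y))%:E < +oo)%E ->
  cintegral D1 (fun x => cintegral D2 (f x)) =
  cintegral D2 (fun y => cintegral D1 (fun x => f x y)).
Proof.
move=> mD1 mD2 mf ff.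
have mn := cmeasurable2_normc mf.
have le (p : R[i] -> R) : (forall z, `|p z| <= normc z) ->
   measurable_fun setT (fun z : mR * mR => p (f z.1 z.2)) ->
   (\int[mu]_(x in D1) \int[mu]_(y in D2) `|p (f x y)|%:E < +oo)%E.
  move=> pn mp; apply: le_lt_trans ff.
  have ind (g : R -> R -> R) : (forall x y, 0 <= g x y) ->
     measurable_fun setT (fun z : mR * mR => g z.1 z.2) ->
     measurable_fun D1 (fun x => \int[mu]_(y in D2) (g x y)%:E)%E.
    move=> g0 mg; apply: measurable_funTS.
    have -> : (fun x => \int[mu]_(y in D2) (g x y)%:E)%E =
        (fun x => \int[mu]_y (\1_D2 y * g x y)%:E)%E.
      apply/funext => x; rewrite integral_mkcond; apply: eq_integral => y _.
      by rewrite /patch indicE; case: ifP; rewrite ?mul1r ?mul0r.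
    apply: (measurable_fun_fubini_tonelli_F (m2 := mu)
      (fun z : mR * mR => (\1_D2 z.2 * g z.1 z.2)%:E)).
      apply/measurable_EFinP/measurable_funM => //.
      apply: (@measurableT_comp _ _ _ _ _ _ (\1_D2 : R -> R)); last exact: measurable_snd.
      exact: measurable_indic.
    by move=> z; rewrite lee_fin mulr_ge0 // indicE ler0n.
  apply: ge0_le_integral => //.
  - by move=> x _; apply: integral_ge0 => y _; rewrite lee_fin.
  - apply: (ind (fun x y => `|p (f x y)|)) => //.
    exact: (measurableT_comp (@normr_measurable R setT)).
  - by apply: (ind (fun x y => normc (f x y))) => // *; exact: normc_ge0.
  - move=> x _; have sec (g : R -> R -> R) :
      measurable_fun setT (fun z : mR * mR => g z.1 z.2) ->
      measurable_fun D2 (fun y => (g x y)%:E).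
      move=> mg; apply: measurable_funTS; apply/measurable_EFinP.
      exact: (measurable_fun_pair2 x mg).
    apply: ge0_le_integral => //.
    + by apply: (sec (fun x y => `|p (f x y)|)); exact: (measurableT_comp (@normr_measurable R setT)).
    + exact: (sec (fun x y => normc (f x y))).
    + by move=> y _; rewrite lee_fin.
apply: complexP.
- apply: (rfubini (h := fun x y => Re (f x y))) => //; first exact: mf.1.
  by apply: le mf.1 => z; exact: normRe_le.
- apply: (rfubini (h := fun x y => Im (f x y))) => //; first exact: mf.2.
  by apply: le mf.2 => z; exact: normIm_le.
Qed.

End ComplexFubini2.

Section HardyCharacterization.
Context (R : realType).
Local Notation mu := (@lebesgue_measure R).
Implicit Types (x y : L2line R) (g : R -> R[i]).
Local Notation H := (@hardy R).

Lemma cauchy_null_class g : inL2 g -> cauchy_null (L2repr (L2class g)) <-> cauchy_null g.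
Proof.
move=> gi; have gi' := L2reprP (L2class g).
have e p q : 0 < p -> cintegral setT (fun t => L2repr (L2class g) t * ck (- p) q t) =
    cintegral setT (fun t => g t * ck (- p) q t).
  move=> p0; have mc := @ck_measurable R (- p) q; apply: ae_eq_cintegral => //.
  - exact: cmeasurable_mul gi'.1 mc.
  - exact: cmeasurable_mul gi.1 mc.
  - by apply: ae_imp (L2repr_class gi) => t ->.
by split=> h p q p0; [rewrite -e|rewrite e] => //; exact: h.
Qed.

Lemma cauchy_null_dot x : cauchy_null (L2repr x) <->
  forall p q : R, 0 < p -> L2dot x (L2class (fun t => (ck (- p) q t)^*%C)) = 0.
Proof.
have e p q : 0 < p -> L2dot x (L2class (fun t => (ck (- p) q t)^*%C)) =
    cintegral setT (fun t => L2repr x t * ck (- p) q t).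
  move=> p0; have p0' : - p != 0 by rewrite oppr_eq0 gt_eqF.
  rewrite -[in LHS](L2classK x) dot_class; [|exact: L2reprP|].
    by apply: eq_cintegral => t _; rewrite conjcK.
  by apply: inL2_conj; exact: inL2_ck.
by split=> h p q p0; [rewrite e|rewrite -e] => //; exact: h.
Qed.

(** Conversely, orthogonality to the kernels with poles on the right says that the
    Cauchy integral equals the Poisson integral by [pkE]; so it is holomorphic, its
    norms on vertical lines are bounded, and it tends to g. *)
Theorem hardyP x : H x <-> cauchy_null (L2repr x).
Proof.
split; first exact: hardy_cauchy_null.
move=> gn; set g := L2repr x in gn; have gi : inL2 g := L2reprP x.
have FE (u v : R) : u < 2^-1 ->
    ((2 * pi)^-1)%:C * cauchy_ext g (u +i* v) = poisson (2^-1 - u) g v.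
  move=> u12; rewrite poissonE ?subr_gt0 // /cauchy_ext /= [cauchy_transform g (- _) _]gn ?subr_gt0 //.
  by rewrite subr0.
exists (fun z => ((2 * pi)^-1)%:C * cauchy_ext g z); split.
- move=> z /= z12; apply/derivable_cdiff; apply: cdiff_mul.
    by apply/derivable_cdiff; exact: derivable_cst.
  by apply: cauchy_ext_cdiff => //; rewrite lt_eqF.
- apply: (@le_lt_trans _ _ (sqint g)%:E); last exact: ltry.
  apply: ge_ereal_sup => _ [u /= u12 <-].
  have [Pi Ple] := poisson_contraction (d := 2^-1 - u) ltac:(by rewrite subr_gt0) gi.
  under eq_integral do rewrite FE //.
  by rewrite -sqintE // lee_fin.
- apply/cvg_L2P => e e0; have [d0 d00 hd] := poisson_goodT x e0.
  near=> u; have u12 : u < 2^-1 by near: u; exact: nbhs_left_lt.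
  rewrite nrmBC (_ : (fun v : R => _) = poisson (2^-1 - u) g); last first.
    by apply/funext => v; exact: FE.
  apply: hd; first by rewrite subr_gt0.
  rewrite ltrBlDr -ltrBlDl; near: u; apply: nbhs_left_gt.
  by rewrite ltrBlDr ltrDl.
Unshelve. all: end_near. Qed.

Lemma hardy_classP g : inL2 g -> H (L2class g) <-> cauchy_null g.
Proof. by move=> gi; rewrite hardyP cauchy_null_class. Qed.

(** Orthogonality to a family of vectors is a closed condition. *)
Theorem hardy_closed : closed_subspace H.
Proof.
have dotP x : H x <-> forall p q : R, 0 < p ->
    L2dot x (L2class (fun t => (ck (- p) q t)^*%C)) = 0.
  by rewrite hardyP cauchy_null_dot.
split.
- by apply/dotP => p q _; rewrite dot0l.
- move=> x y /dotP hx /dotP hy; apply/dotP => p q p0.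
  by rewrite dotDl hx // hy // addr0.
- by move=> a x /dotP hx; apply/dotP => p q p0; rewrite dotZl hx // mulr0.
- move=> u l hu ul; apply/dotP => p q p0; set k := L2class _.
  apply/eqP; rewrite -normc_eq0 eq_le normc_ge0 andbT.
  have h : nrm (u n - l) * nrm k @[n --> \oo] --> 0.
    by rewrite -(mul0r (nrm k)); apply: cvgMl.
  rewrite -(cvg_lim _ h) //; apply: limr_ge; first exact: cvgP h.
  near=> n; have /dotP/(_ p q p0) := hu n; rewrite -/k => un.
  rewrite (_ : L2dot l k = - L2dot (u n - l) k); last by rewrite dotBl un sub0r opprK.
  by rewrite normcN; exact: cauchy_schwarz.
Unshelve. all: end_near. Qed.

End HardyCharacterization.

Section HardyMultipliers.
Context (R : realType).
Local Notation mu := (@lebesgue_measure R).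
Implicit Types (x y : L2line R) (g : R -> R[i]).
Local Notation H := (@hardy R).

(** By [ck_sub], the product of two Cauchy kernels is a combination of them. *)
Lemma cauchy_null_mul_ck g (s q : R) : inL2 g -> cauchy_null g -> 0 < s ->
  cintegral setT (fun t => g t * ck s q t) = 0 ->
  cauchy_null (fun t => ck s q t * g t).
Proof.
move=> gi gn s0 gs p q' p0.
have s0' : s != 0 by rewrite gt_eqF.
have p0' : - p != 0 by rewrite oppr_eq0 gt_eqF.
have i1 := inL2_mul gi (inL2_ck q s0').
have i2 := inL2_mul gi (inL2_ck q' p0').
pose c : R[i] := (- p - s) +i* (q - q').
have c0 : c != 0 by rewrite eq_complex negb_and /= lt_eqF //; lra.
have : c * cintegral setT (fun t => ck s q t * g t * ck (- p) q' t) = 0.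
  rewrite -cintegralZ //.
    have -> : 0 = cintegral setT (fun t => g t * ck s q t) -
        cintegral setT (fun t => g t * ck (- p) q' t) by rewrite gs gn // subrr.
    rewrite -cintegralB //.
    apply: eq_cintegral => t _.
    transitivity (g t * (c * (ck s q t * ck (- p) q' t))); first by ring.
    by rewrite -ck_sub //; ring.
  apply: (eq_cintegrable _ _ (cintegrable_mul_bounded measurableT
     (ck_measurable s q) (fun t _ => normc_ck_le q t s0') i2)) => // t _.
  by rewrite mulrA.
by move/eqP; rewrite mulf_eq0 (negbTE c0) /= => /eqP.
Qed.

(** The functional that must vanish is the value of g at the pole. *)
Theorem hcompact_pole (s q : R) : 0 < s -> hcompact H (ck s q).
Proof.
move=> s0; have s0' : s != 0 by rewrite gt_eqF.
apply: (hcompact_rank1 (@hardy_closed R) (k := L2class (fun t => (ck s q t)^*%C))).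
  exact: bmul_ck.
move=> x /hardyP hx; have xi := L2reprP x.
rewrite -{1}(L2classK x) dot_class //; last by apply: inL2_conj; exact: inL2_ck.
under eq_cintegral do rewrite conjcK.
move=> gs; rewrite -(L2classK x) L2mul_class //; last exact: bmul_ck.
apply/hardy_classP; first by apply: bmul_inL2 => //; exact: bmul_ck.
exact: cauchy_null_mul_ck.
Qed.

End HardyMultipliers.

(** * Multipliers that preserve the Hardy space *)

Section ParametricIntegral.
Context (R : realType).
Local Notation mu := (@lebesgue_measure R).

Lemma ccont_cvg_seq (g : R -> R[i]) (t : R) (u : nat -> R) : ccont_at g t ->
  u n @[n --> \oo] --> t -> normc (g (u n) - g t) @[n --> \oo] --> 0.
Proof.
move=> [gr gi] ut.
have h : `|Re (g (u n)) - Re (g t)| + `|Im (g (u n)) - Im (g t)| @[n --> \oo] --> 0.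
  rewrite -[X in _ --> X]addr0; apply: cvgD; apply: cvg0_norm; apply/subr_cvg0.
    exact: (cvg_comp _ _ ut gr).
  exact: (cvg_comp _ _ ut gi).
apply: (@squeeze_cvgr _ _ _ _ (cst 0) _ _ _ _ _ h); last exact: cvg_cst.
near=> n; rewrite normc_ge0 /=; apply: le_trans (normc_le_ReIm _) _.
by rewrite Re_add Re_opp Im_add Im_opp.
Unshelve. all: end_near. Qed.

Lemma ccont_of_seq (g : R -> R[i]) (t : R) :
  (forall u : nat -> R, u n @[n --> \oo] --> t ->
    normc (g (u n) - g t) @[n --> \oo] --> 0) -> ccont_at g t.
Proof.
move=> h; split; apply/(@cvg_nbhsP _ R^o) => u ut; apply/subr_cvg0; apply: norm_cvg0.
- apply: (@squeeze_cvgr _ _ _ _ (cst 0) _ _ _ _ _ (h u ut)); last exact: cvg_cst.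
  by near=> n; rewrite normr_ge0 /= -Re_opp -Re_add normRe_le.
- apply: (@squeeze_cvgr _ _ _ _ (cst 0) _ _ _ _ _ (h u ut)); last exact: cvg_cst.
  by near=> n; rewrite normr_ge0 /= -Im_opp -Im_add normIm_le.
Unshelve. all: end_near. Qed.

Lemma cintegral_param_ccont (D : set R) (f : R -> R -> R[i]) (g : R -> R) t :
  measurable D -> (forall t, cmeasurable D (f t)) ->
  (forall x, D x -> ccont_at (fun t => f t x) t) ->
  mu.-integrable D (EFin \o g) -> (forall t x, D x -> normc (f t x) <= g x) ->
  ccont_at (fun t => cintegral D (f t)) t.
Proof.
move=> mD mf cf ig fg; apply: ccont_of_seq => u ut.
apply: (proj2 (cdominated (f_ := fun n => f (u n)) mD _ _ ig _)) => //.
- by move=> x Dx; exact: ccont_cvg_seq (cf x Dx) ut.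
- by move=> n x; exact: fg.
Qed.

End ParametricIntegral.

Section ComplexExponential.
Context (R : realType).
Implicit Types (z w : R[i]).

Lemma cexp0 : cexp (0 : R[i]) = 1.
Proof. by rewrite /cexp /= expR0 cos0 sin0 mulr0 mulr1. Qed.

Lemma cexpD z w : cexp (z + w) = cexp z * cexp w.
Proof.
rewrite /cexp Re_add Im_add expRD cosD sinD.
by apply: complexP; rewrite /= ; ring.
Qed.

Lemma normc_cexp z : normc (cexp z) = expR (Re z).
Proof.
apply/eqP; rewrite -(eqrXn2 (ltn0Sn 1)) ?normc_ge0 ?expR_ge0 // normc_sqr /cexp /=.
by rewrite !exprMn -mulrDr cos2Dsin2 mulr1.
Qed.

Lemma cexp_neq0 z : cexp z != 0.
Proof. by rewrite -normc_gt0 normc_cexp expR_gt0. Qed.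

Lemma cexp_conj z : cexp z^*%C = (cexp z)^*%C.
Proof. by rewrite /cexp Re_conj Im_conj cosN sinN mulrN. Qed.

Lemma cexp_real (a : R) : cexp a%:C = (expR a)%:C.
Proof. by rewrite /cexp /= cos0 sin0 mulr1 mulr0. Qed.

Lemma cexpN z : cexp (- z) = (cexp z)^-1.
Proof.
by apply: (mulfI (cexp_neq0 z)); rewrite -cexpD subrr cexp0 divff // cexp_neq0.
Qed.

Let derive_eps (f : R -> R) (l e : R) : is_derive (0 : R) 1 f l -> 0 < e ->
  exists2 d : R, 0 < d & forall a, `|a| < d -> `|f a - f 0 - l * a| <= e * `|a|.
Proof.
move=> [df fl] e0; have /cvgrPdist_lt /(_ _ e0) := df.
rewrite -/(derive f 0 1) fl => -[d /= d0 hd]; exists d => // a ad.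
have [->|a0] := eqVneq a 0; first by rewrite subrr mulr0 subr0 normr0 mulr0.
have := hd a; rewrite /ball /= sub0r normrN => /(_ ad a0) /ltW.
rewrite (quotient_remainder l (f a - f 0) a0) addr0 [a *: 1]mulr1.
by rewrite normrN normrM => h; rewrite ler_wpM2r.
Qed.

(** By the addition formula it suffices to differentiate at 0, where the components
    are controlled by the derivatives of exp, cos and sin. *)
Lemma cdiff_cexp z : cdiff (@cexp R) z.
Proof.
suff h0 : forall e : R, 0 < e -> exists2 d : R, 0 < d & forall h : R[i],
    normc h < d -> normc (cexp h - 1 - h) <= e * normc h.
  exists (cexp z) => e e0; have nz : 0 < normc (cexp z) by rewrite normc_gt0 cexp_neq0.
  have [d d0 hd] := h0 (e / normc (cexp z)) (divr_gt0 e0 nz).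
  exists d => // w wz; rewrite -{1}(subrK z w) cexpD.
  have -> : cexp (w - z) * cexp z - cexp z - cexp z * (w - z) =
     cexp z * (cexp (w - z) - 1 - (w - z)) by ring.
  rewrite normcM; apply: le_trans (ler_wpM2l (ltW nz) (hd _ wz)) _.
  by rewrite mulrA mulrCA divff ?gt_eqF // mulr1.
move=> e e0; have e4 : 0 < e / 8 by rewrite divr_gt0.
have [d1 d10 h1] := derive_eps (is_derive_expR 0) e4.
have [d2 d20 h2] := derive_eps (is_derive_cos 0) e4.
have [d3 d30 h3] := derive_eps (is_derive_sin 0) e4.
exists (Num.min (Num.min d1 d2) (Num.min d3 (Num.min 1 (e / 8)))).
  by rewrite !lt_min d10 d20 d30 e4 ltr01.
move=> h; rewrite !lt_min => /andP[/andP[n1 n2] /andP[n3 /andP[n4 n5]]].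
have [ha hb] := (normRe_le h, normIm_le h).
set a := Re h in ha; set b := Im h in hb; set n := normc h in n1 n2 n3 n4 n5 ha hb *.
have := h1 a (le_lt_trans ha n1); have := h2 b (le_lt_trans hb n2).
have := h3 b (le_lt_trans hb n3).
rewrite expR0 cos0 sin0 !(oppr0, mul0r, addr0) !mul1r => s3 s2 s1.
have C1 : `|cos b| <= 1 by rewrite ler_norml cos_geN1 cos_le1.
have S1 : `|sin b| <= 1 by rewrite ler_norml sin_geN1 sin_le1.
have a1 : `|1 + a| <= 2.
  apply: le_trans (ler_normD _ _) _; rewrite normr1.
  by have := le_trans ha (ltW n4); lra.
have ab : `|a * b| <= e / 8 * n.
  by rewrite normrM; apply: ler_pM => //; exact: le_trans ha (ltW n5).
have prod (u v U V : R) : `|u| <= U -> `|v| <= V -> `|u * v| <= U * V.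
  by move=> hu hv; rewrite normrM; apply: ler_pM.
have n0 : 0 <= n := normc_ge0 h.
have sa : e / 8 * `|a| <= e / 8 * n by rewrite ler_wpM2l // ltW.
have sb : e / 8 * `|b| <= e / 8 * n by rewrite ler_wpM2l // ltW.
apply: le_trans (normc_le_ReIm _) _.
rewrite !Re_add !Im_add !Re_opp !Im_opp /cexp /= -/a -/b subr0.
have r1 := prod _ _ _ _ (le_trans s1 sa) C1.
have r2 := prod _ _ _ _ a1 (le_trans s2 sb).
have r3 := prod _ _ _ _ (le_trans s1 sa) S1.
have r4 := prod _ _ _ _ a1 (le_trans s3 sb).
rewrite (_ : expR a * cos b - 1 - a = (expR a - 1 - a) * cos b + (1 + a) * (cos b - 1)); last by ring.
rewrite (_ : expR a * sin b - b =
  (expR a - 1 - a) * sin b + ((1 + a) * (sin b - b) + a * b)); last by ring.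
have t1 := ler_normD ((expR a - 1 - a) * cos b) ((1 + a) * (cos b - 1)).
have t2 := ler_normD ((expR a - 1 - a) * sin b) ((1 + a) * (sin b - b) + a * b).
have t3 := ler_normD ((1 + a) * (sin b - b)) (a * b).
have en : 0 <= e * n by rewrite mulr_ge0 // ltW.
move: r1 r2 r3 r4 ab t1 t2 t3; rewrite mulr1 (_ : e / 8 * n = e * n / 8); last by ring.
by set X := e * n in en *; lra.
Qed.

Lemma cdiff_comp (f g : R[i] -> R[i]) z : cdiff f z -> cdiff g (f z) ->
  cdiff (fun w => g (f w)) z.
Proof.
move=> /derivable_cdiff/derivable1_diffP df /derivable_cdiff/derivable1_diffP dg.
apply/derivable_cdiff; apply/derivable1_diffP; exact: (differentiable_comp df dg).
Qed.

Lemma cdiff_poly2 (a b c z : R[i]) : cdiff (fun w => a * (w * w) + b * w + c) z.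
Proof.
have di : derivable (id : R[i]^o -> R[i]^o) z 1 by exact: derivable_id.
have dc (k : R[i]) : derivable ((fun=> k) : R[i]^o -> R[i]^o) z 1 by exact: derivable_cst.
apply/derivable_cdiff; apply: (derivableD _ (dc c)); apply: derivableD.
  exact: (derivableM (dc a) (derivableM di di)).
exact: (derivableM (dc b) di).
Qed.

(** The character t |-> exp(i s t); on the critical line, x^z is a multiple of it for
    s = ln x. *)
Definition ei (s t : R) : R[i] := cexp (0 +i* (s * t)).

Lemma normc_ei s t : normc (ei s t) = 1.
Proof. by rewrite /ei normc_cexp expR0. Qed.

Lemma eiD s s' t : ei (s + s') t = ei s t * ei s' t.
Proof. by rewrite /ei -cexpD mulrDl; congr cexp; apply: complexP => /=; rewrite ?addr0. Qed.

Lemma ei0 t : ei 0 t = 1.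
Proof. by rewrite /ei mul0r cexp0. Qed.

Lemma ei_ccont s t : ccont_at (ei s) t.
Proof.
have cm : {for t, continuous (fun t => s * t)} by apply: cvgMr; exact: cvg_id.
split; rewrite /ei /cexp /= expR0.
- by apply: cvgMr; apply: (cvg_comp _ _ cm); exact: continuous_cos.
- by apply: cvgMr; apply: (cvg_comp _ _ cm); exact: continuous_sin.
Qed.

Lemma bmul_ei s : bounded_multiplier (ei s).
Proof.
split; first by apply: ccont_cmeasurable => t; exact: ei_ccont.
by exists 1 => t; rewrite normc_ei.
Qed.

End ComplexExponential.

Section HardyTranslates.
Context (R : realType).
Local Notation mu := (@lebesgue_measure R).
Implicit Types (x y : L2line R) (g : R -> R[i]).
Local Notation H := (@hardy R).

Lemma nrm_L2mul_ei (s : R) x : nrm (L2mul (ei s) x) <= nrm x.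
Proof.
rewrite -[leRHS]mul1r; apply: nrm_L2mul (bmul_ei s).1 _ => t.
by rewrite normc_ei.
Qed.

(** Multiply the holomorphic extension by exp(s (z - 1/2)), of modulus at most one on
    the half-plane. *)
Theorem hardy_ei (s : R) x : 0 <= s -> H x -> H (L2mul (ei s) x).
Proof.
move=> s0 [F [hF bF Fx]].
have [C hC] := hardy_bounded_slices hF bF.
pose E (z : R[i]) := cexp (s%:C * z + (- (s / 2))%:C).
have EE (u v : R) : E (u +i* v) = (expR (s * (u - 2^-1)))%:C * ei s v.
  rewrite /E -cexp_real /ei -cexpD; congr cexp.
  by apply: complexP => /=; ring.
have E1 (u : R) : u < 2^-1 -> `|expR (s * (u - 2^-1))| <= 1.
  move=> u12; rewrite ger0_norm ?expR_ge0 // -[leRHS]expR0 ler_expR.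
  by apply: mulr_ge0_le0 => //; rewrite subr_le0 ltW.
have EF (u v : R) : normc (F (u +i* v) * E (u +i* v)) =
    `|expR (s * (u - 2^-1))| * normc (F (u +i* v)).
  by rewrite EE !normcM normcC normc_ei mulr1 mulrC.
exists (fun z => F z * E z); split.
- move=> z z12; apply/derivable_cdiff; apply: cdiff_mul.
    by apply/derivable_cdiff; exact: hF.
  have da : cdiff (fun w => s%:C * w + (- (s / 2))%:C) z.
    rewrite (_ : (fun w => _) = (fun w => 0 * (w * w) + s%:C * w + (- (s / 2))%:C)).
      exact: cdiff_poly2.
    by apply/funext => w; rewrite mul0r add0r.
  exact: (cdiff_comp da (cdiff_cexp _)).
- apply: (@le_lt_trans _ _ C%:E); last exact: ltry.
  apply: ge_ereal_sup => _ [u /= u12 <-].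
  have [fi fC] := hC u u12.
  apply: (@le_trans _ _ (\int[mu]_y (normc (F (u +i* y)) ^+ 2)%:E)%E).
    apply: ge0_le_integral => //.
    + by move=> v _; rewrite lee_fin sqr_ge0.
    + apply/measurable_EFinP/measurable_funX.
      under eq_fun do rewrite EF.
      by apply: measurable_funM => //; apply: measurable_normc' => //; exact: fi.1.
    + by apply/measurable_EFinP/measurable_funX; apply: measurable_normc' => //; exact: fi.1.
    + move=> v _; rewrite lee_fin ler_pXn2r ?nnegrE ?normc_ge0 // EF.
      by rewrite ler_piMl ?normc_ge0 ?E1.
  by rewrite -sqintE // lee_fin.
- apply/cvg_L2P => e e0.
  have xi := L2reprP x.
  have e2 : 0 < e / 2 by rewrite divr_gt0.
  have n1 : \forall u \near (2^-1 : R)^'-,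
      nrm (x - L2class (fun y : R => F (u +i* y))) < e / 2.
    exact: (proj1 (cvg_L2P _ _) Fx _ e2).
  have c0 : 0 < e / 2 / (nrm x + 1) by rewrite divr_gt0 // ltr_wpDl ?nrm_ge0.
  have n2 : \forall u \near (2^-1 : R)^'-, `|1 - expR (s * (u - 2^-1))| < e / 2 / (nrm x + 1).
    have h : s * (u - 2^-1) @[u --> (2^-1 : R)] --> s * (2^-1 - 2^-1).
      by apply: cvgMr; apply: cvgB; [exact: cvg_id|exact: cvg_cst].
    rewrite subrr mulr0 in h.
    have := cvg_comp _ _ h (@continuous_expR R 0); rewrite expR0.
    by move=> /cvg_at_left_filter /cvgrPdist_lt; apply.
  near=> u; have u12 : u < 2^-1 by near: u; exact: nbhs_left_lt.
  have [fi fC] := hC u u12.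
  set X := L2class (fun y : R => F (u +i* y)).
  pose c := expR (s * (u - 2^-1)).
  have -> : L2class (fun v : R => F (u +i* v) * E (u +i* v)) = L2mul (ei s) (c%:C *: X).
    rewrite L2classZ // L2mul_class //; [|exact: bmul_ei|exact: inL2Z].
    by congr L2class; apply/funext => v; rewrite EE; ring.
  rewrite -L2mul_subr; last exact: bmul_ei.
  apply: le_lt_trans (nrm_L2mul_ei _ _) _.
  have -> : x - c%:C *: X = c%:C *: (x - X) + (1 - c)%:C *: x.
    by rewrite rmorphB /= scalerBl scale1r scalerBr [RHS]addrC addrA subrK.
  apply: le_lt_trans (nrmD _ _) _; rewrite !nrmZ !normcC.
  have h1 : nrm (x - X) < e / 2 by rewrite /X; near: u; exact: n1.
  have h2 : `|1 - c| < e / 2 / (nrm x + 1) by rewrite /c; near: u; exact: n2.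
  have h3 : `|c| * nrm (x - X) <= nrm (x - X) by rewrite ler_piMl ?nrm_ge0 ?E1.
  have h4 : `|1 - c| * nrm x <= e / 2.
    apply: (@le_trans _ _ (`|1 - c| * (nrm x + 1))); first by rewrite ler_wpM2l // lerDl.
    by rewrite -ler_pdivlMr ?ltr_wpDl ?nrm_ge0 // ltW.
  by lra.
Unshelve. all: end_near. Qed.

End HardyTranslates.

Section ProductFubini.
Context (R : realType).
Local Notation mu := (@lebesgue_measure R).

(** The form of Fubini's theorem used below: the integrand is dominated by a product
    of integrable functions of one variable. *)
Lemma cfubini_dominated (D1 D2 : set R) (f : R -> R -> R[i]) (a b : R -> R) :
  measurable D1 -> measurable D2 -> cmeasurable2 f ->
  (forall x, D1 x -> 0 <= a x) ->
  (forall x y, D1 x -> D2 y -> normc (f x y) <= a x * b y) ->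
  mu.-integrable D1 (EFin \o a) -> mu.-integrable D2 (EFin \o b) ->
  cintegral D1 (fun x => cintegral D2 (f x)) =
  cintegral D2 (fun y => cintegral D1 (fun x => f x y)).
Proof.
move=> mD1 mD2 mf a0 fab ia ib; apply: cfubini => //.
have mn := cmeasurable2_normc mf.
have inner x : D1 x -> (\int[mu]_(y in D2) (normc (f x y))%:E <=
    (a x * \int[mu]_(y in D2) `|b y|)%:E)%E.
  move=> Dx; have iab := integrable_scaler (a x) mD2 (integrable_norm ib).
  apply: (@le_trans _ _ (\int[mu]_(y in D2) (a x * `|b y|)%:E)%E).
    apply: ge0_le_integral => //.
    - by move=> y _; rewrite lee_fin normc_ge0.
    - apply: measurable_funTS; apply/measurable_EFinP.
      exact: (measurableT_comp mn (pair1_measurable x)).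
    - exact: measurable_int iab.
    - move=> y Dy; rewrite lee_fin; apply: le_trans (fab x y Dx Dy) _.
      by rewrite ler_wpM2l ?a0 ?ler_norm.
  rewrite (_ : (\int[mu]_(y in D2) (a x * `|b y|)%:E)%E =
     (a x * \int[mu]_(y in D2) `|b y|)%:E) //.
  under eq_integral do rewrite EFinM.
  rewrite integralZl //; last exact: (integrable_norm ib).
  by rewrite EFinM /Rintegral fineK //; apply: integrable_fin_num => //; exact: (integrable_norm ib).
set B := \int[mu]_(y in D2) `|b y| in inner.
have iaB := integrable_scaler B mD1 ia.
apply: (@le_lt_trans _ _ (\int[mu]_(x in D1) (B * a x)%:E)%E).
  have B0 : 0 <= B by apply: Rintegral_ge0 => y _.
  have mi : measurable_fun D1 (fun x => \int[mu]_(y in D2) (normc (f x y))%:E)%E.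
    apply: measurable_funTS.
    have -> : (fun x => \int[mu]_(y in D2) (normc (f x y))%:E)%E =
        (fun x => \int[mu]_y (\1_D2 y * normc (f x y))%:E)%E.
      apply/funext => x; rewrite integral_mkcond; apply: eq_integral => y _.
      by rewrite /patch indicE; case: ifP; rewrite ?mul1r ?mul0r.
    apply: (measurable_fun_fubini_tonelli_F (m2 := mu)
      (fun z : measurableTypeR R * measurableTypeR R => (\1_D2 z.2 * normc (f z.1 z.2))%:E)).
      apply/measurable_EFinP/measurable_funM => //.
      apply: (@measurableT_comp _ _ _ _ _ _ (\1_D2 : R -> R)); last exact: measurable_snd.
      exact: measurable_indic.
    by move=> z; rewrite lee_fin mulr_ge0 ?normc_ge0 // indicE ler0n.
  apply: ge0_le_integral => //.
  - by move=> x _; apply: integral_ge0 => y _; rewrite lee_fin normc_ge0.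
  - exact: measurable_int iaB.
  - by move=> x Dx; rewrite mulrC inner.
have /integrableP[_ fin] := iaB.
apply: le_lt_trans fin; apply: ge0_le_integral => //.
- by move=> x Dx; rewrite lee_fin mulr_ge0 ?a0 //; apply: Rintegral_ge0.
- exact: measurable_int iaB.
- by apply: measurableT_comp => //; exact: measurable_int iaB.
- by move=> x Dx; exact: lee_abs.
Qed.

End ProductFubini.

Section CharacterAverages.
Context (R : realType).
Local Notation mu := (@lebesgue_measure R).
Local Notation H := (@hardy R).

Lemma ei_measurable2 : cmeasurable2 (fun t x : R => ei (ln x) t).
Proof.
have m1 : measurable_fun setT (fun z : measurableTypeR R * measurableTypeR R => ln z.2 * z.1).
  apply: measurable_funM; last exact: measurable_fst.
  by apply: measurableT_comp; [exact: measurable_ln|exact: measurable_snd].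
have comp (f : R -> R) : continuous f -> measurable_fun setT
   (fun z : measurableTypeR R * measurableTypeR R => f (ln z.2 * z.1)).
  by move=> cf; apply: measurableT_comp m1; exact: continuous_measurable_fun.
split; rewrite /ei /cexp /= expR0.
- by apply: measurable_funM => //; apply: comp; exact: continuous_cos.
- by apply: measurable_funM => //; apply: comp; exact: continuous_sin.
Qed.

Context (D : set R) (k : R -> R).
Hypotheses (mD : measurable D) (D1 : forall x, D x -> 1 <= x).
Hypotheses (mk : measurable_fun setT k) (ik : mu.-integrable D (EFin \o k)).

(** On the critical line, the integral of k(x) x^(z - 1/2) over D. *)
Definition char_average (t : R) : R[i] := cintegral D (fun x => (k x)%:C * ei (ln x) t).

Lemma char_average_term t : cintegrable D (fun x => (k x)%:C * ei (ln x) t).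
Proof.
apply: le_cintegrable (integrable_norm ik) => //.
- apply: cmeasurable_mul; first by apply: cmeasurable_real; exact: measurable_funTS.
  apply: (cmeasurableS measurableT) => //; split.
    exact: (measurableT_comp ei_measurable2.1 (pair1_measurable t)).
  exact: (measurableT_comp ei_measurable2.2 (pair1_measurable t)).
- by move=> x _; rewrite normcM normcC normc_ei mulr1.
Qed.

Lemma bmul_char_average : bounded_multiplier char_average.
Proof.
split.
  apply: ccont_cmeasurable => t.
  apply: (cintegral_param_ccont (g := fun x => `|k x|)) => //.
  - by move=> s; exact: (char_average_term s).1.
  - by move=> x _; apply: ccont_mul; [exact: ccont_cst|exact: ei_ccont].
  - exact: integrable_norm ik.
  - by move=> s x _; rewrite normcM normcC normc_ei mulr1.
exists (\int[mu]_(x in D) `|k x|) => t.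
apply: le_trans (normc_cintegral mD (char_average_term t)) _.
rewrite le_eqVlt; apply/orP; left; apply/eqP; apply: eq_Rintegral => x _.
by rewrite normcM normcC normc_ei mulr1.
Qed.

(** By Fubini's theorem the moments of K g are averages of moments of x^(it) g. *)
Lemma hardy_char_average g : inL2 g -> cauchy_null g ->
  cauchy_null (fun t => char_average t * g t).
Proof.
move=> gi gn p q p0; have p0' : - p != 0 by rewrite oppr_eq0 gt_eqF.
have Gi := inL2_mul gi (inL2_ck q p0').
set G := (fun t => g t * ck (- p) q t) in Gi.
transitivity (cintegral setT (fun t => cintegral D (fun x => G t * ((k x)%:C * ei (ln x) t)))).
  apply: eq_cintegral => t _; rewrite cintegralZ //; last exact: char_average_term.
  by rewrite /G -/(char_average t); ring.
rewrite (cfubini_dominated (a := fun t => normc (G t)) (b := fun x => `|k x|)) //.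
- transitivity (cintegral D (fun _ : R => 0 : R[i])); last exact: cintegral0.
  apply: eq_cintegral => x Dx.
  have h : cauchy_null (fun t => ei (ln x) t * g t).
    have eg := bmul_inL2 (bmul_ei (ln x)) gi.
    apply/(hardy_classP eg); rewrite -L2mul_class //; last exact: bmul_ei.
    by apply: hardy_ei; [apply: ln_ge0; exact: D1|exact/hardy_classP].
  transitivity ((k x)%:C * cintegral setT (fun t => ei (ln x) t * g t * ck (- p) q t)).
    rewrite -cintegralZ //.
      by apply: eq_cintegral => t _; rewrite /G; ring.
    apply: inL2_mul; [exact: bmul_inL2 (bmul_ei _) gi|exact: inL2_ck].
  by rewrite h // mulr0.
- apply: cmeasurable2_mul; first exact: cmeasurable2_1 Gi.1.
  apply: cmeasurable2_mul; last exact: ei_measurable2.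
  by apply: cmeasurable2_2; exact: cmeasurable_real.
- by move=> t _; exact: normc_ge0.
- by move=> t x _ _; rewrite !normcM normcC normc_ei mulr1.
- exact: cintegrable_normc.
- exact: integrable_norm ik.
Qed.

(** The factor 1/2 - it is unbounded, so A g is tested first against Cauchy kernels
    multiplied by r_a(t) = a / (a - it), which tends boundedly to 1 when a tends to
    infinity.  The product (1/2 - it) r_a is bounded, and partial fractions write the
    moment as a combination of moments of g and of K g. *)
Theorem hardy_affine_average (A : R -> R[i]) (c : R[i]) x : bounded_multiplier A ->
  (forall t, A t = c + (2^-1 +i* (- t)) * char_average t) -> H x -> H (L2mul A x).
Proof.
move=> bA AE /hardyP gn; have gi := L2reprP x; set g := L2repr x in gn gi.
have bK := bmul_char_average; set K := char_average in bK AE.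
apply/hardy_classP; first exact: bmul_inL2.
have Kgn := hardy_char_average gi gn; have Kgi := bmul_inL2 bK gi.
have Agi := bmul_inL2 bA gi.
move=> p q p0; have p0' : - p != 0 by rewrite oppr_eq0 gt_eqF.
have Ii := inL2_mul Agi (inL2_ck q p0').
(* parameters that tend to infinity and differ from p, so that the two poles below
   are distinct *)
pose a n : R := p + 1 + n%:R.
have a0 n : 0 < a n by rewrite /a -addrA addr_gt0 // addr_gt0.
have a0' n : - a n != 0 by rewrite oppr_eq0 gt_eqF.
pose r n t := (- a n)%:C * ck (- a n) 0 t.
have r1 n t : normc (r n t) <= 1.
  rewrite /r normcM normcC; have := normc_ck_le 0 t (a0' n).
  by rewrite -(ler_pM2l (_ : 0 < `|- a n|)) ?normr_gt0 // divff // normr_eq0.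
have rlim t : normc (r n t * (A t * g t * ck (- p) q t) - A t * g t * ck (- p) q t)
    @[n --> \oo] --> 0.
  set F := A t * g t * _.
  have rt n : normc (r n t - 1) <= `|t| * (n%:R + 1)^-1.
    have -> : r n t - 1 = - (0 +i* t) * ck (- a n) 0 t.
      have n0 := ck_neq0 0 t (a0' n); rewrite /r /ck.
      apply: (mulIf n0); rewrite mulrBl mul1r -!mulrA !mulVf // !mulr1.
      by apply: complexP => /=; ring.
    rewrite normcM normcN (_ : normc (0 +i* t) = `|t|); last first.
      by rewrite /normc expr0n add0r sqrtr_sqr.
    apply: ler_wpM2l => //; apply: le_trans (normc_ck_le 0 t (a0' n)) _.
    rewrite normrN gtr0_norm // lef_pV2 ?posrE // ?ltr_wpDl ?ler0n //.
    by rewrite /a; lra.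
  apply: (@squeeze_cvgr _ _ _ _ (cst 0) (fun n : nat => `|t| * normc F * n.+1%:R^-1));
    last 2 first.
  - exact: cvg_cst.
  - rewrite -[X in _ --> X](mulr0 (`|t| * normc F)); apply: cvgMr.
    exact: (@cvg_harmonic R).
  near=> n; rewrite normc_ge0 /=.
  have -> : r n t * F - F = (r n t - 1) * F by ring.
  by rewrite normcM mulrAC -natr1; apply: ler_wpM2r; [exact: normc_ge0|exact: rt].
have bd n t : setT t -> normc (r n t * (A t * g t * ck (- p) q t)) <=
    normc (A t * g t * ck (- p) q t).
  by move=> _; rewrite normcM ler_piMl ?normc_ge0.
have [_ lim] := cdominated (D := setT) (f_ := fun n t => r n t * (A t * g t * ck (- p) q t))
  (f := fun t => A t * g t * ck (- p) q t) (g := fun t => normc (A t * g t * ck (- p) q t))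
  measurableT
  (fun n => cmeasurable_mul (cmeasurable_mul (cmeasurable_cst _ _) (ck_measurable (- a n) 0)) Ii.1)
  (fun t _ => rlim t) (cintegrable_normc measurableT Ii)
  bd.
apply/eqP; rewrite -normc_eq0; apply/eqP.
have z n : cintegral setT (fun t => r n t * (A t * g t * ck (- p) q t)) = 0.
  pose d : R[i] := (- p - - a n) +i* (0 - q).
  have d0 : d != 0.
    by rewrite eq_complex negb_and /= gt_eqF // /a; have := ler0n R n; lra.
  have nz (f : R -> R[i]) : inL2 f -> cauchy_null f ->
      cintegral setT (fun t => f t * (ck (- a n) 0 t - ck (- p) q t)) = 0 /\
      cintegrable setT (fun t => f t * (ck (- a n) 0 t - ck (- p) q t)).
    move=> fi fn; have i1 := inL2_mul fi (inL2_ck 0 (a0' n)).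
    have i2 := inL2_mul fi (inL2_ck q p0'); split.
      under eq_cintegral do rewrite mulrBr.
      by rewrite cintegralB // !fn // subrr.
    apply: eq_cintegrable (cintegrable_sub measurableT i1 i2) => // t _.
    by rewrite mulrBr.
  have [z1 i1] := nz _ gi gn; have [z2 i2] := nz _ Kgi Kgn.
  have i3 := inL2_mul Kgi (inL2_ck q p0').
  pose c1 := (- a n)%:C * c / d; pose c2 := (- a n)%:C * (2^-1 - a n)%:C / d.
  transitivity (cintegral setT (fun t => c1 * (g t * (ck (- a n) 0 t - ck (- p) q t)) +
     (c2 * (K t * g t * (ck (- a n) 0 t - ck (- p) q t)) +
      (a n)%:C * (K t * g t * ck (- p) q t)))).
    apply: eq_cintegral => t _.
    rewrite ck_sub // -/d /r AE.
    have n0 := ck_neq0 0 t (a0' n).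
    have e : (2^-1 +i* (- t)) * ck (- a n) 0 t = -1 + (2^-1 - a n)%:C * ck (- a n) 0 t.
      rewrite /ck; apply: (mulIf n0); rewrite mulrDl -!mulrA mulVf // !mulr1.
      by apply: complexP => /=; ring.
    rewrite /c1 /c2; move: e.
    set u := 2^-1 +i* - t; set v := ck (- a n) 0 t; set w := ck (- p) q t => e.
    transitivity ((- a n)%:C * g t * w * (c * v + (u * v) * K t)); first by ring.
    rewrite e rmorphN /=; move: (K t) (g t) => kt gt.
    rewrite (_ : _ / d * (gt * (d * (v * w))) = - (a n)%:C * c * (gt * (v * w))); last by field.
    rewrite (_ : _ / d * (kt * gt * (d * (v * w))) =
      - (a n)%:C * (2^-1 - a n)%:C * (kt * gt * (v * w))); last by field.
    by ring.
  rewrite cintegralD //; last 2 first.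
  - exact: cintegrableZ.
  - by apply: cintegrable_add => //; exact: cintegrableZ.
  rewrite cintegralD //; [|exact: cintegrableZ..].
  by rewrite !cintegralZ // z1 z2 Kgn // !mulr0 !addr0.
set I := cintegral setT _ in lim *.
have E : (fun n => normc (cintegral setT (fun t => r n t * (A t * g t * ck (- p) q t)) - I)) =
    (fun _ : nat => normc I).
  by apply/funext => n; rewrite z sub0r normcN.
rewrite E in lim.
by move/cvg_lim: lim => <- //; rewrite lim_cst.
Unshelve. all: end_near. Qed.

End CharacterAverages.

(** * Complex powers and the fundamental theorem of calculus *)

Section ComplexDerivative.
Context (R : realType).
Local Notation mu := (@lebesgue_measure R).
Implicit Types (F G f g : R -> R[i]) (x a b : R) (l k w z : R[i]).

(** Differentiability of a complex function of a real variable, componentwise. *)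
Definition cder F x l : Prop :=
  is_derive x (1 : R) (fun t => Re (F t)) (Re l) /\
  is_derive x (1 : R) (fun t => Im (F t)) (Im l).

Lemma cder_eq F x l k : cder F x l -> l = k -> cder F x k.
Proof. by move=> h <-. Qed.

Lemma cder_mul F G x l k : cder F x l -> cder G x k ->
  cder (fun t => F t * G t) x (l * G x + F x * k).
Proof.
move=> [F1 F2] [G1 G2]; split.
- rewrite (_ : (fun t => _) = (fun t => Re (F t)) * (fun t => Re (G t)) -
     (fun t => Im (F t)) * (fun t => Im (G t))); last first.
    by apply/funext => t; rewrite Re_mul.
  apply: is_derive_eq; rewrite !Re_add !Re_mul /GRing.scale /=; ring.
- rewrite (_ : (fun t => _) = (fun t => Re (F t)) * (fun t => Im (G t)) +
     (fun t => Im (F t)) * (fun t => Re (G t))); last first.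
    by apply/funext => t; rewrite Im_mul.
  apply: is_derive_eq; rewrite !Im_add !Im_mul /GRing.scale /=; ring.
Qed.

Lemma cder_real (f : R -> R) x (l : R) : is_derive x (1 : R) f l ->
  cder (fun t => (f t)%:C) x l%:C.
Proof. by move=> h; split => /=; [exact: h|exact: is_derive_cst]. Qed.

Lemma cder_cst w x : cder (fun=> w) x 0.
Proof. by split => /=; exact: is_derive_cst. Qed.

Lemma cder_cexp F x l : cder F x l -> cder (fun t => cexp (F t)) x (cexp (F x) * l).
Proof.
move=> [F1 F2]; rewrite /cexp; split => /=.
- rewrite (_ : (fun t => _) = (expR \o (fun t => Re (F t))) * (cos \o (fun t => Im (F t)))) //.
  have d1 := is_derive1_comp (is_derive_expR (Re (F x))) F1.
  have d2 := is_derive1_comp (is_derive_cos (Im (F x))) F2.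
  by apply: is_derive_eq; rewrite /GRing.scale /= Re_mul /=; ring.
- rewrite (_ : (fun t => _) = (expR \o (fun t => Re (F t))) * (sin \o (fun t => Im (F t)))) //.
  have d1 := is_derive1_comp (is_derive_expR (Re (F x))) F1.
  have d2 := is_derive1_comp (is_derive_sin (Im (F x))) F2.
  by apply: is_derive_eq; rewrite /GRing.scale /= Im_mul /=; ring.
Qed.

Lemma cder_ccont F x l : cder F x l -> ccont_at F x.
Proof.
by move=> [[d1 _] [d2 _]]; split; apply: differentiable_continuous; exact/derivable1_diffP.
Qed.

Lemma cFTC F f a b : a < b -> (forall x, a <= x <= b -> cder F x (f x)) ->
  (forall x, a <= x <= b -> ccont_at f x) -> cintegral `[a, b] f = F b - F a.
Proof.
move=> ab dF cf.
have part (p q : R -> R) :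
    (forall x, a <= x <= b -> is_derive x (1 : R) q (p x)) ->
    (forall x, a <= x <= b -> {for x, continuous p}) ->
    \int[mu]_(x in `[a, b]) p x = q b - q a.
  move=> dq cp.
  have cq x : a <= x <= b -> {for x, continuous q}.
    move=> /dq[d _]; apply: differentiable_continuous; exact/derivable1_diffP.
  rewrite /Rintegral (@continuous_FTC2 _ p q a b) //.
  - apply: continuous_in_subspaceT => x /set_mem /=; rewrite in_itv /=.
    exact: cp.
  - split.
    + by move=> x; rewrite in_itv /= => /andP[ax xb]; apply: ex_derive; apply: dq; rewrite !ltW.
    + by apply: cvg_at_right_filter; apply: cq; rewrite lexx ltW.
    + by apply: cvg_at_left_filter; apply: cq; rewrite lexx ltW.
  - move=> x; rewrite in_itv /= => /andP[ax xb]; rewrite derive1E.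
    by have /dq[_ ->] : a <= x <= b by rewrite !ltW.
apply: complexP; rewrite ?Re_add ?Re_opp ?Im_add ?Im_opp.
- by apply: (part _ (fun x => Re (F x))) => x hx; [exact: (dF x hx).1|exact: (cf x hx).1].
- by apply: (part _ (fun x => Im (F x))) => x hx; [exact: (dF x hx).2|exact: (cf x hx).2].
Qed.

(** Change of variables, for an increasing h of class C^1. *)
Lemma csubst (h h' : R -> R) f a b : a <= b ->
  {in `[a, b] &, {homo h : x y / x < y}} ->
  (forall x, is_derive x (1 : R) h (h' x)) -> continuous h' ->
  (forall x, h a <= x <= h b -> ccont_at f x) ->
  cintegral `[h a, h b] f = cintegral `[a, b] (fun x => (h' x)%:C * f (h x)).
Proof.
move=> ab hh dh ch cf.
have cq : continuous h.
  by move=> x; have [d _] := dh x; apply: differentiable_continuous; exact/derivable1_diffP.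
have h'E : derive1 h = h'.
  by apply/funext => x; rewrite derive1E; have [_ ->] := dh x.
have part (p : R -> R) : (forall x, h a <= x <= h b -> {for x, continuous p}) ->
    \int[mu]_(x in `[h a, h b]) p x = \int[mu]_(x in `[a, b]) (h' x * p (h x)).
  move=> cp.
  rewrite /Rintegral (@integration_by_substitution_increasing _ h p a b) // ?h'E.
  - by congr fine; apply: eq_integral => x _; rewrite mulrC.
  - by move=> x _; exact: ch.
  - by apply/cvg_ex; exists (h' a); apply: cvg_at_right_filter; exact: ch.
  - by apply/cvg_ex; exists (h' b); apply: cvg_at_left_filter; exact: ch.
  - split.
    + by move=> x _; have [] := dh x.
    + by apply: cvg_at_right_filter; apply: cq.
    + by apply: cvg_at_left_filter; apply: cq.
  - apply: continuous_in_subspaceT => x /set_mem /=; rewrite in_itv /=.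
    exact: cp.
apply: complexP => /=.
- transitivity (\int[mu]_(x in `[a, b]) (h' x * Re (f (h x)))).
    by apply: (part (fun x => Re (f x))) => x /cf[].
  by apply: eq_Rintegral => x _; rewrite Re_mul /= mul0r subr0.
- transitivity (\int[mu]_(x in `[a, b]) (h' x * Im (f (h x)))).
    by apply: (part (fun x => Im (f x))) => x /cf[].
  by apply: eq_Rintegral => x _; rewrite Im_mul /= mul0r addr0.
Qed.

End ComplexDerivative.

Section ComplexPowers.
Context (R : realType).
Implicit Types (a b x r : R) (w z : R[i]).

Lemma cpowD a z w : cpow a (z + w) = cpow a z * cpow a w.
Proof. by rewrite /cpow mulrDl cexpD. Qed.

Lemma cpow0 a : cpow a 0 = 1.
Proof. by rewrite /cpow mul0r cexp0. Qed.

Lemma cpow1l z : cpow 1 z = 1.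
Proof. by rewrite /cpow ln1 mulr0 cexp0. Qed.

Lemma cpow_neq0 a z : cpow a z != 0.
Proof. exact: cexp_neq0. Qed.

Lemma cpowN a z : cpow a (- z) = (cpow a z)^-1.
Proof. by rewrite /cpow mulNr cexpN. Qed.

Lemma cpowM a b z : 0 < a -> 0 < b -> cpow (a * b) z = cpow a z * cpow b z.
Proof. by move=> a0 b0; rewrite /cpow lnM ?posrE // rmorphD /= mulrDr cexpD. Qed.

Lemma cpow_real a r : 0 < a -> cpow a r%:C = (a `^ r)%:C.
Proof. by move=> a0; rewrite /cpow -rmorphM /= cexp_real /powR gt_eqF. Qed.

Lemma cpow1 a : 0 < a -> cpow a 1 = a%:C.
Proof. by move=> a0; rewrite (cpow_real 1 a0) powRr1 // ltW. Qed.

Lemma cpow_conj a z : cpow a z^*%C = (cpow a z)^*%C.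
Proof.
rewrite /cpow -cexp_conj; congr cexp; rewrite conjcM; congr (_ * _).
by apply: complexP => //=; rewrite oppr0.
Qed.

Lemma normc_cpow a z : 0 < a -> normc (cpow a z) = a `^ Re z.
Proof.
move=> a0; rewrite /cpow normc_cexp Re_mul /= mulr0 subr0.
by rewrite /powR gt_eqF.
Qed.

Lemma cpow_critical a r t : 0 < a -> cpow a (r +i* t) = (a `^ r)%:C * ei (ln a) t.
Proof.
move=> a0; rewrite -cpow_real // /cpow /ei -cexpD; congr cexp.
by apply: complexP => /=; ring.
Qed.

Lemma cder_cpow w x : 0 < x -> cder (fun t => cpow t w) x (w * cpow x (w - 1)).
Proof.
move=> x0; have d := is_derive1_ln x0.
apply: cder_eq (cder_cexp (cder_mul (cder_cst w x) (cder_real d))) _.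
rewrite mul0r add0r cpowD cpowN cpow1 // /cpow.
by rewrite (_ : (x^-1)%:C = (x%:C)^-1) ?fmorphV //; ring.
Qed.

Lemma ccont_cpow w x : 0 < x -> ccont_at (fun t => cpow t w) x.
Proof. by move=> x0; exact: cder_ccont (cder_cpow w x0). Qed.

Lemma cpow_measurable w : cmeasurable setT (fun t : R => cpow t w).
Proof.
have m (a b : R) : measurable_fun setT (fun t : R => a * ln t + b * ln t).
  by apply: measurable_funD; apply: measurable_funM => //; exact: measurable_ln.
have mr : measurable_fun setT (fun t : R => Re (w * (ln t)%:C)).
  rewrite (_ : (fun _ => _) = (fun t => Re w * ln t + 0 * ln t)) //.
  by apply/funext => t; rewrite Re_mul /=; ring.
have mi : measurable_fun setT (fun t : R => Im (w * (ln t)%:C)).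
  rewrite (_ : (fun _ => _) = (fun t => Im w * ln t + 0 * ln t)) //.
  by apply/funext => t; rewrite Im_mul /=; ring.
have mc := continuous_measurable_fun (@continuous_cos R).
have ms := continuous_measurable_fun (@continuous_sin R).
split; apply: measurable_funM.
- by apply: measurableT_comp mr; exact: measurable_expR.
- exact: measurableT_comp mc mi.
- by apply: measurableT_comp mr; exact: measurable_expR.
- exact: measurableT_comp ms mi.
Qed.

End ComplexPowers.

Section PowerIntegrals.
Context (R : realType).
Local Notation mu := (@lebesgue_measure R).

(** Monotone convergence along an exhaustion. *)
Lemma integrable_of_exhaust (D : set R) (D_ : nat -> set R) (f : R -> R) (C : R) :
  measurable D -> (forall n, measurable (D_ n)) -> (forall n, D_ n `<=` D) ->
  (forall t, D t -> \forall n \near \oo, D_ n t) ->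
  measurable_fun setT f -> (forall t, D t -> 0 <= f t) ->
  (forall n, mu.-integrable (D_ n) (EFin \o f)) ->
  (forall n, \int[mu]_(t in D_ n) f t <= C) ->
  mu.-integrable D (EFin \o f).
Proof.
move=> mD mD_ sD nD mf f0 ifn fC.
have e n : (\int[mu]_(t in D_ n) (f t)%:E = \int[mu]_t (\1_(D_ n) t * f t)%:E)%E.
  rewrite integral_mkcond; apply: eq_integral => t _.
  by rewrite /patch indicE; case: ifP; rewrite ?mul1r ?mul0r.
have ge0 n t : (0 <= (\1_(D_ n) t * f t)%:E)%E.
  rewrite lee_fin indicE; have [/set_mem h|_] := boolP (t \in D_ n); last by rewrite mul0r.
  by rewrite mul1r f0 //; exact: sD h.
apply/integrableP; split; first by apply/measurable_EFinP; exact: measurable_funTS.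
apply: (@le_lt_trans _ _ C%:E); last exact: ltry.
have -> : (\int[mu]_(t in D) `|(EFin \o f) t| = \int[mu]_t (\1_D t * f t)%:E)%E.
  rewrite integral_mkcond; apply: eq_integral => t _.
  rewrite /patch indicE; case: ifP => [/set_mem h|_]; rewrite ?mul0r // mul1r.
  by rewrite /= ger0_norm // f0.
apply: (fatou_le (h_ := fun n t => (\1_(D_ n) t * f t)%:E)).
- move=> n; apply/measurable_EFinP; exact: measurable_funM (measurable_indic (mD_ n)) mf.
- exact: ge0.
- move=> t; apply: cvg_near_cst; have [Dt|nDt] := pselect (D t).
    by apply: filterS (nD t Dt) => n h; rewrite !indicE (mem_set Dt) (mem_set h).
  apply: nearW => n; have nDn : ~ D_ n t by move=> /sD.
  by rewrite !indicE (memNset nDt) (memNset nDn).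
- apply: nearW => n; rewrite -e; apply: le_trans (_ : (_ <= (\int[mu]_(t in D_ n) f t)%:E)%E) _;
    last by rewrite lee_fin.
  rewrite /Rintegral fineK ?lexx //; refine (@integrable_fin_num _ _ _ mu _ (mD_ n) (EFin \o f) (ifn n)).
Qed.

(** The primitive of x^(w-1) is x^w / w. *)
Lemma integral_cpow (a b : R) (w : R[i]) : 0 < a -> a <= b -> w != 0 ->
  cintegral `[a, b] (fun x => cpow x (w - 1)) = (cpow b w - cpow a w) / w.
Proof.
move=> a0; rewrite le_eqVlt => /predU1P[<- _|ab w0].
  by rewrite subrr mul0r /cintegral set_itv1 !Rintegral_set1.
have pos x : a <= x <= b -> 0 < x by move=> /andP[ax _]; exact: lt_le_trans ax.
rewrite (cFTC (F := fun x => w^-1 * cpow x w) ab); first by ring.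
- move=> x /pos x0; apply: cder_eq (cder_mul (cder_cst _ x) (cder_cpow w x0)) _.
  by rewrite mul0r add0r mulKf.
- by move=> x /pos x0; exact: ccont_cpow.
Qed.

Lemma cpow_integrable (a b : R) (w : R[i]) : 0 < a ->
  cintegrable `[a, b] (fun x => cpow x w).
Proof.
move=> a0; apply: ccont_cintegrable => x /andP[ax _].
by apply: ccont_cpow; exact: lt_le_trans ax.
Qed.

Lemma powR_cpow (x r : R) : 0 < x -> x `^ (r - 1) = Re (cpow x (r%:C - 1)).
Proof.
move=> x0; have -> : r%:C - 1 = (r - 1)%:C by rewrite rmorphB.
by rewrite (cpow_real (r - 1) x0).
Qed.

Lemma powR_integrable (a b r : R) : 0 < a ->
  mu.-integrable `[a, b] (EFin \o (fun x => x `^ (r - 1))).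
Proof.
move=> a0; have := cintegrable_Re (measurable_itv _) (cpow_integrable b (r%:C - 1) a0).
apply: eq_integrable => // x /set_mem /=; rewrite in_itv /= => /andP[ax _].
by rewrite powR_cpow //; exact: lt_le_trans ax.
Qed.

Lemma Rintegral_powR (a b r : R) : 0 < a -> a <= b -> r != 0 ->
  \int[mu]_(x in `[a, b]) x `^ (r - 1) = (b `^ r - a `^ r) / r.
Proof.
move=> a0 ab r0; have b0 := lt_le_trans a0 ab.
transitivity (Re (cintegral `[a, b] (fun x => cpow x (r%:C - 1)))).
  apply: eq_Rintegral => x /set_mem /=; rewrite in_itv /= => /andP[ax _].
  by rewrite powR_cpow //; exact: lt_le_trans ax.
have w0 : r%:C != 0 :> R[i] by rewrite eq_complex negb_and /= r0.
by rewrite integral_cpow // !cpow_real // -rmorphB -fmorphV -rmorphM.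
Qed.

Lemma powR_integrable01 (r : R) : 0 < r ->
  mu.-integrable `]0, 1] (EFin \o (fun x : R => x `^ (r - 1))).
Proof.
move=> r0; pose D_ n : set R := `[(n.+1%:R)^-1, 1]%classic.
apply: (@integrable_of_exhaust _ D_ (fun x => x `^ (r - 1)) r^-1) => //.
- by move=> n; exact: measurable_itv.
- move=> n x; rewrite /D_ /= !in_itv /= => /andP[h ->]; rewrite andbT.
  by apply: lt_le_trans h; rewrite invr_gt0.
- move=> t; rewrite /= in_itv /= => /andP[t0 t1]; near=> n.
  rewrite /D_ /= in_itv /= t1 andbT -[leRHS]invrK lef_pV2 ?posrE ?invr_gt0 //.
  by apply: (@le_trans _ _ n%:R); [near: n; exact: nbhs_infty_ger|rewrite ler_nat].
- by move=> t _; exact: powR_ge0.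
- by move=> n; apply: powR_integrable; rewrite invr_gt0.
- move=> n; rewrite Rintegral_powR ?invr_gt0 // ?gt_eqF //; last first.
    by rewrite invf_le1 // ler1n.
  rewrite powR1 -[leRHS]mul1r; apply: ler_wpM2r; first by rewrite invr_ge0 ltW.
  by rewrite lerBlDr lerDl powR_ge0.
Unshelve. all: end_near. Qed.

Lemma powR_integrable1y (r : R) : 0 < r ->
  mu.-integrable `[1, +oo[ (EFin \o (fun x : R => x `^ (- r - 1))).
Proof.
move=> r0; pose D_ n : set R := `[1, n.+1%:R]%classic.
apply: (@integrable_of_exhaust _ D_ (fun x => x `^ (- r - 1)) r^-1) => //.
- by move=> n; exact: measurable_itv.
- by move=> n x; rewrite /D_ /= !in_itv /= andbT => /andP[].
- move=> t; rewrite /= in_itv /= andbT => t1; near=> n.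
  rewrite /D_ /= in_itv /= t1 /=.
  by apply: (@le_trans _ _ n%:R); [near: n; exact: nbhs_infty_ger|rewrite ler_nat].
- by move=> t _; exact: powR_ge0.
- by move=> n; exact: powR_integrable.
- move=> n; rewrite Rintegral_powR ?ler1n // ?oppr_eq0 ?gt_eqF //.
  rewrite powR1 invrN mulrN -mulNr opprB -[leRHS]mul1r.
  apply: ler_wpM2r; first by rewrite invr_ge0 ltW.
  by rewrite lerBlDr lerDl powR_ge0.
Unshelve. all: end_near. Qed.

(** The exponential dominates x^n / n! with n at least r + 1. *)
Lemma powR_expRN (r x : R) : 1 <= x ->
  x `^ (r - 1) * expR (- x) <= (Num.truncn `|r|).+1.+1`!%:R * x `^ (- 1 - 1).
Proof.
move=> x1; have x0 : 0 < x := lt_le_trans ltr01 x1.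
set n := (Num.truncn `|r|).+2.
have rn : r + 1 <= n%:R.
  have := truncnS_gt `|r|; have := ler_norm r; rewrite /n -(natr1 _.+1).
  by lra.
have e : x `^ n%:R <= n`!%:R * expR x.
  have n0 : 0 < n`!%:R :> R by rewrite ltr0n fact_gt0.
  have h : x ^+ n / n`!%:R <= expR x.
    by have := @expR_ge1Dxn R x n.-1 (ltW x0); rewrite /n /=; lra.
  rewrite powR_mulrn ?(ltW x0) // -[leLHS](divfK (lt0r_neq0 n0)) mulrC.
  by rewrite ler_wpM2l // ltW.
rewrite (_ : r - 1 = (r + 1) + (- 1 - 1)); last by ring.
rewrite powRD ?(gt_eqF x0) ?implybT // mulrAC; apply: ler_wpM2r; first exact: powR_ge0.
rewrite expRN ler_pdivrMr ?expR_gt0 //; apply: le_trans e.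
exact: ler_powR.
Qed.

Lemma integrable_halfline (f : R -> R) : measurable_fun setT f ->
  mu.-integrable `]0, 1] (EFin \o f) -> mu.-integrable `[1, +oo[ (EFin \o f) ->
  mu.-integrable `]0, +oo[ (EFin \o f).
Proof.
move=> mf i1 i2.
have i3 : mu.-integrable `]1, +oo[ (EFin \o f).
  apply: (@integrableS _ _ _ mu `[1, +oo[%classic) => // x /=.
  by rewrite !in_itv /= !andbT => /ltW.
apply/integrableP; split; first by apply/measurable_EFinP; exact: measurable_funTS.
rewrite (_ : `]0, +oo[%classic = `]0, 1]%classic `|` `]1, +oo[%classic :> set R); last first.
  apply/seteqP; split => x /=; rewrite !in_itv /= ?andbT.
    by move=> x0; have [h|h] := leP x 1; [left|right]; rewrite ?x0.
  by case=> [/andP[]//|]; apply: lt_trans.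
rewrite ge0_integral_setU //.
- by apply: lte_add_pinfty; [have /integrableP[] := i1|have /integrableP[] := i3].
- apply: measurableT_comp => //; apply/measurable_EFinP; exact: measurable_funTS.
- apply/disj_setPS => x /=; rewrite !in_itv /= andbT => -[/andP[_ h1] h2].
  by move: (lt_le_trans h2 h1); rewrite ltxx.
Qed.

Lemma gamma_integrable (r : R) : 0 < r ->
  mu.-integrable `]0, +oo[ (EFin \o (fun t => t `^ (r - 1) * expR (- t))).
Proof.
move=> r0; have mf : measurable_fun setT (fun t : R => t `^ (r - 1) * expR (- t)).
  apply: measurable_funM; first exact: measurable_powR.
  by apply: measurableT_comp; [exact: measurable_expR|exact: measurable_funN].
have bound (D : set R) (g : R -> R) : measurable D -> mu.-integrable D (EFin \o g) ->
    (forall t, D t -> t `^ (r - 1) * expR (- t) <= g t) ->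
    mu.-integrable D (EFin \o (fun t => t `^ (r - 1) * expR (- t))).
  move=> mD ig fg; apply: le_integrable ig => //.
    by apply/measurable_EFinP; exact: measurable_funTS.
  move=> t Dt; rewrite /= lee_fin ger0_norm ?mulr_ge0 ?powR_ge0 ?expR_ge0 //.
  exact: le_trans (fg t Dt) (ler_norm _).
apply: integrable_halfline => //.
- apply: bound (powR_integrable01 r0) _ => // t /=; rewrite in_itv /= => /andP[t0 _].
  by rewrite ler_piMr ?powR_ge0 // -expR0 ler_expR oppr_le0 ltW.
- apply: bound (integrable_scaler _ _ (powR_integrable1y ltr01)) _ => // t /=.
  by rewrite in_itv /= andbT; exact: powR_expRN.
Qed.

End PowerIntegrals.

(** * Euler's integral has no zeros *)

Section EulerIntegral.
Context (R : realType).
Local Notation mu := (@lebesgue_measure R).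
Implicit Types (z : R[i]).

Lemma climit_unique (u : nat -> R[i]) (a b : R[i]) :
  normc (u n - a) @[n --> \oo] --> (0 : R) ->
  normc (u n - b) @[n --> \oo] --> (0 : R) -> a = b.
Proof.
move=> ua ub; apply/eqP; rewrite -subr_eq0 -normc_eq0; apply/eqP.
have h : normc (u n - a) + normc (u n - b) @[n --> \oo] --> (0 : R).
  by rewrite -[X in _ --> X]addr0; exact: cvgD.
have : normc (a - b) @[_ --> \oo] --> (0 : R).
  apply: (@squeeze_cvgr _ _ _ _ (cst 0) _ _ _ _ _ h); last exact: cvg_cst.
  apply: nearW => n; rewrite normc_ge0 /= normcBC.
  by rewrite (_ : b - a = (u n - a) - (u n - b)) ?le_normcB //; ring.
by move=> /(@cvg_lim _ (@norm_hausdorff _ R^o)) <- //; rewrite lim_cst.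
Qed.

Lemma halfline_exhaust : [/\ forall n : nat, measurable (`[(n.+1%:R)^-1, n.+1%:R]%classic : set R),
  forall n : nat, `[(n.+1%:R)^-1, n.+1%:R]%classic `<=` (`]0, +oo[%classic : set R) &
  forall t : R, `]0, +oo[%classic t ->
    \forall n \near \oo, `[(n.+1%:R)^-1, n.+1%:R]%classic t].
Proof.
split.
- by move=> n; exact: measurable_itv.
- move=> n x; rewrite /= !in_itv /= andbT => /andP[h _].
  by apply: lt_le_trans h; rewrite invr_gt0.
- move=> t; rewrite /= in_itv /= andbT => t0; near=> n; rewrite in_itv /=; apply/andP; split.
    rewrite -[leRHS]invrK lef_pV2 ?posrE ?invr_gt0 //.
    by apply: (@le_trans _ _ n%:R); [near: n; exact: nbhs_infty_ger|rewrite ler_nat].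
  by apply: (@le_trans _ _ n%:R); [near: n; exact: nbhs_infty_ger|rewrite ler_nat].
Unshelve. all: end_near. Qed.

Lemma Re_sub1 z : Re (z - 1) = Re z - 1.
Proof. by rewrite Re_add Re_opp. Qed.

Lemma euler_normc z t : 0 < t ->
  normc (cpow t (z - 1) * (expR (- t))%:C) = t `^ (Re z - 1) * expR (- t).
Proof.
by move=> t0; rewrite normcM normcC ger0_norm ?expR_ge0 // normc_cpow // Re_sub1.
Qed.

Lemma expRN_measurable : measurable_fun setT (fun t : R => expR (- t)).
Proof. by apply: measurableT_comp; [exact: measurable_expR|exact: measurable_funN]. Qed.

Lemma euler_cintegrable z : 0 < Re z ->
  cintegrable `]0, +oo[ (fun t => cpow t (z - 1) * (expR (- t))%:C).
Proof.
move=> z0; apply: le_cintegrable (gamma_integrable z0) => //.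
- apply: (cmeasurableS measurableT) => //; apply: cmeasurable_mul.
    exact: cpow_measurable.
  by apply: cmeasurable_real; exact: expRN_measurable.
- by move=> t; rewrite /= in_itv /= andbT => t0; rewrite euler_normc.
Qed.

Lemma is_derive_expRN (t : R) : is_derive t (1 : R) (fun t : R => expR (- t)) (- expR (- t)).
Proof.
have d := is_derive1_comp (is_derive_expR (- t)) (is_deriveN (is_derive_id t (1 : R))).
by apply: is_derive_eq d _; rewrite mulrN1.
Qed.

Lemma powR_expRN_cvg0 (r : R) : 0 < r ->
  (n.+1%:R `^ r * expR (- n.+1%:R) : R) @[n --> \oo] --> (0 : R).
Proof.
move=> r0; pose C : R := (Num.truncn `|r + 1|).+1.+1`!%:R.
apply: (@squeeze_cvgr _ _ _ _ (cst 0) (fun n : nat => C * n.+1%:R^-1)); last 2 first.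
- exact: cvg_cst.
- by rewrite -[X in _ --> X](mulr0 C); apply: cvgMr; exact: (@cvg_harmonic R).
near=> n; rewrite /= mulr_ge0 ?powR_ge0 ?expR_ge0 //=.
have n1 : 1 <= n.+1%:R :> R by rewrite ler1n.
have := powR_expRN (r + 1) n1; rewrite addrK => h; apply: le_trans h _.
apply: ler_wpM2l => //; rewrite -opprD powRN lef_pV2 ?posrE ?powR_gt0 //.
by rewrite -[leLHS]powRr1 //; apply: ler_powR => //; rewrite lerDr.
Unshelve. all: end_near. Qed.

Lemma powR_inv_cvg0 (r : R) : 0 < r -> ((n.+1%:R^-1 : R) `^ r) @[n --> \oo] --> (0 : R).
Proof.
move=> r0; have h := @powR_cvg0 R r r0.
apply/cvgrPdist_lt => e e0; have /cvgrPdist_lt /(_ _ e0) := h.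
move=> [d /= d0 hd]; have := @cvg_harmonic R; move=> /cvgrPdist_lt /(_ _ d0).
apply: filterS => n hn; apply: hd; last by rewrite invr_gt0.
exact: hn.
Qed.

(** Integration of the derivative of t^z exp(-t) over [1/n, n]; the boundary terms
    tend to 0. *)
Lemma euler_succ z : 0 < Re z -> Euler_integral (z + 1) = z * Euler_integral z.
Proof.
move=> z0; have z1 : 0 < Re (z + 1) by rewrite Re_add addr_gt0.
have [mD sD nD] := halfline_exhaust.
have i0 := euler_cintegrable z0; have i1 := euler_cintegrable z1.
have zi0 := cintegrableZ z (measurable_itv _) i0.
have i := cintegrable_sub (measurable_itv _) zi0 i1.
pose F t : R[i] := cpow t z * (expR (- t))%:C.
pose f t : R[i] := z * (cpow t (z - 1) * (expR (- t))%:C) -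
  cpow t (z + 1 - 1) * (expR (- t))%:C.
have dF t : 0 < t -> cder F t (f t).
  move=> t0; apply: cder_eq (cder_mul (cder_cpow z t0) (cder_real (is_derive_expRN t))) _.
  by rewrite /f addrK rmorphN /=; ring.
have cf t : 0 < t -> ccont_at f t.
  move=> t0; have ce : ccont_at (fun t : R => (expR (- t))%:C) t.
    exact: cder_ccont (cder_real (is_derive_expRN t)).
  by apply: ccont_sub; [apply: ccont_mul; [exact: ccont_cst|]|];
    apply: ccont_mul => //; exact: ccont_cpow.
have FTC n : (0 < n)%N -> cintegral `[(n.+1%:R)^-1, n.+1%:R] f = F n.+1%:R - F n.+1%:R^-1.
  move=> n0; have pos x : (n.+1%:R)^-1 <= x <= n.+1%:R -> 0 < x.
    by move=> /andP[h _]; apply: lt_le_trans h; rewrite invr_gt0.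
  apply: cFTC; [|by move=> x /pos; exact: dF|by move=> x /pos; exact: cf].
  apply: (@lt_le_trans _ _ 1); last by rewrite ler1n.
  by rewrite invf_lt1 // ltr1n.
have lim1 := cintegral_exhaust (measurable_itv _) mD sD nD i.
have lim2 : normc (cintegral `[(n.+1%:R)^-1, n.+1%:R] f) @[n --> \oo] --> (0 : R).
  apply: (@squeeze_cvgr _ _ _ _ (cst 0)
    (fun n : nat => n.+1%:R `^ (Re z) * expR (- n.+1%:R) + n.+1%:R^-1 `^ (Re z))); last 2 first.
  - exact: cvg_cst.
  - rewrite -[X in _ --> X]addr0; apply: cvgD; first exact: powR_expRN_cvg0.
    exact: powR_inv_cvg0.
  near=> n; rewrite normc_ge0 /= FTC; last by near: n; exact: nbhs_infty_gt.
  apply: le_trans (le_normcB _ _) _; apply: lerD; rewrite /F normcM normcC normc_cpow ?invr_gt0 //.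
    by rewrite ger0_norm // expR_ge0.
  rewrite ger0_norm ?expR_ge0 // ler_piMr ?powR_ge0 // -[leRHS]expR0 ler_expR.
have f0 : cintegral `]0, +oo[ f = 0.
  apply: (climit_unique lim1); under eq_fun do rewrite subr0.
  exact: lim2.
move: f0; rewrite /f cintegralB // cintegralZ // => /eqP.
by rewrite subr_eq0 => /eqP/esym.
Unshelve. all: end_near. Qed.

Lemma normr_sin_le (x : R) : `|sin x| <= `|x|.
Proof.
wlog x0 : x / 0 <= x.
  move=> h; have [/h//|/ltW x0] := leP 0 x.
  by rewrite -normrN -sinN -[leRHS]normrN; apply: h; rewrite oppr_ge0.
have [c _] := @MVT_segment R sin cos 0 x x0 (fun y _ => is_derive_sin y)
  (continuous_subspaceT (@continuous_sin R)).
rewrite sin0 !subr0 => ->; rewrite normrM ler_piMl //.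
by rewrite ler_norml cos_geN1 cos_le1.
Qed.

Lemma cos_lower (x : R) : 1 - x ^+ 2 / 2 <= cos x.
Proof.
have e : cos x = 1 - 2 * sin (x / 2) ^+ 2.
  have -> : cos x = cos (x / 2 + x / 2) by congr cos; lra.
  by rewrite cosD -!expr2 cos2sin2; ring.
have h : sin (x / 2) ^+ 2 <= (x / 2) ^+ 2.
  rewrite -[leLHS]real_normK ?num_real // -[leRHS]real_normK ?num_real //.
  by rewrite ler_pXn2r ?nnegrE // normr_sin_le.
by rewrite e; rewrite expr_div_n in h; lra.
Qed.

(** With r = s^2, this is |ln s| <= |s - 1/s|. *)
Lemma ln_sqr_le (r : R) : 0 < r -> ln r ^+ 2 <= 4 * (r - 2 + r^-1).
Proof.
move=> r0; pose s := Num.sqrt r; have s0 : 0 < s by rewrite sqrtr_gt0.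
have rE : r = s ^+ 2 by rewrite sqr_sqrtr // ltW.
have h (x : R) : 1 <= x -> ln x ^+ 2 <= (x - x^-1) ^+ 2.
  move=> x1; have x0 : 0 < x := lt_le_trans ltr01 x1.
  have xV : x^-1 <= 1 by rewrite invf_le1.
  rewrite ler_pXn2r ?nnegrE ?ln_ge0 ?subr_ge0 ?(le_trans xV) //.
  apply: (@le_trans _ _ (x - 1)); last by rewrite lerD2l lerN2.
  by have := @le_ln1Dx R (x - 1); rewrite (_ : 1 + (x - 1) = x); [apply; lra|ring].
have hs : ln s ^+ 2 <= (s - s^-1) ^+ 2.
  have [s1|s1] := leP 1 s; first exact: h.
  have := h s^-1; rewrite lnV ?posrE // sqrrN invrK -opprB sqrrN.
  by apply; rewrite invf_ge1 // ltW.
have e : (s - s^-1) ^+ 2 = r - 2 + r^-1.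
  by rewrite rE sqrrB divff ?gt_eqF // exprVn.
rewrite -e [X in ln X ^+ 2]rE expr2 lnM ?posrE //.
by move: hs; nra.
Qed.

(** The Gamma function on the positive reals. *)
Definition rgamma (r : R) : R := \int[mu]_(t in `]0, +oo[) (t `^ (r - 1) * expR (- t)).

Lemma euler_real (r : R) : Euler_integral r%:C = (rgamma r)%:C.
Proof.
rewrite /Euler_integral /rgamma -cintegral_real; apply: eq_cintegral => t /=.
rewrite in_itv /= andbT => t0; rewrite rmorphM /=; congr (_ * _).
have -> : r%:C - 1 = (r - 1)%:C by rewrite rmorphB.
exact: cpow_real.
Qed.

Lemma rgamma_succ (r : R) : 0 < r -> rgamma (r + 1) = r * rgamma r.
Proof.
move=> r0; have := @euler_succ r%:C r0.
have -> : r%:C + 1 = (r + 1)%:C by rewrite rmorphD.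
by rewrite !euler_real -rmorphM => -[].
Qed.

Lemma rgamma_gt0 (r : R) : 1 <= r -> 0 < rgamma r.
Proof.
move=> r1; have gi := gamma_integrable (lt_le_trans ltr01 r1).
apply: (@lt_le_trans _ _ (expR (- 2))); first exact: expR_gt0.
rewrite -lee_fin /rgamma /Rintegral fineK; last exact: (integrable_fin_num _ gi).
have -> : (expR (- 2))%:E = (\int[mu]_(t in `[1%R, 2%R]) (expR (- 2))%:E)%E :> \bar R.
  rewrite integral_cst //; have := @lebesgue_measure_itv R `[1, 2]; rewrite /= => ->.
  by rewrite lte_fin ltr1n -EFinB (_ : 2 - 1 = 1 :> R) ?mule1 //; ring.
have sub : (`[1, 2]%classic : set R) `<=` `]0, +oo[%classic.
  by move=> x /=; rewrite !in_itv /= andbT => /andP[h _]; apply: lt_le_trans h.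
have mg := measurable_int _ gi.
apply: (@le_trans _ _ (\int[mu]_(t in `[1%R, 2%R]) (t `^ (r - 1) * expR (- t))%:E)%E).
  apply: ge0_le_integral => //.
  - exact: measurable_funS sub mg.
  - move=> x; rewrite /= in_itv /= => /andP[x1 x2]; rewrite lee_fin.
    rewrite -[leLHS]mul1r; apply: ler_pM => //; rewrite ?expR_ge0 //.
      by rewrite -[leLHS](powRr0 x); apply: ler_powR => //; rewrite subr_ge0.
    by rewrite ler_expR lerN2.
apply: ge0_subset_integral => // t _.
by rewrite lee_fin mulr_ge0 ?powR_ge0 ?expR_ge0.
Qed.

(** The probability density proportional to t^(a-1) exp(-t) concentrates around
    c = a - 1 in the logarithmic scale, so that the oscillating factor t^(iy) stays
    close to c^(iy) on average.  Precisely, cos u >= 1 - u^2/2 and [ln_sqr_le] applied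
    to t / c bound the real part from below by rgamma a (1 - 2 y^2 / c). *)
Lemma euler_neq0_large (a y : R) : 2 + 2 * y ^+ 2 <= a -> Euler_integral (a +i* y) != 0.
Proof.
move=> ay; have y2 := sqr_ge0 y; pose c := a - 1.
have c0 : 0 < c by rewrite /c; lra.
have a0 : 0 < a by lra.
have wi := @euler_cintegrable (a +i* y) a0.
(* the factor c^(-iy), which cancels the phase of t^(iy) at t = c *)
pose k : R[i] := cexp (0 +i* (- (y * ln c))).
have ki := cintegrableZ k (measurable_itv _) wi.
apply/eqP => E0.
pose g t : R := t `^ (a - 1) * expR (- t).
have tpos t : t \in (`]0, +oo[%classic : set R) -> 0 < t by rewrite inE /= in_itv /= andbT.
have ReE : \int[mu]_(t in `]0, +oo[) (g t * cos (y * (ln t - ln c))) = 0.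
  transitivity (Re (k * Euler_integral (a +i* y))); last by rewrite E0 mulr0.
  rewrite -cintegralZ //; apply: eq_Rintegral => t /tpos t0.
  have -> : cpow t (a +i* y - 1) = (t `^ (a - 1))%:C * cexp (0 +i* (y * ln t)).
    rewrite -cpow_real // /cpow -cexpD; congr cexp.
    by apply: complexP => /=; ring.
  transitivity (Re ((g t)%:C * cexp (0 +i* (y * (ln t - ln c))))).
    by rewrite Re_mul /= expR0 !mul0r; ring.
  congr (Re _); rewrite /g rmorphM /= /k.
  have -> : 0 +i* (y * (ln t - ln c)) = 0 +i* (y * ln t) + 0 +i* (- (y * ln c)) :> R[i].
    by apply: complexP => /=; ring.
  by rewrite cexpD; ring.
have gi := gamma_integrable a0.
have gi1 : mu.-integrable `]0, +oo[ (EFin \o (fun t => t `^ (a + 1 - 1) * expR (- t))).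
  by apply: gamma_integrable; lra.
have gi2 : mu.-integrable `]0, +oo[ (EFin \o (fun t => t `^ (c - 1) * expR (- t))).
  exact: gamma_integrable.
pose h t : R := (1 + 4 * y ^+ 2) * g t +
  (- (2 * y ^+ 2 / c) * (t `^ (a + 1 - 1) * expR (- t)) +
   - (2 * y ^+ 2 * c) * (t `^ (c - 1) * expR (- t))).
have mD : measurable (`]0, +oo[%classic : set R) := measurable_itv _.
have j1 := integrable_scaler (1 + 4 * y ^+ 2) mD gi.
have j2 := integrable_scaler (- (2 * y ^+ 2 / c)) mD gi1.
have j3 := integrable_scaler (- (2 * y ^+ 2 * c)) mD gi2.
have j23 := integrable_addr mD j2 j3.
have hi := integrable_addr mD j1 j23.
have Ih : \int[mu]_(t in `]0, +oo[) h t = rgamma a * (1 - 2 * y ^+ 2 / c).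
  rewrite /h RintegralD // RintegralD // !RintegralZl //.
  rewrite -/(rgamma (a + 1)) -/(rgamma c) -/(rgamma a) rgamma_succ //.
  have -> : rgamma a = c * rgamma c.
    by rewrite -(rgamma_succ c0) (subrK 1 a).
  have -> : a = c + 1 by rewrite /c subrK.
  by field; rewrite gt_eqF.
have hle t : 0 < t -> h t <= g t * cos (y * (ln t - ln c)).
  move=> t0; have tc : 0 < t / c by rewrite divr_gt0.
  have g0 : 0 <= g t by rewrite mulr_ge0 ?powR_ge0 ?expR_ge0.
  have e1 : t `^ (a + 1 - 1) * expR (- t) = t * g t.
    rewrite /g mulrA; congr (_ * _); rewrite (_ : a + 1 - 1 = 1 + (a - 1)); last by ring.
    by rewrite (@powRD _ t 1 (a - 1)) ?(gt_eqF t0) ?implybT // powRr1 // ltW.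
  have e2 : t `^ (c - 1) * expR (- t) = t^-1 * g t.
    rewrite /g mulrA; congr (_ * _); rewrite (_ : c - 1 = - 1 + (a - 1)); last by rewrite /c; ring.
    by rewrite (@powRD _ t (- 1) (a - 1)) ?(gt_eqF t0) ?implybT // powRN powRr1 // ltW.
  have := ln_sqr_le tc; rewrite lnM ?posrE ?invr_gt0 // lnV ?posrE // invf_div.
  set L := ln t - ln c => hL.
  have hc := cos_lower (y * L).
  have : 1 - 2 * y ^+ 2 * (t / c - 2 + c / t) <= cos (y * L).
    apply: le_trans hc; rewrite exprMn lerD2l lerN2.
    have := ler_wpM2l y2 hL; lra.
  move=> /(ler_wpM2l g0); apply: le_trans; rewrite /h e1 e2 le_eqVlt; apply/orP; left.
  by apply/eqP; ring.
have ig : mu.-integrable `]0, +oo[ (EFin \o (fun t => g t * cos (y * (ln t - ln c)))).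
  apply: le_integrable gi => //.
    apply/measurable_EFinP; apply: measurable_funTS; apply: measurable_funM.
      by apply: measurable_funM; [exact: measurable_powR|exact: expRN_measurable].
    apply: (measurableT_comp (continuous_measurable_fun (@continuous_cos R))).
    apply: measurable_funM => //; apply: measurable_funB => //; exact: measurable_ln.
  move=> t _; rewrite /= lee_fin normrM ler_piMr //.
  by rewrite ler_norml cos_geN1 cos_le1.
have : rgamma a * (1 - 2 * y ^+ 2 / c) <= 0.
  rewrite -Ih -[leRHS]ReE; apply: (@le_Rintegral _ _ _ mu _ _ _ mD hi ig) => t.
  by rewrite /= in_itv /= andbT; exact: hle.
apply/negP; rewrite -ltNge mulr_gt0 //; first by apply: rgamma_gt0; lra.
by rewrite subr_gt0 ltr_pdivrMr // mul1r /c; lra.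
Qed.

(** The functional equation moves a zero to large real parts. *)
Theorem euler_neq0 z : 0 < Re z -> Euler_integral z != 0.
Proof.
move=> z0; apply/eqP => E0.
have shift n : 0 < Re (z + n%:R) /\ Euler_integral (z + n%:R) = 0.
  elim: n => [|n [h1 h2]]; first by rewrite addr0.
  have -> : z + n.+1%:R = z + n%:R + 1 by rewrite -natr1 addrA.
  split; last by rewrite euler_succ // h2 mulr0.
  by rewrite Re_add addr_gt0.
pose n := (Num.truncn (2 + 2 * Im z ^+ 2)).+1.
have [_ /eqP] := shift n; apply/negP.
have -> : z + n%:R = (Re z + n%:R) +i* Im z.
  by rewrite natC; case: (z) => x y; apply: complexP; rewrite /= ?addr0.
apply: euler_neq0_large; have := truncnS_gt (2 + 2 * Im z ^+ 2); rewrite -/n.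
by move: z0; set u := Re z; set v := 2 + _ => u0 h; lra.
Qed.

End EulerIntegral.

(** * The Gaussian and the archimedean factor *)

Section GaussianTransform.
Context (R : realType).
Local Notation mu := (@lebesgue_measure R).
Implicit Types (x y : R).

Definition gauss x : R := expR (- (pi * x ^+ 2)).

Lemma gauss_ge0 x : 0 <= gauss x. Proof. exact: expR_ge0. Qed.

Lemma gauss_cont : continuous gauss.
Proof.
move=> x; rewrite /gauss.
have h : {for x, continuous (fun x : R => - (pi * x ^+ 2))}.
  by apply: cvgN; apply: cvgMr; exact: exprn_continuous.
exact: (cvg_comp _ _ h (@continuous_expR R _)).
Qed.

Lemma gauss_mass : mu.-integrable setT (EFin \o gauss) /\ \int[mu]_x gauss x = 1.
Proof.
pose s : R := (Num.sqrt (2 * pi))^-1.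
have p0 : 0 < 2 * pi :> R by rewrite mulr_gt0 ?pi_gt0.
have s0 : s != 0 by rewrite invr_eq0 gt_eqF // sqrtr_gt0.
have s2 : s ^+ 2 = (2 * pi)^-1 by rewrite /s exprVn sqr_sqrtr // ltW.
have e : gauss = normal_pdf 0 s.
  apply/funext => x; rewrite normal_pdfE // /normal_peak /normal_fun s2 subr0 /gauss.
  have pp : (pi : R) != 0 by rewrite gt_eqF // pi_gt0.
  have -> : (2 * pi)^-1 * pi *+ 2 = 1 :> R by move: (pi : R) pp => p pp; field.
  rewrite sqrtr1 invr1 mul1r; congr expR.
  by move: (pi : R) pp => p pp; field.
split; first by rewrite e; exact: integrable_normal_pdf.
by rewrite /Rintegral e integral_normal_pdf.
Qed.

(** The entire function whose restriction to the imaginary axis is the Gaussian. *)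
Definition cgauss (w : R[i]) : R[i] := cexp (pi%:C * (w * w)).

Lemma cgaussE x y : cgauss (x +i* y) = (expR (pi * x ^+ 2) * gauss y)%:C * ei (2 * pi * x) y.
Proof.
rewrite /cgauss /gauss -expRD -cexp_real /ei -cexpD; congr cexp.
by apply: complexP => /=; ring.
Qed.

Lemma normc_cgauss x y : normc (cgauss (x +i* y)) = expR (pi * x ^+ 2) * gauss y.
Proof. by rewrite cgaussE normcM normc_ei mulr1 normcC ger0_norm // mulr_ge0 ?expR_ge0 ?gauss_ge0. Qed.

Lemma cgauss_integrable x : cintegrable setT (fun y => cgauss (x +i* y)).
Proof.
have ig := integrable_scaler (expR (pi * x ^+ 2)) measurableT gauss_mass.1.
apply: le_cintegrable ig => //.
- apply: (@eq_cmeasurable _ _ (fun y => (expR (pi * x ^+ 2) * gauss y)%:C * ei (2 * pi * x) y)).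
    by move=> y; rewrite cgaussE.
  apply: cmeasurable_mul; last by apply: ccont_cmeasurable => t; exact: ei_ccont.
  apply: cmeasurable_real; apply: measurable_funM => //.
  exact: continuous_measurable_fun gauss_cont.
- by move=> y _; rewrite normc_cgauss.
Qed.

(** Cauchy's theorem moves the line of integration. *)
Lemma cgauss_line x : 0 <= x ->
  cintegral setT (fun y => cgauss (0 +i* y)) = cintegral setT (fun y => cgauss (x +i* y)).
Proof.
move=> x0; apply: (strip_integral x0 _ (cgauss_integrable 0) (cgauss_integrable x)
  (C := expR (pi * x ^+ 2))).
- move=> z _; apply: cdiff_comp (cdiff_cexp _).
  rewrite (_ : (fun w => _) = (fun w => pi%:C * (w * w) + 0 * w + 0)).
    exact: cdiff_poly2.
  by apply/funext => w; rewrite mul0r !addr0.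
- move=> u /andP[u0 ux]; have [ig g1] := gauss_mass.
  under eq_integral do rewrite normc_cgauss EFinM.
  rewrite integralZl //.
  have -> : (\int[mu]_y (gauss y)%:E = 1)%E.
    rewrite -[RHS]/(1%R%:E) -g1 /Rintegral fineK //; exact: (integrable_fin_num _ ig).
  rewrite mule1 lee_fin ler_expR ler_wpM2l ?pi_ge0 //.
  by rewrite ler_pXn2r ?nnegrE.
Qed.

Lemma gauss_cos_integrable x : mu.-integrable setT (EFin \o (fun y => cos (2 * pi * x * y) * gauss y)).
Proof.
have [ig _] := gauss_mass; apply: le_integrable ig => //.
  apply/measurable_EFinP; apply: measurable_funM; last exact: continuous_measurable_fun gauss_cont.
  apply: (measurableT_comp (continuous_measurable_fun (@continuous_cos R))).
  exact: measurable_funM.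
move=> y _; rewrite /= lee_fin normrM ler_piMl //.
by rewrite ler_norml cos_geN1 cos_le1.
Qed.

Lemma gauss_fourier x : 0 <= x -> \int[mu]_y (cos (2 * pi * x * y) * gauss y) = gauss x.
Proof.
move=> x0; have := congr1 (@complex.Re R) (cgauss_line x0).
rewrite /cintegral /=.
have -> : \int[mu]_y Re (cgauss (0 +i* y)) = 1.
  rewrite -gauss_mass.2; apply: eq_Rintegral => y _.
  rewrite cgaussE Re_mul /= expr0n /=.
  by rewrite !(mulr0, mul0r, expR0, cos0, sin0, mulr1, mul1r, subr0).
have -> : \int[mu]_y Re (cgauss (x +i* y)) =
    expR (pi * x ^+ 2) * \int[mu]_y (cos (2 * pi * x * y) * gauss y).
  rewrite -RintegralZl //; last exact: gauss_cos_integrable.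
  apply: eq_Rintegral => y _; rewrite cgaussE Re_mul /= expR0; ring.
move=> h; rewrite /gauss expRN; apply: (mulfI (lt0r_neq0 (expR_gt0 (pi * x ^+ 2)))).
by rewrite -h divff // gt_eqF // expR_gt0.
Qed.

Lemma Rintegral_even (f : R -> R) : (forall x, 0 <= f x) -> continuous f ->
  (forall x, f (- x) = f x) -> mu.-integrable setT (EFin \o f) ->
  \int[mu]_x f x = 2 * \int[mu]_(x in `]0, +oo[) f x.
Proof.
move=> f0 cf ev fi.
have fD : mu.-integrable `]0, +oo[ (EFin \o f).
  by apply: (@integrableS _ _ _ mu setT).
rewrite (@Rintegral_itv_obnd_cbnd _ _ (BInfty _ false)) //.
rewrite /Rintegral ge0_symfun_integralT //; last by move=> x /=; rewrite ev.
rewrite -set_itvcy fineM //.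
have fD' : mu.-integrable `[0, +oo[ (EFin \o f).
  by apply: (@integrableS _ _ _ mu setT).
exact: (integrable_fin_num _ fD').
Qed.

(** The Gaussian is its own Fourier transform, by [cgauss_line]; it is even, so the
    transform is a cosine transform over the half-line. *)
Theorem gauss_cosine_transform x : 0 <= x ->
  gauss x = \int[mu]_(y in `]0, +oo[) (2 * cos (2 * pi * x * y) * gauss y).
Proof.
move=> x0; have [ig g1] := gauss_mass; have ic := gauss_cos_integrable x.
have icg := integrable_addr measurableT ic ig.
have cc : continuous (fun y => cos (2 * pi * x * y) * gauss y).
  move=> y; apply: cvgM; last exact: gauss_cont.
  have h : {for y, continuous (fun y => 2 * pi * x * y)} by apply: cvgMr; exact: cvg_id.
  by apply: (cvg_comp _ _ h); exact: continuous_cos.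
have gN y : gauss (- y) = gauss y by rewrite /gauss sqrrN.
have e1 := Rintegral_even gauss_ge0 gauss_cont gN ig.
(* the cosine changes sign; adding the Gaussian makes the integrand nonnegative *)
have e2 : \int[mu]_y (cos (2 * pi * x * y) * gauss y + gauss y) =
    2 * \int[mu]_(y in `]0, +oo[) (cos (2 * pi * x * y) * gauss y + gauss y).
  apply: Rintegral_even => //.
  - move=> y; rewrite -{2}[gauss y]mul1r -mulrDl; apply: mulr_ge0; last exact: gauss_ge0.
    by have := cos_geN1 (2 * pi * x * y); lra.
  - by move=> y; apply: cvgD; [exact: cc|exact: gauss_cont].
  - by move=> y; rewrite gN mulrN cosN.
have sub (f : R -> R) : mu.-integrable setT (EFin \o f) -> mu.-integrable `]0, +oo[ (EFin \o f).
  by move=> h; apply: (@integrableS _ _ _ mu setT).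
move: e2; rewrite !RintegralD // ?gauss_fourier //; try exact: sub.
rewrite e1 mulrDr => /addIr ->.
rewrite -RintegralZl //; last exact: sub.
by apply: eq_Rintegral => y _; rewrite mulrA.
Qed.

End GaussianTransform.

Section ArchimedeanFactor.
Context (R : realType).
Local Notation mu := (@lebesgue_measure R).
Implicit Types (z : R[i]) (x y : R).

Lemma climitZ (u : nat -> R[i]) (a c : R[i]) : normc (u n - a) @[n --> \oo] --> (0 : R) ->
  normc (c * u n - c * a) @[n --> \oo] --> (0 : R).
Proof.
move=> ua; under eq_fun do rewrite -mulrBr normcM.
by rewrite -(mulr0 (normc c)); apply: cvgMr.
Qed.

Lemma gauss_le_exp x : 0 <= x -> gauss x <= expR 1 * expR (- x).
Proof.
move=> x0; rewrite -expRD ler_expR lerNl opprD opprK.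
have h : 1 <= pi :> R by have := @pi_ge2 R; lra.
have h2 : x ^+ 2 <= pi * x ^+ 2 by rewrite ler_peMl // sqr_ge0.
have : 0 <= (x - 1) ^+ 2 := sqr_ge0 _; rewrite expr2 in h2 *; nra.
Qed.

Lemma gauss_mellin_cintegrable z : 0 < Re z ->
  cintegrable `]0, +oo[ (fun x => (2 * gauss x)%:C * cpow x (z - 1)).
Proof.
move=> z0; have ig := integrable_scaler (2 * expR 1) (measurable_itv _) (gamma_integrable z0).
apply: le_cintegrable ig => //.
- apply: (cmeasurableS measurableT) => //; apply: cmeasurable_mul; last exact: cpow_measurable.
  apply: cmeasurable_real; apply: measurable_funM => //.
  exact: continuous_measurable_fun (@gauss_cont R).
- move=> x; rewrite /= in_itv /= andbT => x0.
  rewrite normcM normcC normc_cpow // Re_sub1 ger0_norm ?mulr_ge0 ?gauss_ge0 //.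
  have := gauss_le_exp (ltW x0); have := powR_ge0 x (Re z - 1).
  set p := powR _ _; set e := expR (- x) => p0 h.
  have := ler_wpM2l p0 h; lra.
Qed.

Definition gauss_mellin z : R[i] :=
  cintegral `]0, +oo[ (fun x => (2 * gauss x)%:C * cpow x (z - 1)).

Lemma Re_half z : Re (z / 2) = Re z / 2.
Proof. by rewrite natC -fmorphV Re_mul /= mulr0 subr0. Qed.

Lemma archimedean_factor_euler z : 0 < Re z ->
  local_factor archimedean z = cpow pi (- (z / 2)) * Euler_integral (z / 2).
Proof.
move=> z0; rewrite /= /Gamma (_ : Num.truncn _ = 0%N).
  by rewrite big_ord0 divr1 addr0 mulNr.
by apply/truncn0Pn; rewrite -ltNge Re_half; lra.
Qed.

Lemma archimedean_factor_neq0 z : 0 < Re z -> local_factor archimedean z != 0.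
Proof.
move=> z0; rewrite archimedean_factor_euler // mulf_neq0 ?cpow_neq0 // euler_neq0 //.
by rewrite Re_half divr_gt0.
Qed.

(** Substitute t = pi x^2 in Euler's integral. *)
Theorem archimedean_factorE z : 0 < Re z -> local_factor archimedean z = gauss_mellin z.
Proof.
move=> z0; have r0 : 0 < Re (z / 2) by rewrite Re_half divr_gt0.
rewrite archimedean_factor_euler //.
have [mD sD nD] := halfline_exhaust R.
pose h x : R := pi * x ^+ 2.
pose E n : set R := `[h (n.+1%:R)^-1, h n.+1%:R]%classic.
pose f t : R[i] := cpow t (z / 2 - 1) * (expR (- t))%:C.
have p0 : 0 < pi :> R := pi_gt0 R.
have p1 : 1 <= pi :> R by have := @pi_ge2 R; lra.
have lim1 : normc (cintegral (E n) f - Euler_integral (z / 2)) @[n --> \oo] --> (0 : R).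
  apply: cintegral_exhaust => //; last exact: euler_cintegrable.
  - by move=> n; exact: measurable_itv.
  - move=> n t; rewrite /E /= !in_itv /= andbT => /andP[ht _].
    by apply: lt_le_trans ht; rewrite mulr_gt0 // exprn_gt0 // invr_gt0.
  - move=> t; rewrite /= in_itv /= andbT => t0; near=> n.
    have n1 : 1 <= n.+1%:R :> R by rewrite ler1n.
    have nn : n%:R <= n.+1%:R :> R by rewrite ler_nat.
    have sq : n.+1%:R <= n.+1%:R ^+ 2 :> R by rewrite expr2 ler_peMl.
    rewrite /E /= in_itv /= /h; apply/andP; split.
      rewrite exprVn ler_pdivrMr ?exprn_gt0 // mulrC -ler_pdivrMr //.
      by apply: le_trans sq; apply: le_trans nn; near: n; exact: nbhs_infty_ger.
    apply: (@le_trans _ _ n.+1%:R).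
      by apply: le_trans nn; near: n; exact: nbhs_infty_ger.
    by apply: le_trans sq _; rewrite ler_peMl // exprn_ge0.
have lim2 := climitZ (cpow pi (z / 2))
  (cintegral_exhaust (measurable_itv _) mD sD nD (gauss_mellin_cintegrable z0)).
have e n : cintegral (E n) f = cpow pi (z / 2) *
    cintegral `[n.+1%:R^-1, n.+1%:R] (fun x => (2 * gauss x)%:C * cpow x (z - 1)).
  have pos x : n.+1%:R^-1 <= x -> 0 < x by apply: lt_le_trans; rewrite invr_gt0.
  transitivity (cintegral `[n.+1%:R^-1, n.+1%:R] (fun x => (2 * pi * x)%:C * f (h x))); last first.
    rewrite -cintegralZ //.
      apply: eq_cintegral => x; rewrite /= in_itv /= => /andP[/pos x0 _].
      rewrite /f /gauss /h expr2 cpowM ?mulr_gt0 // cpowM //.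
      have -> : cpow pi (z / 2 - 1) = cpow pi (z / 2) / (pi : R)%:C.
        by rewrite cpowD cpowN cpow1.
      have -> : cpow x (z / 2 - 1) * cpow x (z / 2 - 1) = cpow x (z - 1) * (x%:C)^-1.
        rewrite -cpowD -(cpow1 x0) -cpowN -cpowD; congr cpow.
        rewrite [in RHS](splitr z); ring.
      rewrite !rmorphM /=.
      have xn : x%:C != 0 :> R[i] by rewrite eq_complex negb_and /= gt_eqF.
      have pn : (pi : R)%:C != 0 :> R[i] by rewrite eq_complex negb_and /= gt_eqF.
      move: xn pn; move: (x%:C) ((pi : R)%:C) => X P xn pn.
      by field; rewrite xn pn.
    apply: cintegrableS (gauss_mellin_cintegrable z0) => //.
  apply: (@csubst R h (fun x => 2 * pi * x)).
  - by rewrite (@le_trans _ _ 1) ?ler1n // invf_le1 // ler1n.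
  - move=> x y; rewrite !in_itv /= => /andP[/pos x0 _] /andP[/pos y0 _] xy.
    by rewrite /h ltr_pM2l // ltr_pXn2r ?nnegrE // ltW.
  - move=> x; rewrite /h; have d := is_deriveX 1 (is_derive_id x (1 : R)).
    by apply: is_derive_eq; rewrite /GRing.scale /=; ring.
  - by move=> x; apply: cvgMr; exact: cvg_id.
  - move=> x /andP[hx _]; have x0 : 0 < x.
      by apply: lt_le_trans hx; rewrite mulr_gt0 // exprn_gt0 // invr_gt0.
    apply: ccont_mul; first exact: ccont_cpow.
    exact: cder_ccont (cder_real (is_derive_expRN x)).
have -> : Euler_integral (z / 2) = cpow pi (z / 2) * gauss_mellin z.
  apply: (climit_unique lim1); under eq_fun do rewrite e.
  exact: lim2.
by rewrite mulrA -cpowD addNr cpow0 mul1r.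
Unshelve. all: end_near. Qed.

Lemma gauss_mellin_conj z : 0 < Re z -> gauss_mellin z^*%C = (gauss_mellin z)^*%C.
Proof.
move=> z0; rewrite /gauss_mellin -cintegral_conj //; last exact: gauss_mellin_cintegrable.
apply: eq_cintegral => x _; rewrite conjcM -cpow_conj conjcB.
by congr (_ * cpow _ (_ - _)); apply: complexP => //=; rewrite oppr0.
Qed.

End ArchimedeanFactor.

(** * The Mellin transform of the cosine *)

Section CosineMellin.
Context (R : realType).
Local Notation mu := (@lebesgue_measure R).

Lemma cintegral_obnd_cbnd (a : R) (b : itv_bound R) (f : R -> R[i]) :
  cintegrable [set` Interval (BRight a) b] f ->
  cintegral [set` Interval (BRight a) b] f = cintegral [set` Interval (BLeft a) b] f.
Proof.
move=> fi; rewrite /cintegral; congr (_ +i* _); apply: Rintegral_itv_obnd_cbnd.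
- exact: (cintegrable_Re (measurable_itv _) fi).
- exact: (cintegrable_Im (measurable_itv _) fi).
Qed.

Lemma normc_cintegral_sub (D D' : set R) (f : R -> R[i]) (g : R -> R) :
  measurable D -> measurable D' -> D `<=` D' -> cmeasurable D f ->
  (forall x, D' x -> 0 <= g x) ->
  (forall x, D x -> normc (f x) <= g x) -> mu.-integrable D' (EFin \o g) ->
  normc (cintegral D f) <= \int[mu]_(x in D') g x.
Proof.
move=> mD mD' sub mf g0 fg gi.
have gD : mu.-integrable D (EFin \o g) by apply: (@integrableS _ _ _ mu D').
have fi := le_cintegrable mD mf fg gD.
apply: le_trans (normc_cintegral mD fi) _.
apply: (@le_trans _ _ (\int[mu]_(x in D) g x)).
  exact: (@le_Rintegral _ _ _ mu _ _ _ mD (cintegrable_normc mD fi) gD).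
rewrite -lee_fin /Rintegral !fineK; [|exact: (integrable_fin_num _ gi)|
  exact: (integrable_fin_num _ gD)].
by apply: ge0_subset_integral => //; exact: measurable_int _ gi.
Qed.

Lemma powR_integrable0 (r X : R) : 0 < r ->
  mu.-integrable `]0, X] (EFin \o (fun x => x `^ (r - 1))).
Proof.
move=> r0; have sub : (`]0, X]%classic : set R) `<=` `]0, +oo[%classic.
  by move=> x /=; rewrite !in_itv /= andbT => /andP[].
have gi : mu.-integrable `]0, X] (EFin \o (fun t => t `^ (r - 1) * expR (- t))).
  by apply: (@integrableS _ _ _ mu `]0, +oo[%classic) => //; exact: gamma_integrable.
apply: le_integrable (integrable_scaler (expR X) (measurable_itv _) gi) => //.
  by apply/measurable_EFinP; apply: measurable_funTS; exact: measurable_powR.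
move=> x; rewrite /= in_itv /= => /andP[x0 xX]; rewrite lee_fin.
rewrite ger0_norm ?powR_ge0 // ger0_norm ?mulr_ge0 ?powR_ge0 ?expR_ge0 //.
rewrite mulrCA -expRD ler_peMr ?powR_ge0 // -[leLHS]expR0 ler_expR.
by rewrite subr_ge0.
Qed.

Lemma climit_sub (u v : nat -> R[i]) (a b : R[i]) :
  normc (u n - a) @[n --> \oo] --> (0 : R) -> normc (v n - b) @[n --> \oo] --> (0 : R) ->
  normc (u n + v n - (a + b)) @[n --> \oo] --> (0 : R).
Proof.
move=> ua vb; have h : normc (u n - a) + normc (v n - b) @[n --> \oo] --> (0 : R).
  by rewrite -[X in _ --> X]addr0; exact: cvgD.
apply: (@squeeze_cvgr _ _ _ _ (cst 0) _ _ _ _ _ h); last exact: cvg_cst.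
apply: nearW => n; rewrite normc_ge0 /= opprD addrACA.
exact: le_normcD.
Qed.

Context (z : R[i]).
Hypotheses (z0 : 0 < Re z) (z1 : Re z < 1).

Definition cos_kernel (q x : R) : R[i] := (2 * cos (2 * pi * q * x))%:C * cpow x (z - 1).

Definition cos_mellin_partial (q X : R) : R[i] := cintegral `]0, X] (cos_kernel q).

(** The primitive of 2 cos(2 pi q x) that vanishes at 0. *)
Definition sin_ratio (q x : R) : R := sin (2 * pi * q * x) / (pi * q).

Definition sin_mellin (q : R) : R[i] :=
  cintegral `[1, +oo[ (fun x => (sin_ratio q x)%:C * cpow x (z - 2)).

(** The limit of [cos_mellin_partial], written after integration by parts: the
    Mellin integral of the cosine over (1, oo) converges conditionally only. *)
Definition cos_mellin (q : R) : R[i] :=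
  - (sin_ratio q 1)%:C + (1 - z) * sin_mellin q + cos_mellin_partial q 1.

Lemma cos_kernel_measurable q : cmeasurable setT (cos_kernel q).
Proof.
apply: cmeasurable_mul; last exact: cpow_measurable.
apply: cmeasurable_real; apply: measurable_funM => //.
by apply: (measurableT_comp (continuous_measurable_fun (@continuous_cos R))).
Qed.

Lemma normc_cos_kernel q x : 0 < x -> normc (cos_kernel q x) <= 2 * x `^ (Re z - 1).
Proof.
move=> x0; rewrite normcM normcC normc_cpow // Re_sub1; apply: ler_wpM2r; first exact: powR_ge0.
rewrite normrM ger0_norm // ler_piMr //.
by rewrite ler_norml cos_geN1 cos_le1.
Qed.

Lemma cos_kernel_cintegrable q X : cintegrable `]0, X] (cos_kernel q).
Proof.
apply: le_cintegrable (integrable_scaler 2 (measurable_itv _) (powR_integrable0 X z0)) => //.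
  by apply: (cmeasurableS measurableT) => //; exact: cos_kernel_measurable.
by move=> x; rewrite /= in_itv /= => /andP[/normc_cos_kernel].
Qed.

Lemma sin_ratio_le q x : 0 < q -> `|sin_ratio q x| <= (pi * q)^-1.
Proof.
move=> q0; have pq : 0 < pi * q by rewrite mulr_gt0 ?pi_gt0.
have pq' : 0 <= (pi * q)^-1 by rewrite invr_ge0 ltW.
rewrite /sin_ratio normrM [X in _ * X]ger0_norm // ler_piMl //.
by rewrite ler_norml sin_geN1 sin_le1.
Qed.

Lemma sin_ratio_measurable q : measurable_fun setT (sin_ratio q).
Proof.
apply: measurable_funM => //.
by apply: (measurableT_comp (continuous_measurable_fun (@continuous_sin R))).
Qed.

Lemma is_derive_sin_ratio q x : q != 0 ->
  is_derive x (1 : R) (sin_ratio q) (2 * cos (2 * pi * q * x)).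
Proof.
move=> q0; have p0 : (pi : R) != 0 by rewrite gt_eqF ?pi_gt0.
have d1 : is_derive x (1 : R) (fun x => 2 * pi * q * x) (2 * pi * q).
  rewrite (_ : (fun x => _) = (2 * pi * q) *: id) //.
  by apply: is_derive_eq; rewrite /GRing.scale /= mulr1.
have d2 := is_derive1_comp (is_derive_sin (2 * pi * q * x)) d1.
rewrite (_ : sin_ratio q = (pi * q)^-1 *: (sin \o (fun x => 2 * pi * q * x))); last first.
  by apply/funext => t; rewrite /sin_ratio mulrC.
apply: is_derive_eq; rewrite /GRing.scale /=.
by move: (pi : R) p0 (cos _) => p p0 c; field; rewrite p0 q0.
Qed.

Lemma sin_mellin_bound q x : 0 < q -> 0 < x ->
  normc ((sin_ratio q x)%:C * cpow x (z - 2)) <= (pi * q)^-1 * x `^ (- (1 - Re z) - 1).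
Proof.
move=> q0 x0; rewrite normcM normcC normc_cpow //.
rewrite (_ : Re (z - 2) = - (1 - Re z) - 1); last by rewrite natC Re_add Re_opp /=; lra.
by apply: ler_wpM2r; [exact: powR_ge0|exact: sin_ratio_le].
Qed.

Lemma sin_mellin_measurable q : cmeasurable setT (fun x => (sin_ratio q x)%:C * cpow x (z - 2)).
Proof.
apply: cmeasurable_mul; last exact: cpow_measurable.
by apply: cmeasurable_real; exact: sin_ratio_measurable.
Qed.

Lemma sin_mellin_dominated q :
  mu.-integrable `[1, +oo[ (EFin \o (fun x => (pi * q)^-1 * x `^ (- (1 - Re z) - 1))).
Proof.
apply: (integrable_scaler _ (measurable_itv _)).
by apply: powR_integrable1y; rewrite subr_gt0.
Qed.

Lemma pos1y (x : R) : (`[1, +oo[%classic : set R) x -> 0 < x.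
Proof. by rewrite /= in_itv /= andbT; exact: lt_le_trans. Qed.

Lemma sin_mellin_cintegrable q : 0 < q ->
  cintegrable `[1, +oo[ (fun x => (sin_ratio q x)%:C * cpow x (z - 2)).
Proof.
move=> q0; apply: le_cintegrable (sin_mellin_dominated q) => //.
  by apply: (cmeasurableS measurableT) => //; exact: sin_mellin_measurable.
by move=> x /pos1y; exact: sin_mellin_bound.
Qed.

Lemma cos_mellin_by_parts q X : 0 < q -> 1 < X ->
  cos_mellin_partial q X = - (sin_ratio q 1)%:C +
    (1 - z) * cintegral `[1, X] (fun x => (sin_ratio q x)%:C * cpow x (z - 2)) +
    cos_mellin_partial q 1 + (sin_ratio q X)%:C * cpow X (z - 1).
Proof.
move=> q0 X1; have X1' := ltW X1.
pose F x : R[i] := (sin_ratio q x)%:C * cpow x (z - 1).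
pose g x : R[i] := (sin_ratio q x)%:C * cpow x (z - 2).
have pos (x : R) : 1 <= x -> 0 < x by exact: lt_le_trans.
have dF x : 0 < x -> cder F x (cos_kernel q x + (z - 1) * g x).
  move=> x0; have d := is_derive_sin_ratio x (lt0r_neq0 q0).
  apply: cder_eq (cder_mul (cder_real d) (cder_cpow (z - 1) x0)) _.
  by rewrite /cos_kernel /g (_ : z - 1 - 1 = z - 2) //; ring.
have cg x : 0 < x -> ccont_at g x.
  move=> x0; apply: ccont_mul; last exact: ccont_cpow.
  exact: cder_ccont (cder_real (is_derive_sin_ratio x (lt0r_neq0 q0))).
have ck x : 0 < x -> ccont_at (cos_kernel q) x.
  move=> x0; apply: ccont_mul; last exact: ccont_cpow.
  split => /=; last exact: cvg_cst.
  apply: cvgMr; have h : {for x, continuous (fun x => 2 * pi * q * x)}.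
    by apply: cvgMr; exact: cvg_id.
  exact: (cvg_comp _ _ h (@continuous_cos R _)).
have ik : cintegrable `[1, X] (cos_kernel q).
  by apply: ccont_cintegrable => x /andP[/pos x0 _]; exact: ck.
have ig : cintegrable `[1, X] g.
  by apply: ccont_cintegrable => x /andP[/pos x0 _]; exact: cg.
have FTC : cintegral `[1, X] (fun x => cos_kernel q x + (z - 1) * g x) = F X - F 1.
  apply: (cFTC X1) => x /andP[/pos x0 _]; first exact: (dF x x0).
  exact: (ccont_add (ck x x0) (ccont_mul (ccont_cst _ x) (cg x x0))).
have split : cos_mellin_partial q X = cos_mellin_partial q 1 + cintegral `[1, X] (cos_kernel q).
  have iX := cos_kernel_cintegrable q X.
  (* the two pieces must be disjoint, whereas the fundamental theorem is stated on
     closed intervals *)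
  have U : (`]0, X]%classic : set R) = `]0, 1]%classic `|` `]1, X]%classic.
    apply/seteqP; split => x /=; rewrite !in_itv /=.
      by move=> /andP[x0 xX]; have [h|h] := leP x 1; [left|right]; rewrite ?x0 ?xX.
    case=> /andP[h1 h2]; first by rewrite h1 (le_trans h2).
    by rewrite h2 (lt_trans _ h1).
  rewrite /cos_mellin_partial U cintegral_setU //; last 2 first.
  - by rewrite -U.
  - apply/disj_setPS => x /=; rewrite !in_itv /= => -[/andP[_ h1] /andP[h2 _]].
    by move: (lt_le_trans h2 h1); rewrite ltxx.
  congr (_ + _); apply: cintegral_obnd_cbnd.
  apply: (cintegrableS _ _ _ ik) => // x /=; rewrite !in_itv /= => /andP[/ltW -> ->] //.
rewrite split; move: FTC; rewrite cintegralD // ?cintegralZ //; last exact: cintegrableZ.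
rewrite {2}/F cpow1l mulr1 => FTC.
have -> : cintegral `[1, X] (cos_kernel q) =
    F X - (sin_ratio q 1)%:C - (z - 1) * cintegral `[1, X] g by rewrite -FTC; ring.
by rewrite /F; ring.
Qed.

(** Uniformity in X is what allows dominated convergence in
    [gauss_mellin_reflection]. *)
Lemma cos_mellin_partial_bounded q : 0 < q ->
  exists C : R, forall X, 0 < X -> normc (cos_mellin_partial q X) <= C.
Proof.
move=> q0; have pq : 0 < (pi * q)^-1 by rewrite invr_gt0 mulr_gt0 ?pi_gt0.
pose C1 := \int[mu]_(x in `]0, 1]) (2 * x `^ (Re z - 1)).
pose C2 := \int[mu]_(x in `[1, +oo[) ((pi * q)^-1 * x `^ (- (1 - Re z) - 1)).
have i1 := integrable_scaler 2 (measurable_itv _) (powR_integrable0 1 z0).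
have C10 : 0 <= C1 by apply: Rintegral_ge0 => x _; rewrite mulr_ge0 ?powR_ge0.
have C20 : 0 <= C2 by apply: Rintegral_ge0 => x _; rewrite mulr_ge0 ?powR_ge0 // ltW.
have b1 X : X <= 1 -> normc (cos_mellin_partial q X) <= C1.
  move=> X1; apply: normc_cintegral_sub i1 => //.
  - by move=> x /=; rewrite !in_itv /= => /andP[-> h]; exact: le_trans h X1.
  - by apply: (cmeasurableS measurableT) => //; exact: cos_kernel_measurable.
  - by move=> x _; rewrite mulr_ge0 ?powR_ge0.
  - by move=> x; rewrite /= in_itv /= => /andP[/normc_cos_kernel].
exists (C1 + ((pi * q)^-1 + normc (1 - z) * C2 + (pi * q)^-1)) => X X0.
have [X1|X1] := leP X 1.
  apply: le_trans (b1 X X1) _; have h := mulr_ge0 (normc_ge0 (1 - z)) C20.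
  by have := pq; lra.
rewrite cos_mellin_by_parts // [leRHS]addrC.
have b2 : normc (cintegral `[1, X] (fun x => (sin_ratio q x)%:C * cpow x (z - 2))) <= C2.
  apply: normc_cintegral_sub (sin_mellin_dominated q) => //.
  - by move=> x /=; rewrite !in_itv /= andbT => /andP[].
  - by apply: (cmeasurableS measurableT) => //; exact: sin_mellin_measurable.
  - by move=> x _; rewrite mulr_ge0 ?powR_ge0 // ltW.
  - move=> x; rewrite /= in_itv /= => /andP[x1 _]; apply: sin_mellin_bound => //.
    exact: lt_le_trans x1.
rewrite -[leLHS]/(normc _) (_ : _ + _ + _ + _ = - (sin_ratio q 1)%:C +
    (1 - z) * cintegral `[1, X] (fun x => (sin_ratio q x)%:C * cpow x (z - 2)) +
    (sin_ratio q X)%:C * cpow X (z - 1) + cos_mellin_partial q 1); last by ring.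
apply: le_trans (le_normcD _ _) _; apply: lerD; last exact: b1.
apply: le_trans (le_normcD _ _) _; apply: lerD.
  apply: le_trans (le_normcD _ _) _; apply: lerD.
    by rewrite normcN normcC; exact: sin_ratio_le.
  by rewrite normcM; apply: ler_wpM2l => //; exact: normc_ge0.
rewrite normcM normcC normc_cpow // Re_sub1 -[leRHS]mulr1.
apply: ler_pM; rewrite ?powR_ge0 ?sin_ratio_le //.
by rewrite -[leRHS](powRr0 X); apply: ler_powR; [exact: ltW|rewrite subr_le0; exact: ltW].
Qed.

Lemma cos_mellin_limit q c : 0 < q -> 0 < c ->
  normc (cos_mellin_partial q (n.+1%:R * c) - cos_mellin q) @[n --> \oo] --> (0 : R).
Proof.
move=> q0 c0; have X0 n : 0 < n.+1%:R * c by rewrite mulr_gt0.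
pose s x : R[i] := (sin_ratio q x)%:C * cpow x (z - 2).
have big (A : R) : \forall n \near \oo, A <= n.+1%:R * c.
  near=> n; rewrite -ler_pdivrMr //; apply: (@le_trans _ _ n%:R).
    by near: n; exact: nbhs_infty_ger.
  by rewrite ler_nat.
have lim1 : normc (cintegral `[1, n.+1%:R * c] s - sin_mellin q) @[n --> \oo] --> (0 : R).
  apply: (cintegral_exhaust (measurable_itv `[1, +oo[) (fun n => measurable_itv _)).
  - by move=> n x /=; rewrite !in_itv /= andbT => /andP[].
  - move=> x; rewrite /= in_itv /= andbT => x1; apply: filterS (big x) => n h.
    by rewrite /= in_itv /= x1.
  - exact: sin_mellin_cintegrable.
have lim2 : normc ((sin_ratio q (n.+1%:R * c))%:C * cpow (n.+1%:R * c) (z - 1) - 0)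
    @[n --> \oo] --> (0 : R).
  apply: (@squeeze_cvgr _ _ _ _ (cst 0)
    (fun n : nat => (pi * q)^-1 * (c `^ (Re z - 1) * n.+1%:R^-1 `^ (1 - Re z)))); last 2 first.
  - exact: cvg_cst.
  - rewrite -[X in _ --> X](mulr0 ((pi * q)^-1)); apply: cvgMr.
    rewrite -[X in _ --> X](mulr0 (c `^ (Re z - 1))); apply: cvgMr.
    by apply: powR_inv_cvg0; rewrite subr_gt0.
  apply: nearW => n; rewrite normc_ge0 /= subr0 normcM normcC normc_cpow // Re_sub1.
  have -> : (n.+1%:R * c) `^ (Re z - 1) = c `^ (Re z - 1) * n.+1%:R^-1 `^ (1 - Re z).
    rewrite powRM ?(ltW c0) // mulrC; congr (_ * _).
    by rewrite -(@powR_inv1 _ n.+1%:R) // -powRrM mulN1r opprB.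
  by apply: ler_wpM2r; rewrite ?mulr_ge0 ?powR_ge0 ?sin_ratio_le.
have lim3 := climit_sub (climitZ (1 - z) lim1) lim2.
apply: cvg_trans lim3; apply: near_eq_cvg; apply: filterS (big 2) => n h.
rewrite cos_mellin_by_parts //; last by apply: lt_le_trans h; rewrite ltr1n.
by rewrite /cos_mellin -/s; congr normc; ring.
Unshelve. all: end_near. Qed.

(** The substitution of q x for x. *)
Lemma cos_mellin_scale q X : 0 < q -> 0 < X ->
  cos_mellin_partial 1 (q * X) = cpow q z * cos_mellin_partial q X.
Proof.
move=> q0 X0; have qX0 : 0 < q * X by rewrite mulr_gt0.
have inv0 n : 0 < n.+1%:R^-1 :> R by rewrite invr_gt0.
have inv1 n : n.+1%:R^-1 <= 1 :> R by rewrite invf_le1 // ler1n.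
have exh (Y : R) (f : R -> R[i]) : 0 < Y -> cintegrable `]0, Y] f ->
    normc (cintegral `[n.+1%:R^-1 * Y, Y] f - cintegral `]0, Y] f) @[n --> \oo] --> (0 : R).
  move=> Y0; apply: cintegral_exhaust => //.
  - by move=> n x /=; rewrite !in_itv /= => /andP[h ->]; rewrite andbT (lt_le_trans _ h) // mulr_gt0.
  - move=> x; rewrite /= in_itv /= => /andP[x0 xY]; near=> n; rewrite /= in_itv /= xY andbT.
    rewrite mulrC ler_pdivrMr // mulrC -ler_pdivrMr //; apply: (@le_trans _ _ n%:R).
      by near: n; exact: nbhs_infty_ger.
    by rewrite ler_nat.
have lim1 := exh _ _ qX0 (cos_kernel_cintegrable 1 (q * X)).
have lim2 := climitZ (cpow q z) (exh _ _ X0 (cos_kernel_cintegrable q X)).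
apply: (climit_unique lim1).
rewrite (_ : (fun n => _) = (fun n : nat => normc (cpow q z *
  cintegral `[n.+1%:R^-1 * X, X] (cos_kernel q) - cpow q z * cos_mellin_partial q X))) //.
apply/funext => n; congr normc; congr (_ - _).
have pos x : n.+1%:R^-1 * X <= x -> 0 < x by apply: lt_le_trans; rewrite mulr_gt0.
have nX : n.+1%:R^-1 * X <= X by rewrite ler_piMl // ltW.
transitivity (cintegral `[n.+1%:R^-1 * X, X] (fun x => q%:C * cos_kernel 1 (q * x))).
  rewrite mulrCA; apply: (@csubst R (fun x => q * x) (fun=> q)) => //.
  - by move=> x y _ _; rewrite ltr_pM2l.
  - move=> x; rewrite (_ : (fun x => _) = q *: id) //.
    by apply: is_derive_eq; rewrite /GRing.scale /= mulr1.
  - by move=> x; exact: cvg_cst.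
  - move=> x /andP[h _]; have x0 : 0 < x.
      by apply: lt_le_trans h; rewrite !mulr_gt0.
    apply: ccont_mul; last exact: ccont_cpow.
    split => /=; last exact: cvg_cst.
    apply: cvgMr; have hc : {for x, continuous (fun x => 2 * pi * 1 * x)}.
      by apply: cvgMr; exact: cvg_id.
    exact: (cvg_comp _ _ hc (@continuous_cos R _)).
rewrite -cintegralZ //.
  apply: eq_cintegral => x; rewrite /= in_itv /= => /andP[/pos x0 _].
  have -> : cpow q z = cpow q (z - 1) * q%:C by rewrite -(cpow1 q0) -cpowD subrK.
  rewrite /cos_kernel cpowM // (_ : 2 * pi * 1 * (q * x) = 2 * pi * q * x); first by ring.
  by ring.
apply: (cintegrableS _ _ _ (cos_kernel_cintegrable q X)) => // x /=; rewrite !in_itv /=.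
by move=> /andP[/pos -> ->].
Unshelve. all: end_near. Qed.

Theorem cos_mellin_homogeneous q : 0 < q -> cos_mellin 1 = cpow q z * cos_mellin q.
Proof.
move=> q0; have lim1 := cos_mellin_limit ltr01 q0.
apply: (climit_unique lim1).
have := climitZ (cpow q z) (cos_mellin_limit q0 ltr01).
by under eq_fun do rewrite mulr1 -cos_mellin_scale // mulrC.
Qed.

End CosineMellin.

Section FunctionalEquation.
Context (R : realType).
Local Notation mu := (@lebesgue_measure R).
Context (z : R[i]).
Hypotheses (z0 : 0 < Re z) (z1 : Re z < 1).

Let Y : set R := `]0, +oo[%classic.
Let mY : measurable Y := measurable_itv _.

(** The Gaussian is replaced by its cosine transform and the integrals are exchanged,
    which is legitimate on a bounded interval of x. *)
Lemma gauss_kernel_swap X : 0 < X ->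
  cintegral `]0, X] (fun x => (2 * gauss x)%:C * cpow x (z - 1)) =
  cintegral Y (fun y => (2 * gauss y)%:C * cos_mellin_partial z y X).
Proof.
move=> X0; have [ig _] := gauss_mass R.
have igY : mu.-integrable Y (EFin \o @gauss R) by apply: (@integrableS _ _ _ mu setT).
have ig2 := integrable_scaler 2 mY igY.
have mg : measurable_fun setT (@gauss R) by exact: continuous_measurable_fun (@gauss_cont R).
pose f x y : R[i] := (2 * gauss y)%:C * cos_kernel z y x.
transitivity (cintegral `]0, X] (fun x => cintegral Y (f x))).
  apply: eq_cintegral => x; rewrite /= in_itv /= => /andP[x0 _].
  rewrite {1}(gauss_cosine_transform (ltW x0)).
  have icos : mu.-integrable Y (EFin \o (fun y => 2 * cos (2 * pi * x * y) * gauss y)).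
    have h := integrable_scaler 2 measurableT (gauss_cos_integrable x).
    apply: (@integrableS _ _ _ mu setT) => //.
    by apply: eq_integrable h => // y _; rewrite /= mulrA.
  transitivity (cpow x (z - 1) * cintegral Y (fun y => (2 * (2 * cos (2 * pi * x * y) * gauss y))%:C)).
    by rewrite cintegral_real RintegralZl // mulrC.
  rewrite -cintegralZ //; last by apply: cintegrable_real => //; exact: integrable_scaler.
  apply: eq_cintegral => y _; rewrite /f /cos_kernel.
  rewrite (_ : 2 * pi * y * x = 2 * pi * x * y); last by ring.
  by rewrite !rmorphM /=; ring.
rewrite (cfubini_dominated (a := fun x => 2 * x `^ (Re z - 1)) (b := fun y => 2 * gauss y)) //.
- apply: eq_cintegral => y _; rewrite /f cintegralZ //.
  exact: cos_kernel_cintegrable.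
- apply: cmeasurable2_mul.
    by apply: cmeasurable2_2; apply: cmeasurable_real; exact: measurable_funM.
  apply: (@cmeasurable2_mul R (fun x y => (2 * cos (2 * pi * y * x))%:C)
    (fun x _ => cpow x (z - 1))); last exact: cmeasurable2_1 (cpow_measurable _).
  split => //=; apply: measurable_funM => //.
  apply: (measurableT_comp (continuous_measurable_fun (@continuous_cos R))).
  apply: measurable_funM; last exact: measurable_fst.
  by apply: measurable_funM => //; exact: measurable_snd.
- by move=> x _; rewrite mulr_ge0 ?powR_ge0.
- move=> x y; rewrite /= in_itv /= => /andP[x0 _] _; rewrite /f normcM normcC mulrC.
  rewrite ger0_norm ?mulr_ge0 ?gauss_ge0 //; apply: ler_wpM2r.
    by rewrite mulr_ge0 ?gauss_ge0.
  exact: normc_cos_kernel.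
- exact: (integrable_scaler _ (measurable_itv _) (powR_integrable0 X z0)).
Qed.

(** In [gauss_kernel_swap], the inner integral over (0, X) is y^(-z) times the partial
    Mellin integral up to X y.  When X tends to infinity it tends to
    y^(-z) [cos_mellin z 1]. *)
Theorem gauss_mellin_reflection :
  gauss_mellin z = cos_mellin z 1 * gauss_mellin (1 - z).
Proof.
have w0 : 0 < Re (1 - z) by rewrite Re_add Re_opp subr_gt0.
have [C hC] := cos_mellin_partial_bounded z0 z1 (ltr01 : 0 < 1 :> R).
pose G y : R[i] := (2 * gauss y)%:C * cpow y (1 - z - 1).
have Gi : cintegrable Y G := gauss_mellin_cintegrable w0.
pose D_ n : set R := `]0, n.+1%:R]%classic.
have lim1 : normc (cintegral (D_ n) (fun x => (2 * gauss x)%:C * cpow x (z - 1)) - gauss_mellin z)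
    @[n --> \oo] --> (0 : R).
  apply: cintegral_exhaust; last exact: gauss_mellin_cintegrable.
  - by [].
  - by move=> n; exact: measurable_itv.
  - by move=> n x; rewrite /D_ /= !in_itv /= andbT => /andP[].
  - move=> x; rewrite /= in_itv /= andbT => x0; near=> n; rewrite /D_ /= in_itv /= x0 /=.
    by apply: (@le_trans _ _ n%:R); [near: n; exact: nbhs_infty_ger|rewrite ler_nat].
have posY y : Y y -> 0 < y by rewrite /Y /= in_itv /= andbT.
pose f_ n y : R[i] := (2 * gauss y)%:C * cos_mellin_partial z y n.+1%:R.
have mg : measurable_fun setT (@gauss R) by exact: continuous_measurable_fun (@gauss_cont R).
have mf n : cmeasurable Y (f_ n).
  apply: (cmeasurableS measurableT) => //; apply: cmeasurable_mul.
    by apply: cmeasurable_real; exact: measurable_funM.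
  apply: ccont_cmeasurable => y.
  apply: (cintegral_param_ccont (g := fun x => 2 * x `^ (Re z - 1))) => //.
  - by move=> q; apply: (cmeasurableS measurableT) => //; exact: cos_kernel_measurable.
  - move=> x _; apply: ccont_mul; last exact: ccont_cst.
    split => /=; last exact: cvg_cst.
    apply: cvgMr; have h : {for y, continuous (fun q => 2 * pi * q * x)}.
      by apply: cvgMl; apply: cvgMr; exact: cvg_id.
    exact: (cvg_comp _ _ h (@continuous_cos R _)).
  - exact: (integrable_scaler _ (measurable_itv _) (powR_integrable0 _ z0)).
  - by move=> q x; rewrite /= in_itv /= => /andP[x0 _]; exact: normc_cos_kernel.
have fE n y : Y y -> f_ n y = cos_mellin_partial z 1 (y * n.+1%:R) * G y.
  move=> /posY y0; rewrite /f_ /G cos_mellin_scale // (_ : 1 - z - 1 = - z); last by ring.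
  rewrite cpowN; have := cpow_neq0 y z; move: (cpow y z) => c c0.
  by field.
have fb n y : Y y -> normc (f_ n y) <= C * normc (G y).
  move=> Yy; rewrite fE // normcM; apply: ler_wpM2r; first exact: normc_ge0.
  by apply: hC; rewrite mulr_gt0 // posY.
have flim y : Y y -> normc (f_ n y - cos_mellin z 1 * G y) @[n --> \oo] --> (0 : R).
  move=> Yy; have y0 := posY _ Yy.
  have h := climitZ (G y) (cos_mellin_limit z0 z1 ltr01 y0).
  under eq_fun do rewrite fE // mulrC (mulrC y) (mulrC (cos_mellin z 1)).
  exact: h.
have [_ lim2] := cdominated mY mf flim
  (integrable_scaler C mY (cintegrable_normc mY Gi)) fb.
rewrite cintegralZ // in lim2.
apply: (climit_unique lim1); apply: cvg_trans lim2; apply: near_eq_cvg; apply: nearW => n.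
by rewrite gauss_kernel_swap.
Unshelve. all: end_near. Qed.

End FunctionalEquation.

(** * The archimedean ratio on the critical line *)

Section ArchimedeanRatio.
Context (R : realType).
Local Notation mu := (@lebesgue_measure R).
Implicit Types (t : R).
Local Notation cl := (@critical_line R).

Definition arch_ratio t : R[i] := local_ratio archimedean (cl t).

Lemma Re_cl_gt0 t : 0 < Re (cl t). Proof. by rewrite /= invr_gt0. Qed.

Lemma Re_cl_lt1 t : Re (cl t) < 1. Proof. by rewrite /= invf_lt1 // ltr1n. Qed.

Lemma cl_reflect t : 1 - cl t = (cl t)^*%C.
Proof. by apply: complexP => /=; lra. Qed.

(** On the critical line 1 - z is the conjugate of z, so the ratio is the quotient of
    a nonzero number by its conjugate. *)
Lemma normc_arch_ratio t : normc (arch_ratio t) = 1.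
Proof.
have z0 := Re_cl_gt0 t; have z0' : 0 < Re (cl t)^*%C by rewrite Re_conj.
rewrite /arch_ratio /local_ratio cl_reflect; have := archimedean_factor_neq0 z0.
rewrite !archimedean_factorE // gauss_mellin_conj // => n0.
by rewrite normcM normcV normc_conj divff // normc_eq0.
Qed.

Lemma arch_ratioE t : arch_ratio t = cos_mellin (cl t) 1.
Proof.
have z0 := Re_cl_gt0 t; have z1 := Re_cl_lt1 t.
have w0 : 0 < Re (1 - cl t) by rewrite Re_add Re_opp subr_gt0.
rewrite /arch_ratio /local_ratio; have := archimedean_factor_neq0 w0.
rewrite !archimedean_factorE // (gauss_mellin_reflection z0 z1) => n0.
by rewrite mulfK.
Qed.

Section Dilation.
Context (q : R) (q0 : 0 < q).

(** The part of the Mellin integral over (0, 1). *)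
Definition near_part t : R[i] := cos_mellin_partial (cl t) q 1.

(** The modulus of x^(z - 2) on the critical line is x^(-3/2). *)
Definition far_density (x : R) : R := sin_ratio q x * x `^ (- (1 / 2) - 1).

(** The part of the Mellin integral over (1, oo) after integration by parts, where
    1 - z is 1/2 - it. *)
Definition far_part t : R[i] :=
  - (sin_ratio q 1)%:C + (2^-1 +i* (- t)) * char_average `[1, +oo[%classic far_density t.

Lemma far_density_measurable : measurable_fun setT far_density.
Proof. by apply: measurable_funM; [exact: sin_ratio_measurable|exact: measurable_powR]. Qed.

Lemma far_density_integrable : mu.-integrable `[1, +oo[ (EFin \o far_density).
Proof.
have h := integrable_scaler (pi * q)^-1 (measurable_itv _) (@powR_integrable1y R (1 / 2) _).
apply: le_integrable (h _) => //.
  by apply/measurable_EFinP; apply: measurable_funTS; exact: far_density_measurable.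
move=> x _; rewrite /= lee_fin normrM (ger0_norm (powR_ge0 _ _)).
apply: le_trans (ler_norm _); apply: ler_wpM2r; first exact: powR_ge0.
exact: sin_ratio_le.
Qed.

(** Multiplying the ratio by q^(-z) amounts to dilating the cosine by q. *)
Lemma arch_ratio_dilated t : arch_ratio t = cpow q (cl t) * (far_part t + near_part t).
Proof.
rewrite arch_ratioE (cos_mellin_homogeneous (Re_cl_gt0 t) (Re_cl_lt1 t) q0).
congr (_ * _); rewrite /cos_mellin /far_part /near_part; congr (_ + _ * _ + _).
  by apply: complexP => /=; lra.
apply: eq_cintegral => x /pos1y x0.
transitivity ((sin_ratio q x)%:C * ((x `^ (- (1 / 2) - 1))%:C * ei (ln x) t)).
  by rewrite -cpow_critical //; congr (_ * cpow _ _); apply: complexP => /=; lra.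
by rewrite mulrA -rmorphM.
Qed.

Lemma near_part_bmul : bounded_multiplier near_part.
Proof.
have ig := integrable_scaler 2 (measurable_itv _) (@powR_integrable0 R 2^-1 1 _).
split.
  apply: ccont_cmeasurable => t.
  apply: (cintegral_param_ccont (g := fun x => 2 * x `^ (2^-1 - 1))) => //.
  - by move=> s; apply: (cmeasurableS measurableT) => //; exact: cos_kernel_measurable.
  - move=> x; rewrite /= in_itv /= => /andP[x0 _]; apply: ccont_mul; first exact: ccont_cst.
    rewrite (_ : (fun t => _) = (fun t => (x `^ (2^-1 - 1))%:C * ei (ln x) t)).
      by apply: ccont_mul; [exact: ccont_cst|exact: ei_ccont].
    apply/funext => s; rewrite -cpow_critical //; congr cpow.
    by apply: complexP => /=; rewrite ?subr0.
  - exact: ig.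
  - by move=> s x; rewrite /= in_itv /= => /andP[x0 _]; exact: normc_cos_kernel.
exists (\int[mu]_(x in `]0, 1]) (2 * x `^ (2^-1 - 1))) => t.
apply: normc_cintegral_sub (ig _) => //.
- by apply: (cmeasurableS measurableT) => //; exact: cos_kernel_measurable.
- by move=> x _; rewrite mulr_ge0 ?powR_ge0.
- by move=> x; rewrite /= in_itv /= => /andP[x0 _]; exact: normc_cos_kernel.
Qed.

End Dilation.

Lemma cpow_cl q t : 0 < q -> cpow q (cl t) = (q `^ 2^-1)%:C * ei (ln q) t.
Proof. exact: cpow_critical. Qed.

Lemma bmul_cpow_cl q : 0 < q -> bounded_multiplier (fun t => cpow q (cl t)).
Proof.
move=> q0; rewrite (_ : (fun t => _) = (fun t => (q `^ 2^-1)%:C * ei (ln q) t)).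
  exact: bmul_mul (bmul_cst _) (bmul_ei _).
by apply/funext => t; exact: cpow_cl.
Qed.

Lemma arch_ratio_bmul : bounded_multiplier arch_ratio.
Proof.
split; last by exists 1 => t; rewrite normc_arch_ratio.
rewrite (_ : arch_ratio = (fun t => cpow 1 (cl t) * (far_part 1 t + near_part 1 t))); last first.
  by apply/funext => t; exact: (arch_ratio_dilated ltr01).
apply: cmeasurable_mul; first exact: (bmul_cpow_cl ltr01).1.
apply: cmeasurable_add; last exact: (near_part_bmul 1).1.
apply: cmeasurable_add; first exact: cmeasurable_cst.
apply: cmeasurable_mul.
  by apply: ccont_cmeasurable => t; split => /=; [exact: cvg_cst|apply: cvgN; exact: cvg_id].
exact: (bmul_char_average (measurable_itv _) (far_density_measurable _)
  (far_density_integrable ltr01)).1.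
Qed.

End ArchimedeanRatio.

Section CosineApproximation.
Context (R : realType).

(** The tail of the cosine series on |x| <= a is bounded by the tail of the
    exponential series at a. *)
Lemma cos_series_uniform (a e : R) : 0 < e ->
  exists N, forall x, `|x| <= a -> `|cos x - \sum_(0 <= k < N) cos_coeff x k| <= e.
Proof.
move=> e0; have expc : series (exp_coeff a) n @[n --> \oo] --> expR a.
  exact: is_cvg_series_exp_coeff.
have /cvgrPdist_lt /(_ e e0) [N _ hN] := expc.
exists N => x xa.
have cosc : series (cos_coeff x) n @[n --> \oo] --> cos x.
  by rewrite unlock; exact: is_cvg_series_cos_coeff.
have lim : `|series (cos_coeff x) n - series (cos_coeff x) N| @[n --> \oo] -->
    `|cos x - series (cos_coeff x) N|.
  by apply: cvg_norm; apply: cvgB => //; exact: cvg_cst.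
have limE : (series (exp_coeff a) n - series (exp_coeff a) N) @[n --> \oo] -->
    expR a - series (exp_coeff a) N by apply: cvgB => //; exact: cvg_cst.
apply: (@le_trans _ _ (expR a - series (exp_coeff a) N)); last first.
  by apply: ltW; apply: le_lt_trans (ler_norm _) _; apply: hN => /=.
apply: (ler_cvg_to lim limE); near=> n.
have Nn : (N <= n)%N by near: n; exact: nbhs_infty_ge.
rewrite !sub_series_geq //.
apply: le_trans (ler_norm_sum _ _ _) _; apply: ler_sum => k _.
rewrite /cos_coeff /exp_coeff /= !normrM normfV !normr_nat !normrX normrN normr1 expr1n mulr1.
apply: ler_wpM2r; first by rewrite invr_ge0.
have h : `|x| ^+ k <= a ^+ k.
  by apply: lerXn2r; rewrite ?nnegrE ?(le_trans _ xa).
case: (odd k); rewrite ?mul0r ?mul1r //=.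
by rewrite exprn_ge0 // (le_trans _ xa).
Unshelve. all: end_near. Qed.

End CosineApproximation.

Section NearPart.
Context (R : realType).
Local Notation mu := (@lebesgue_measure R).
Local Notation H := (@hardy R).
Local Notation cl := (@critical_line R).
Local Notation cH := (@hardy_closed R).

Lemma hcompact_sum (I : Type) (r : seq I) (F : I -> R -> R[i]) :
  (forall i, hcompact H (F i)) -> hcompact H (fun t => \sum_(i <- r) F i t).
Proof.
move=> hF; elim: r => [|i r IH].
  rewrite (_ : (fun t => _) = (fun=> 0)); last by apply/funext => t; rewrite big_nil.
  apply: hcompact_of_stable; [exact: cH|exact: bmul_cst|].
  by move=> g Hg; rewrite L2mul_cst scale0r; exact: csub0 cH.
rewrite (_ : (fun t => _) = (fun t => F i t + \sum_(j <- r) F j t)).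
  by apply: hcompact_add; [exact: cH|exact: hF|exact: IH].
by apply/funext => t; rewrite big_cons.
Qed.

Lemma cintegrable_sum (D : set R) (I : Type) (r : seq I) (F : I -> R -> R[i]) :
  measurable D -> (forall i, cintegrable D (F i)) ->
  cintegrable D (fun x => \sum_(i <- r) F i x) /\
  cintegral D (fun x => \sum_(i <- r) F i x) = \sum_(i <- r) cintegral D (F i).
Proof.
move=> mD hF; elim: r => [|i r [IH1 IH2]].
  rewrite (_ : (fun t => _) = (fun=> 0)); last by apply/funext => t; rewrite big_nil.
  rewrite big_nil cintegral0; split=> //.
  have := cintegrable_sub mD (cintegrable_real mD (@integrable0 _ _ R mu D))
    (cintegrable_real mD (@integrable0 _ _ R mu D)).
  by apply: eq_cintegrable => // x _; rewrite subrr.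
rewrite (_ : (fun t => _) = (fun t => F i t + \sum_(j <- r) F j t)); last first.
  by apply/funext => t; rewrite big_cons.
by split; [exact: cintegrable_add|rewrite cintegralD // IH2 big_cons].
Qed.

Lemma cpow_integrable01 (w : R[i]) : 0 < Re w ->
  cintegrable `]0, 1] (fun x => cpow x (w - 1)).
Proof.
move=> w0; apply: le_cintegrable (powR_integrable01 w0) => //.
  by apply: (cmeasurableS measurableT) => //; exact: cpow_measurable.
by move=> x; rewrite /= in_itv /= => /andP[x0 _]; rewrite normc_cpow // Re_sub1.
Qed.

(** The moment of x^(w-1) on (0, 1) is a pole; with w = z + k it lies at -k, in the left
    half-plane. *)
Lemma cpow_pole (w : R[i]) : 0 < Re w ->
  cintegral `]0, 1] (fun x => cpow x (w - 1)) = w^-1.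
Proof.
move=> w0; have w0' : w != 0 by apply: contraTneq w0 => ->; rewrite ltxx.
have inv0 n : 0 < n.+1%:R^-1 :> R by rewrite invr_gt0.
have inv1 n : n.+1%:R^-1 <= 1 :> R by rewrite invf_le1 // ler1n.
have lim1 : normc (cintegral `[n.+1%:R^-1, 1] (fun x => cpow x (w - 1)) -
    cintegral `]0, 1] (fun x => cpow x (w - 1))) @[n --> \oo] --> (0 : R).
  apply: cintegral_exhaust; last exact: cpow_integrable01.
  - by [].
  - by move=> n; exact: measurable_itv.
  - by move=> n x /=; rewrite !in_itv /= => /andP[h ->]; rewrite andbT (lt_le_trans _ h).
  - move=> x; rewrite /= in_itv /= => /andP[x0 xY]; near=> n; rewrite /= in_itv /= xY andbT.
    rewrite -[leRHS]invrK lef_pV2 ?posrE ?invr_gt0 //; apply: (@le_trans _ _ n%:R).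
      by near: n; exact: nbhs_infty_ger.
    by rewrite ler_nat.
apply: (climit_unique lim1).
have h : (n.+1%:R^-1 : R) `^ Re w * normc w^-1 @[n --> \oo] --> (0 : R).
  by rewrite -(mul0r (normc w^-1)); apply: cvgMl; exact: powR_inv_cvg0.
apply: cvg_trans h; apply: near_eq_cvg; apply: nearW => n.
rewrite integral_cpow // cpow1l mulrBl mul1r addrAC subrr add0r normcN normcM.
by rewrite normc_cpow.
Unshelve. all: end_near. Qed.

(** Integrating the Taylor polynomials of the cosine term by term gives sums of poles,
    and the error is uniform on the critical line because x^(z-1) has modulus
    x^(-1/2), which is integrable on (0, 1). *)
Theorem near_part_hcompact (q : R) : 0 < q -> hcompact H (near_part q).
Proof.
move=> q0; have p0 : 0 < pi :> R := pi_gt0 R.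
apply: hcompact_unif => [||e e0]; [exact: cH|exact: near_part_bmul|].
pose W x : R := x `^ (2^-1 - 1).
have Wi : mu.-integrable `]0, 1] (EFin \o W) by apply: powR_integrable01; rewrite invr_gt0.
(* the error of the polynomial is integrated against W; C + 1 is used to divide by a
   positive number *)
pose C := \int[mu]_(x in `]0, 1]) W x.
have C0 : 0 <= C by apply: Rintegral_ge0 => x _; exact: powR_ge0.
have C1 : 0 < C + 1 by rewrite ltr_wpDl.
have d0 : 0 < e / (2 * (C + 1)) by rewrite divr_gt0 // mulr_gt0.
have [N hN] := cos_series_uniform (2 * pi * q) d0.
pose b (k : nat) : R := cos_coeff (2 * pi * q) k.
have bE x k : cos_coeff (2 * pi * q * x) k = b k * x ^+ k.
  by rewrite /b /cos_coeff /= exprMn; ring.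
exists (fun t => \sum_(0 <= k < N) (2 * b k)%:C * ck (2^-1 + k%:R) 0 t).
  apply: hcompact_sum => k; apply: hcompactZ; first exact: cH.
  by apply: hcompact_pole; rewrite ltr_wpDr // invr_gt0.
move=> t; pose z := cl t.
have zk k : 0 < Re (z + k%:R) by rewrite natC Re_add /= ltr_wpDr // invr_gt0.
pose F (k : nat) x : R[i] := (2 * b k)%:C * cpow x (z + k%:R - 1).
have Fi k : cintegrable `]0, 1] (F k) by apply: cintegrableZ => //; exact: cpow_integrable01.
have FI k : cintegral `]0, 1] (F k) = (2 * b k)%:C * ck (2^-1 + k%:R) 0 t.
  rewrite cintegralZ ?cpow_pole //; last exact: cpow_integrable01.
  congr (_ * _); rewrite /ck; congr (_^-1).
  by rewrite natC; apply: complexP; rewrite /= ?subr0 ?addr0.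
have [Si SI] := cintegrable_sum (index_iota 0 N) (measurable_itv `]0, 1]) Fi.
have -> : \sum_(0 <= k < N) (2 * b k)%:C * ck (2^-1 + k%:R) 0 t =
    cintegral `]0, 1] (fun x => \sum_(0 <= k < N) F k x).
  by rewrite SI; apply: eq_bigr => k _; rewrite FI.
have Ki := cos_kernel_cintegrable (Re_cl_gt0 t) q 1.
rewrite -cintegralB //.
have bound x : 0 < x <= 1 -> normc (cos_kernel z q x - \sum_(0 <= k < N) F k x) <=
    e / (C + 1) * W x.
  move=> /andP[x0 x1].
  have -> : cos_kernel z q x - \sum_(0 <= k < N) F k x =
      (2 * (cos (2 * pi * q * x) - \sum_(0 <= k < N) cos_coeff (2 * pi * q * x) k))%:C *
      cpow x (z - 1).
    rewrite /cos_kernel mulrBr rmorphB /= mulrBl; congr (_ - _).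
    rewrite mulr_sumr rmorph_sum /= mulr_suml; apply: eq_bigr => k _.
    rewrite /F (_ : z + k%:R - 1 = (k%:R : R)%:C + (z - 1)); last by rewrite (natC R k); ring.
    rewrite cpowD bE cpow_real // powR_mulrn ?(ltW x0) //.
    by rewrite !rmorphM /=; ring.
  rewrite normcM normcC normc_cpow // Re_sub1; apply: ler_wpM2r; first exact: powR_ge0.
  rewrite normrM ger0_norm //.
  have : `|2 * pi * q * x| <= 2 * pi * q.
    by rewrite ger0_norm ?ler_piMr // !mulr_ge0 // ltW.
  move=> /hN; rewrite invfM mulrA -ler_pdivlMl // => h.
  by rewrite [leRHS](_ : _ = 2^-1 * (e / (C + 1))) //; apply: le_trans h _; rewrite le_eqVlt;
    apply/orP; left; apply/eqP; ring.
have ig := integrable_scaler (e / (C + 1)) (measurable_itv `]0, 1]) Wi.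
have eC0 : 0 <= e / (C + 1) by rewrite divr_ge0 ?ltW.
apply: le_trans (_ : e / (C + 1) * C <= e); last first.
  by rewrite mulrAC ler_pdivrMr // ler_wpM2l ?lerDl // ltW.
rewrite /C -RintegralZl //; apply: normc_cintegral_sub ig => //.
- exact: (cintegrable_sub _ Ki Si).1.
- by move=> x _; rewrite mulr_ge0 ?powR_ge0.
Qed.

Lemma far_part_bmul (q : R) : 0 < q -> bounded_multiplier (far_part q).
Proof.
move=> q0; have qV0 : 0 < q^-1 by rewrite invr_gt0.
have := bmul_sub (bmul_mul (bmul_cpow_cl qV0) (arch_ratio_bmul R)) (near_part_bmul q).
congr bounded_multiplier; apply/funext => t.
rewrite (arch_ratio_dilated q0) mulrA -cpowM // mulVf ?gt_eqF // cpow1l mul1r.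
by rewrite addrK.
Qed.

(** This part even preserves the Hardy space. *)
Theorem far_part_hcompact (q : R) : 0 < q -> hcompact H (far_part q).
Proof.
move=> q0; apply: hcompact_of_stable; [exact: cH|exact: far_part_bmul|].
move=> x Hx.
apply: (hardy_affine_average (measurable_itv _) _ (far_density_measurable q)
  (far_density_integrable q0) (far_part_bmul q0) _ Hx (c := - (sin_ratio q 1)%:C)) => //.
by move=> y; rewrite /= in_itv /= andbT.
Qed.

End NearPart.

(** * The ratios at the primes *)

Section EulerFactors.
Context (R : realType).
Local Notation mu := (@lebesgue_measure R).
Local Notation H := (@hardy R).
Local Notation cl := (@critical_line R).
Local Notation cH := (@hardy_closed R).

(** Stability under the characters is what an induction over the primes needs: the
    expansion of a ratio at p involves all the powers p^(-kz). *)
Definition hcompact_translates (v : R -> R[i]) : Prop :=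
  bounded_multiplier v /\ forall s, hcompact H (fun t => v t * ei s t).

(** The character of parameter s is, up to a constant, q^(-z) with q = exp(-s). *)
Theorem arch_ratio_hcompact : hcompact_translates (@arch_ratio R).
Proof.
split; first exact: arch_ratio_bmul.
move=> s; pose q := expR (- s); have q0 : 0 < q by exact: expR_gt0.
have c0 : (q `^ 2^-1)%:C * (q `^ 2^-1)%:C != 0 :> R[i].
  by rewrite -rmorphM /= eq_complex negb_and /= mulf_neq0 // gt_eqF // powR_gt0.
rewrite (_ : (fun t => _) = (fun t => (q `^ 2^-1)%:C * (far_part q t + near_part q t))).
  apply: hcompactZ; first exact: cH.
  by apply: hcompact_add; [exact: cH|exact: far_part_hcompact|exact: near_part_hcompact].
apply/funext => t; rewrite (arch_ratio_dilated q0) cpow_cl // -!mulrA; congr (_ * _).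
rewrite mulrCA -[RHS]mulr1; congr (_ * _).
by rewrite -eiD /q expRK addNr ei0.
Qed.

(** Here w = p^(-z), and p^(z-1) is its conjugate on the critical line. *)
Lemma prime_ratioE (p : {p : nat | prime p}) : exists2 a : R, 0 < a < 1 &
  forall t, let w := a%:C * ei (- ln (val p)%:R) t in
    local_ratio (Some p) (cl t) = (1 - w^*%C) / (1 - w).
Proof.
have p1 : 1 < (val p)%:R :> R by rewrite ltr1n prime_gt1 // (valP p).
have p0 : 0 < (val p)%:R :> R := lt_trans ltr01 p1.
exists ((val p)%:R `^ (- 2^-1)).
  rewrite powR_gt0 //= powRN invf_lt1 ?powR_gt0 //.
  by rewrite -[ltLHS](powRr0 (val p)%:R) /powR gt_eqF // ltr_expR mul0r mulr_gt0 // ln_gt0.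
move=> t w.
have wE : w = cpow (val p)%:R (- cl t).
  rewrite (_ : - cl t = (- 2^-1) +i* (- t)); last exact: complexP.
  rewrite cpow_critical // /w /ei; congr (_ * cexp (_ +i* _)); ring.
by rewrite wE /local_ratio /= invrK mulrC cl_reflect -conjcN cpow_conj.
Qed.

(** The geometric series of w converges uniformly because |w| is the constant
    p^(-1/2) < 1; each term w^k multiplies v by a character.  The remainder after N
    terms is exactly w^N times the ratio, which has modulus one. *)
Theorem prime_ratio_hcompact (p : {p : nat | prime p}) (v : R -> R[i]) :
  (forall t, normc (local_ratio (Some p) (cl t)) = 1) /\
  (hcompact_translates v -> hcompact_translates (fun t => v t * local_ratio (Some p) (cl t))).
Proof.
have [a /andP[a0 a1]] := prime_ratioE p.
set L := ln _; pose w t : R[i] := a%:C * ei (- L) t => E.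
have {}E t : local_ratio (Some p) (cl t) = (1 - (w t)^*%C) / (1 - w t) := E t.
have nw t : normc (w t) = a by rewrite /w normcM normcC normc_ei mulr1 ger0_norm // ltW.
have w1 t : 1 - w t != 0.
  rewrite subr_eq0; apply/eqP => h; have := nw t; rewrite -h.
  by rewrite (normcC (1 : R)) normr1 => h1; move: a1; rewrite -h1 ltxx.
have u1 t : normc (local_ratio (Some p) (cl t)) = 1.
  have -> : local_ratio (Some p) (cl t) = (1 - w t)^*%C / (1 - w t).
    by rewrite E conjcB (rmorph1 (@conjc R)).
  by rewrite normcM normcV normc_conj divff // normc_eq0 w1.
split; first exact: u1.
move=> [bv hv].
have bw : bounded_multiplier w by exact: bmul_mul (bmul_cst _) (bmul_ei _).
have wc t : (w t)^*%C = a%:C * ei L t.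
  rewrite /w conjcM /ei -cexp_conj; congr (_ * cexp _);
    by apply: complexP; rewrite /= ?mulNr ?opprK ?oppr0.
have bwc : bounded_multiplier (fun t => (w t)^*%C).
  rewrite (_ : (fun t => _) = (fun t => a%:C * ei L t)); last exact/funext.
  exact: bmul_mul (bmul_cst _) (bmul_ei _).
have br : bounded_multiplier (fun t => local_ratio (Some p) (cl t)).
  split; last by exists 1 => t; rewrite u1.
  rewrite (_ : (fun t => _) = (fun t => (1 - (w t)^*%C) * (1 - w t)^-1)); last exact/funext.
  apply: cmeasurable_mul; first exact: (bmul_sub (bmul_cst 1) bwc).1.
  by apply: cmeasurable_inv => //; exact: (bmul_sub (bmul_cst 1) bw).1.
split; first exact: bmul_mul.
move=> s; apply: hcompact_unif => [||e e0]; [exact: cH| |].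
  exact: bmul_mul (bmul_mul bv br) (bmul_ei s).
have [M hM] := bv.2.
have M0 : 0 <= M := le_trans (normc_ge0 (v 0)) (hM 0).
have [N hN] : exists N : nat, M * a ^+ N <= e.
  have h : M * a ^+ n @[n --> \oo] --> (0 : R).
    rewrite -(mulr0 M); apply: cvgMr; apply: cvg_expr.
    by rewrite ger0_norm // ltW.
  have /cvgrPdist_lt /(_ e e0) [N _ /(_ N)] := h; rewrite sub0r normrN => hN.
  by exists N; apply: le_trans (ler_norm _) _; apply: ltW; apply: hN => /=.
exists (fun t => \sum_(0 <= k < N) (a ^+ k)%:C * (v t * ei (s - k%:R * L) t +
    (- a)%:C * (v t * ei (s - k%:R * L + L) t))).
  apply: hcompact_sum => k; apply: hcompactZ; first exact: cH.
  apply: hcompact_add; [exact: cH|exact: hv|].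
  by apply: hcompactZ; [exact: cH|exact: hv].
move=> t.
have wk k : w t ^+ k = (a ^+ k)%:C * ei (- (k%:R * L)) t.
  elim: k => [|k IH]; first by rewrite !expr0 mul0r oppr0 ei0 mulr1.
  rewrite !exprS IH /w rmorphM /= -natr1 mulrDl mul1r opprD eiD; ring.
have term k : (a ^+ k)%:C * (v t * ei (s - k%:R * L) t + (- a)%:C * (v t * ei (s - k%:R * L + L) t))
    = v t * ei s t * (1 - (w t)^*%C) * w t ^+ k.
  by rewrite wk wc !eiD rmorphN /=; ring.
under eq_bigr do rewrite term.
rewrite -mulr_sumr big_mkord.
have geo : \sum_(i < N) w t ^+ i = (1 - w t ^+ N) / (1 - w t).
  apply: (mulIf (w1 t)); rewrite divfK // mulrC.
  have := subrX1 (w t) N; move: (\sum_(i < N) _) (w t ^+ N) => S W h.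
  by rewrite -opprB mulNr -h opprB.
rewrite geo E.
rewrite (_ : _ - _ = v t * ei s t * w t ^+ N * ((1 - (w t)^*%C) / (1 - w t))); last first.
  by have := w1 t; move: (w t ^+ N) => W n0; field.
rewrite -E normcM u1 mulr1 2!normcM normc_ei mulr1 normcX nw.
by apply: le_trans hN; apply: ler_wpM2r; [rewrite exprn_ge0 // ltW|exact: hM].
Qed.

Lemma finite_norm_unimodular (u : R -> R[i]) : (forall t, normc (u t) = 1) ->
  finite_norm mu +oo%E (@normc R \o u).
Proof.
move=> u1; rewrite /finite_norm unlock; case: ifP => // _.
apply: (@le_lt_trans _ _ 1%:E); last exact: ltry.
by apply/ess_supP; apply: nearW => t /=; rewrite u1 normr1.
Qed.

Theorem quasi_inner_of_hcompact (u : R -> R[i]) : (forall t, normc (u t) = 1) ->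
  hcompact H u -> quasi_inner u.
Proof.
move=> u1 hu; split.
- exact: hu.1.1.
- exact: finite_norm_unimodular.
- by apply: aeW => t; rewrite conjcK_mul u1 expr1n.
- exact: (hcompact_compact cH hu).
Qed.

Lemma ratio_prod_hcompact (s : seq place) : all (fun p => p != archimedean) s ->
  (forall t, normc (arch_ratio t * \prod_(p <- s) local_ratio p (cl t)) = 1) /\
  hcompact_translates (fun t => arch_ratio t * \prod_(p <- s) local_ratio p (cl t)).
Proof.
elim: s => [_|p s IH /= /andP[pa /IH[h1 h2]]].
  have E : (fun t => arch_ratio t * \prod_(p <- [::]) local_ratio p (cl t)) = @arch_ratio R.
    by apply/funext => t; rewrite big_nil mulr1.
  rewrite E; split; last exact: arch_ratio_hcompact.
  by move=> t; rewrite big_nil mulr1 normc_arch_ratio.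
case: p pa => [p _|//].
have E : (fun t => arch_ratio t * \prod_(j <- Some p :: s) local_ratio j (cl t)) =
    (fun t => (arch_ratio t * \prod_(j <- s) local_ratio j (cl t)) * local_ratio (Some p) (cl t)).
  by apply/funext => t; rewrite big_cons mulrCA mulrC.
have [u1 hc] := prime_ratio_hcompact p (fun t => arch_ratio t * \prod_(j <- s) local_ratio j (cl t)).
rewrite E; split; last exact: hc.
by move=> t; rewrite big_cons mulrCA normcM u1 mul1r h1.
Qed.

End EulerFactors.

Theorem theorem4p1 (R : realType) (m : nat) (F : {fset place})
    (hF : archimedean \in F) (hm : #|` (F `\ archimedean)%fset| = m) :
  quasi_inner (fun t : R => ratio_product F (critical_line t)).
Proof.
have Fp : all (fun p => p != archimedean) (enum_fset (F `\ archimedean)%fset).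
  by apply/allP => p; rewrite in_fsetD1 => /andP[].
have [u1 [_ hu]] := ratio_prod_hcompact R Fp.
apply: quasi_inner_of_hcompact; first exact: u1.
have := hu 0; congr hcompact; apply/funext => t.
by rewrite ei0 mulr1.
Qed.
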